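(* Consider the doubly robust generalized U estimating function $\sum_{i<j}\mathbf G_{ij}(\mathbf h_{ij}-\mathbf f_{ij})$ defined in the context, and write $\mathbf u_{ij}=\mathbf G_{ij}(\mathbf h_{ij}-\mathbf f_{ij})$, $\mathbf B_{ij}=\mathbf G_{ij}\mathbf M_{ij}$, $B=E(\mathbf B_{ij})$, $\Sigma=\mathrm{Var}(E(\mathbf u_{ij}\mid O_i))$ and $V=4B^{-1}\Sigma B^{-T}$. Under sub-Gaussian tails, the anchor–partner Monte Carlo scheme with $s$ anchors and $m$ partners per anchor (described in the context) yields $$\hat B-B=O_p(s^{-1/2})+O_p((sm)^{-1/2})+O_p(n^{-1/2}),$$ $$\hat\Sigma-\Sigma=O_p(s^{-1/2})+O_p(n^{-1/2})+O(m^{-1})+O(n^{-1}),$$ where $\hat\Sigma$ is the estimator without de-biasing. With de-biasing, the $O(m^{-1})$ term vanishes. The variance estimator $\hat V=4\,\hat B^{-1}\hat\Sigma\hat B^{-T}$ inherits the same rate. In particular, choosing $s$ proportional to $n$ gives, with de-biasing, $$\hat V-V=O_p(n^{-1/2}),$$ the same rate as that of the estimator based on all $O(n^2)$ pairs.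
   Context: Data: units $i=1,\dots,n$ are i.i.d.; unit $i$ has treatment $z_i\in\{0,1\}$, covariates $w_{it}$ and potential outcomes $y_{it1},y_{it0}$ at times $t=1,\dots,T$ ($T\ge1$; $T=1$ is the snapshot case); $O_i$ denotes the data of unit $i$, $\mathbf w_i=[w_{i1}^T,\dots,w_{iT}^T]^T$. One observes $y_{it}=z_iy_{it1}+(1-z_i)y_{it0}$. Unconfoundedness (potential outcomes $\perp z_i\mid\mathbf w_i$) holds and $0<E(z_i\mid\mathbf w_i)<1$. Target and models: $\varphi:\mathbb R\to\mathbb R$ is monotonic with $E[\varphi^2(y_{it1}-y_{jt0})]<\infty$; $\delta_t=E[\varphi(y_{it1}-y_{jt0})]$ for $i\neq j$, $\boldsymbol\delta=(\delta_t)_t$; $\pi_i=\pi(\mathbf w_i;\beta)=\phi([1,\mathbf w_i^T]\beta)$ models $E(z_i\mid\mathbf w_i)$; $g_{ijt}=g(w_{it},w_{jt};\gamma_t)=\psi([1,w_{it}^T,w_{jt}^T]\gamma_t)$ models $E(\varphi(y_{it1}-y_{jt0})\mid w_{it},w_{jt})$, with link functions $\phi,\psi$; $\mathbf g_{ij}=(g_{ijt})_t$, $\boldsymbol\varphi_{ij}=(\varphi(y_{it1}-y_{jt0}))_t$; $\theta=(\boldsymbol\delta,\beta,\gamma_1,\dots,\gamma_T)$. Estimating function: $\mathbf h_{ij}=[\mathbf h_{ij1}^T,h_{ij2},\mathbf h_{ij3}^T]^T$, $\mathbf f_{ij}=[\mathbf f_{ij1}^T,f_{ij2},\mathbf f_{ij3}^T]^T$,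 where $\mathbf h_{ij1}$ has $t$-th entry $$\tfrac{z_i(1-z_j)}{2\pi_i(1-\pi_j)}(\varphi(y_{it1}-y_{jt0})-g_{ijt})+\tfrac{z_j(1-z_i)}{2\pi_j(1-\pi_i)}(\varphi(y_{jt1}-y_{it0})-g_{jit})+\tfrac{g_{ijt}+g_{jit}}2,$$ $h_{ij2}=z_i+z_j$, $\mathbf h_{ij3}=z_i(1-z_j)\boldsymbol\varphi_{ij}+z_j(1-z_i)\boldsymbol\varphi_{ji}$, $\mathbf f_{ij1}=\boldsymbol\delta$, $f_{ij2}=\pi_i+\pi_j$, $\mathbf f_{ij3}=\pi_i(1-\pi_j)\mathbf g_{ij}+\pi_j(1-\pi_i)\mathbf g_{ji}$; $\mathbf G_{ij}=\mathbf D_{ij}^T\mathbf V_{ij}^{-1}$, $\mathbf D_{ij}=\partial\mathbf f_{ij}/\partial\theta$, $\mathbf M_{ij}=\partial(\mathbf f_{ij}-\mathbf h_{ij})/\partial\theta$, $\mathbf V_{ij}=A\,\mathbf R(\alpha_R)A$ with $A$ the diagonal matrix of conditional standard deviations of the entries of $\mathbf h_{ij}$ given $(\mathbf w_i,\mathbf w_j)$ and $\mathbf R(\alpha_R)$ a working correlation matrix (the identity when $T=1$). At the true parameter $E(\mathbf u_{ij})=0$, and $B$ is invertible. Anchor–partner scheme: given the estimate $\hat\theta$ (a $\sqrt n$-consistent solution of the estimating equation, at which all quantities below are evaluated), sample $s$ anchor indices $I$ uniformly from $\{1,\dots,n\}$; for each anchor $i\in I$ sample $m$ partner indices $J_i\subset\{1,\dots,n\}\setminus\{i\}$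 uniformly without replacement; set $\bar{\mathbf u}_i=\frac1m\sum_{j\in J_i}\mathbf u_{ij}$, $\hat\Sigma_i^{\mathrm{within}}=\frac1{m-1}\sum_{j\in J_i}(\mathbf u_{ij}-\bar{\mathbf u}_i)(\mathbf u_{ij}-\bar{\mathbf u}_i)^T$, and $$\hat B=\frac1s\sum_{i\in I}\frac1m\sum_{j\in J_i}\mathbf B_{ij},\qquad\hat\Sigma=\frac1s\sum_{i\in I}\bar{\mathbf u}_i\bar{\mathbf u}_i^T-\alpha\Bigl(\frac1m-\frac1{n-1}\Bigr)\frac1s\sum_{i\in I}\hat\Sigma_i^{\mathrm{within}}.$$ ''Without de-biasing'' means $\alpha=0$; ''with de-biasing'' means $\alpha=1$. ''Sub-Gaussian tails'' means that the entries of $\mathbf u_{ij}$ and $\mathbf B_{ij}$ are sub-Gaussian. An equality such as $\hat\Sigma-\Sigma=O_p(a_n)+O(b_n)$ means the difference is a sum of terms of the indicated (stochastic or deterministic) orders; ''inherits the same rate'' means that the error $\hat V-V$ is bounded by the sum of the orders appearing for $\hat B-B$ and $\hat\Sigma-\Sigma$ (without the $O(m^{-1})$ term when de-biased).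
   Formalization: Added: near the true θ, u_ij and B_ij are Lipschitz in θ with a square-integrable constant (the claim fails otherwise, e.g. if a link's derivative is only Hölder); links are differentiable, the propensity link has values in (0,1); rates of V̂ are for s→∞, de-biasing for m≥2. *)

(* Defs.v *)
From HB Require Import structures.
From mathcomp Require Import all_boot all_order all_algebra.
From mathcomp Require Import all_classical all_reals all_analysis.

Set Implicit Arguments.
Unset Strict Implicit.
Unset Printing Implicit Defensive.

Import Order.TTheory GRing.Theory Num.Theory.
Import numFieldNormedType.Exports.

Local Open Scope classical_set_scope.
Local Open Scope ring_scope.

Section Probability.
Context {d : measure_display} {Omega : measurableType d} {R : realType}.
Variable P : probability Omega R.

(* X_r = O_p(a_r).  Only the existence of a large measurable event is asked
   for, so X_r need not be known to be measurable. *)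
Definition bigOp (V : normedModType R) (X : nat -> Omega -> V) (a : nat -> R) :=
  forall eps : R, 0 < eps -> exists C : R, \forall r \near \oo,
    exists E : set Omega, [/\ measurable E, ((1 - eps)%:E <= P E)%E &
      forall omega, E omega -> `|X r omega| <= C * a r].

Definition wp_to_one (A : nat -> set Omega) :=
  forall eps : R, 0 < eps -> \forall r \near \oo,
    exists E : set Omega,
      [/\ measurable E, ((1 - eps)%:E <= P E)%E & E `<=` A r].

(* The psi_2 (Orlicz) norm of X is finite. *)
Definition sub_gaussian (X : Omega -> R) :=
  exists2 K : R, 0 < K &
    ('E_P[fun omega => (expR ((X omega / K) ^+ 2))%R] <= 2%:E)%E.

Section Conditioning.
Context {d' : measure_display} {E : measurableType d'}.
Variable W : Omega -> E.

(* c o W is a version of E(X | W), for X >= 0; both sides may be +oo. *)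
Definition cond_exp_ge0 (X : Omega -> R) (c : E -> R) :=
  [/\ measurable_fun setT c, (forall x, 0 <= c x) &
    forall S : set E, measurable S ->
      (\int[P]_(omega in W @^-1` S) (X omega)%:E =
       \int[P]_(omega in W @^-1` S) (c (W omega))%:E)%E].

(* c o W is a version of E(X | W) = E(X^+ | W) - E(X^- | W), whenever the two
   terms are a.s. finite; X itself need not be integrable. *)
Definition cond_exp (X : Omega -> R) (c : E -> R) :=
  exists cp cn : E -> R,
    [/\ cond_exp_ge0 (fun omega => Num.max (X omega) 0) cp,
        cond_exp_ge0 (fun omega => Num.max (- X omega) 0) cn &
        forall x, c x = cp x - cn x].

(* sigma o W is a version of the conditional standard deviation of X. *)
Definition cond_sd (X : Omega -> R) (sigma : E -> R) :=
  (forall x, 0 <= sigma x) /\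
  exists2 mu : E -> R, cond_exp X mu &
    cond_exp (fun omega => (X omega - mu (W omega)) ^+ 2)
             (fun x => sigma x ^+ 2).

Definition cond_indep {d1 d2 : measure_display} {E1 : measurableType d1}
    {E2 : measurableType d2} (X : Omega -> E1) (Y : Omega -> E2) :=
  forall (A : set E1) (B : set E2) (a b : E -> R),
    measurable A -> measurable B ->
    cond_exp (\1_(X @^-1` A) : Omega -> R) a ->
    cond_exp (\1_(Y @^-1` B) : Omega -> R) b ->
    cond_exp (\1_(X @^-1` A `&` Y @^-1` B) : Omega -> R)
             (fun x => a x * b x).

End Conditioning.

Definition iid {d' : measure_display} {E : measurableType d'}
    (X : nat -> Omega -> E) :=
  [/\ (forall i, measurable_fun setT (X i)),
      (forall i (A : set E), measurable A ->
         P (X i @^-1` A) = P (X 0%N @^-1` A)) &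
      (forall (n : nat) (A : 'I_n -> set E), (forall i, measurable (A i)) ->
         P [set omega | forall i : 'I_n, A i (X i omega)] =
         (\prod_(i < n) P (X i @^-1` A i))%E)].

End Probability.

Notation covariates R T p := (T.-tuple (p.-tuple R)) (only parsing).

(* (z, w, (y1, y0)): treatment, covariates, potential outcomes over time. *)
Notation unit_data R T p :=
  (bool * T.-tuple (p.-tuple R) * (T.-tuple R * T.-tuple R))%type
  (only parsing).

(* (z, w, y) *)
Notation unit_obs R T p := (bool * T.-tuple (p.-tuple R) * T.-tuple R)%type
  (only parsing).

(* Length of theta = (delta, beta, gamma_1, ..., gamma_T). *)
Notation dim_theta T p := (T + ((1 + T * p) + T * (1 + (p + p))))%N.

(* Length of h_ij and f_ij. *)
Notation dim_h T := (T + (1 + T))%N.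

Section Units.
Context {R : realType} {T p : nat}.
Implicit Types (o : unit_data R T p) (w : covariates R T p).

Definition trt o : bool := o.1.1.
Definition cov o : covariates R T p := o.1.2.
Definition pot o : T.-tuple R * T.-tuple R := o.2.
Definition y1 o (t : 'I_T) : R := tnth o.2.1 t.
Definition y0 o (t : 'I_T) : R := tnth o.2.2 t.
Definition trtR o : R := (trt o)%:R.

Definition observe o : unit_obs R T p :=
  (trt o, cov o,
   [tuple trtR o * y1 o t + (1 - trtR o) * y0 o t | t < T]).

Definition cov_mx w : 'M[R]_(T, p) := \matrix_(t, k) tnth (tnth w t) k.

End Units.

(* Ingredients of the estimating function: the contrast function varphi, the
   links of pi and g, the map (theta, w_i, w_j) |-> standard deviations of the
   entries of h_ij given (w_i, w_j), and the working correlation R(alpha_R). *)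
Record gee_model (R : realType) (T p : nat) := GeeModel {
  varphi : R -> R;
  link_pi : R -> R;
  link_g : R -> R;
  sd_h : 'rV[R]_(dim_theta T p) -> covariates R T p * covariates R T p ->
         'I_(dim_h T) -> R;
  work_corr : 'M[R]_(dim_h T)
}.

Section EstimatingFunction.
Context {R : realType} {T p : nat}.
Variable G : gee_model R T p.
Implicit Types (theta : 'rV[R]_(dim_theta T p)) (w : covariates R T p)
  (o : unit_data R T p).

Definition delta_of theta : 'rV[R]_T := lsubmx theta.
Definition beta_of theta : 'rV[R]_(1 + T * p) := lsubmx (rsubmx theta).
Definition gamma_of theta : 'M[R]_(T, 1 + (p + p)) :=
  vec_mx (rsubmx (rsubmx theta)).

Definition prop_model theta w : R :=
  link_pi G ((row_mx (1%:M : 'M[R]_1) (mxvec (cov_mx w)) *m (beta_of theta)^T) 0 0).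

Definition outcome_model theta w w' (t : 'I_T) : R :=
  link_g G ((row_mx (1%:M : 'M[R]_1) (row_mx (row t (cov_mx w)) (row t (cov_mx w')))
             *m (row t (gamma_of theta))^T) 0 0).

Definition contrast o o' (t : 'I_T) : R := varphi G (y1 o t - y0 o' t).

Definition h_fun theta o o' : 'cV[R]_(dim_h T) :=
  let z := trtR o in let z' := trtR o' in
  let q := prop_model theta (cov o) in let q' := prop_model theta (cov o') in
  let g t := outcome_model theta (cov o) (cov o') t in
  let g' t := outcome_model theta (cov o') (cov o) t in
  col_mx
    (\col_t (z * (1 - z') / (2 * q * (1 - q')) * (contrast o o' t - g t)
           + z' * (1 - z) / (2 * q' * (1 - q)) * (contrast o' o t - g' t)
           + (g t + g' t) / 2))
  (col_mx
    (\col_(_ < 1) (z + z'))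
    (\col_t (z * (1 - z') * contrast o o' t + z' * (1 - z) * contrast o' o t))).

Definition f_fun theta w w' : 'cV[R]_(dim_h T) :=
  let q := prop_model theta w in let q' := prop_model theta w' in
  col_mx (delta_of theta)^T
  (col_mx
    (\col_(_ < 1) (q + q'))
    (\col_t (q * (1 - q') * outcome_model theta w w' t
           + q' * (1 - q) * outcome_model theta w' w t))).

(* The matrix of partial derivatives of F with respect to the entries of
   theta; one row per entry of F. *)
Definition jac (F : 'rV[R]_(dim_theta T p) -> 'cV[R]_(dim_h T)) theta
    : 'M[R]_(dim_h T, dim_theta T p) :=
  \matrix_(k, l) 'D_(delta_mx 0 l) (fun x => F x k 0) theta.

Definition V_mx theta w w' : 'M[R]_(dim_h T) :=
  let A := diag_mx (\row_k sd_h G theta (w, w') k) in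
  A *m work_corr G *m A.

Definition G_mx theta w w' : 'M[R]_(dim_theta T p, dim_h T) :=
  (jac (fun x => f_fun x w w') theta)^T *m invmx (V_mx theta w w').

Definition u_fun theta o o' : 'cV[R]_(dim_theta T p) :=
  G_mx theta (cov o) (cov o') *m
    (h_fun theta o o' - f_fun theta (cov o) (cov o')).

Definition B_fun theta o o' : 'M[R]_(dim_theta T p) :=
  G_mx theta (cov o) (cov o') *m
    jac (fun x => f_fun x (cov o) (cov o') - h_fun x o o') theta.

End EstimatingFunction.

Definition correlation_mx (R : realType) (q : nat) (C : 'M[R]_q) :=
  [/\ C^T = C, (forall k, C k k = 1) &
      forall v : 'rV[R]_q, v != 0 -> 0 < (v *m C *m v^T) 0 0].

Section Population.
Context {d : measure_display} {Omega : measurableType d} {R : realType}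
  {T p : nat}.
Variables (P : probability Omega R) (G : gee_model R T p)
  (O : nat -> Omega -> unit_data R T p).

(* Local mean-square Lipschitz continuity in theta of u_ij and B_ij, on a
   measurable set of pairs of full probability. *)
Definition local_L2_lipschitz (theta0 : 'rV[R]_(dim_theta T p)) :=
  exists (rho : R) (N : set (unit_data R T p * unit_data R T p))
         (L : unit_data R T p * unit_data R T p -> R),
    [/\ 0 < rho,
        measurable N /\ P [set omega | N (O 0%N omega, O 1%N omega)] = 1%E,
        measurable_fun setT L,
        ('E_P[fun omega => (L (O 0%N omega, O 1%N omega) ^+ 2)%R] < +oo)%E &
        forall o o' theta, N (o, o') -> `|theta - theta0| <= rho ->
          `|u_fun G theta o o' - u_fun G theta0 o o'|
             <= L (o, o') * `|theta - theta0| /\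
          `|B_fun G theta o o' - B_fun G theta0 o o'|
             <= L (o, o') * `|theta - theta0|].

Definition B_pop (theta0 : 'rV[R]_(dim_theta T p)) : 'M[R]_(dim_theta T p) :=
  \matrix_(k, l)
    fine 'E_P[fun omega => B_fun G theta0 (O 0%N omega) (O 1%N omega) k l].

(* Var(eta(O_i)), to be used with eta(O_i) a version of E(u_ij | O_i). *)
Definition Sigma_pop (eta : unit_data R T p -> 'cV[R]_(dim_theta T p))
    : 'M[R]_(dim_theta T p) :=
  \matrix_(k, l)
    fine (covariance P (fun omega => eta (O 0%N omega) k 0)
                       (fun omega => eta (O 0%N omega) l 0)).

End Population.

Definition sandwich (R : realType) (q : nat) (B Sigma : 'M[R]_q) : 'M[R]_q :=
  4 *: (invmx B *m Sigma *m (invmx B)^T).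

(* s anchor draws together with the partner set of each draw. *)
Notation design n s :=
  ({ffun 'I_s -> 'I_n} * {ffun 'I_s -> {set 'I_n}})%type.

(* The admissible designs; repl tells whether the anchors are drawn with
   replacement.  A uniformly distributed element of this set consists of
   uniform anchors and, given these, independent uniform m-subsets. *)
Definition designs (repl : bool) (n s m : nat) : {set design n s} :=
  [set D : design n s |
    [&& repl || injectiveb D.1,
        [forall a, #|D.2 a| == m] &
        [forall a, D.1 a \notin D.2 a]]]%SET.

Section Estimators.
Context {R : realType} {T p : nat}.
Variables (G : gee_model R T p) (n : nat) (x : 'I_n -> unit_data R T p)
  (theta : 'rV[R]_(dim_theta T p)).

Definition est_eq : 'cV[R]_(dim_theta T p) :=
  \sum_(i < n) \sum_(j < n | (i < j)%N) u_fun G theta (x i) (x j).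

Section AnchorPartner.
Variables (s m : nat) (D : design n s).

Definition u_bar (a : 'I_s) : 'cV[R]_(dim_theta T p) :=
  m%:R^-1 *: \sum_(j in D.2 a) u_fun G theta (x (D.1 a)) (x j).

Definition Sigma_within (a : 'I_s) : 'M[R]_(dim_theta T p) :=
  (m%:R - 1)^-1 *: \sum_(j in D.2 a)
    (u_fun G theta (x (D.1 a)) (x j) - u_bar a) *m
    (u_fun G theta (x (D.1 a)) (x j) - u_bar a)^T.

Definition B_hat : 'M[R]_(dim_theta T p) :=
  s%:R^-1 *: \sum_(a < s) m%:R^-1 *:
    \sum_(j in D.2 a) B_fun G theta (x (D.1 a)) (x j).

Definition Sigma_hat (alpha : R) : 'M[R]_(dim_theta T p) :=
  s%:R^-1 *: (\sum_(a < s) u_bar a *m (u_bar a)^T)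
  - (alpha * (m%:R^-1 - (n%:R - 1)^-1)) *:
      (s%:R^-1 *: \sum_(a < s) Sigma_within a).

Definition V_hat (alpha : R) : 'M[R]_(dim_theta T p) :=
  sandwich B_hat (Sigma_hat alpha).

End AnchorPartner.

Definition B_full : 'M[R]_(dim_theta T p) :=
  n%:R^-1 *: \sum_(i < n) (n%:R - 1)^-1 *:
    \sum_(j < n | j != i) B_fun G theta (x i) (x j).

Definition u_full (i : 'I_n) : 'cV[R]_(dim_theta T p) :=
  (n%:R - 1)^-1 *: \sum_(j < n | j != i) u_fun G theta (x i) (x j).

Definition Sigma_full : 'M[R]_(dim_theta T p) :=
  n%:R^-1 *: \sum_(i < n) u_full i *m (u_full i)^T.

Definition V_full : 'M[R]_(dim_theta T p) := sandwich B_full Sigma_full.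

End Estimators.

(* n^(-1/2) *)
Definition rsqrt (R : realType) (n : nat) : R := (Num.sqrt n%:R)^-1.
Arguments rsqrt {R} n.

(* Main.v *)
(** The entries of [B_hat] and [Sigma_hat] at the true parameter are averages
    over the anchors of functions of (anchor, partner set).  Conditionally on
    the data, their mean is the average over all anchors and all partner sets,
    and their variance is at most 1/s times the average of the squares: this is
    the O_p(s^(-1/2)) term.  The population averages are themselves
    U-statistics: writing Q for the mean of u_ij u_ij^T and W for that of
    u_ij u_ik^T with distinct i, j, k, the average attached to [Sigma_hat] is
    W + c (Q - W), with c = 1/m without de-biasing and c = 1/(n-1) with it.  A
    U-statistic deviates from its mean by O_p(n^(-1/2)), and E(W) = Sigma by
    conditioning on O_i.  Replacing the true parameter by its estimate costs
    |theta_hat - theta0| times an anchor average with bounded mean, by the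
    local Lipschitz condition.  The rate of [V_hat] follows because the
    sandwich is locally Lipschitz, and [V_full] is the special case of the
    deterministic design in which every unit is an anchor once and has all
    other units as partners. *)

Require Import Defs.
From HB Require Import structures.
From mathcomp Require Import all_boot all_order all_algebra.
From mathcomp Require Import perm ring lra.
From mathcomp Require Import all_classical all_reals all_analysis.
From mathcomp Require Import measurable_realfun.

Set Implicit Arguments.
Unset Strict Implicit.
Unset Printing Implicit Defensive.

Import Order.TTheory GRing.Theory Num.Theory.
Import numFieldNormedType.Exports.

Local Open Scope classical_set_scope.
Local Open Scope ring_scope.

(** * Uniform designs and their sampling moments *)

(** Exact sampling moments come from symmetry: a count invariant under permutations of the units is
    constant on units and on pairs of distinct units, hence determined by its total. The variance
    bound has to cover anchors drawn with and without replacement; what the two share is that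
    centred values at different draws have a nonpositive mean product. The sub-Gaussian tails enter
    through moments only, the second for [B_fun] and the fourth for [u_fun], because [Sigma_hat] is
    quadratic in u and Chebyshev's inequality squares it once more. The main obstacle is that the
    estimate of theta depends on the data, while the Lipschitz bound holds only near the true
    parameter and for almost all pairs. Every moment is therefore computed at the true parameter,
    where the kernel is fixed and the design is independent of the sample, and the estimators are
    compared with that situation on events whose probability tends to 1. A second obstacle is that
    conditional expectations are given only by their integrals over preimages; they have to be
    identified with section integrals before Fubini's theorem yields E(W) = Sigma. *)

Lemma tperm_invariant2 (T : finType) (U : Type) (A : pred T) (F : T -> T -> U) :
  (forall x y j k, A x -> A y -> F (tperm x y j) (tperm x y k) = F j k) ->
  forall j k j' k', A j -> A k -> A j' -> A k' -> j != k -> j' != k' ->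
  F j k = F j' k'.
Proof.
move=> FP j k j' k' Aj Ak Aj' Ak' jk j'k'.
(* The second transposition exchanges [k1] and [k']; it fixes [j'], which differs from both. *)
rewrite -(FP j j' j k)// tpermL; set k1 := tperm j j' k.
have Ak1 : A k1 by rewrite /k1; case: tpermP.
have k1j' : k1 != j' by rewrite -(tpermL j j') (inj_eq perm_inj) eq_sym.
by rewrite -(FP k1 k' j' k1)// tpermL tpermD// eq_sym.
Qed.

Section Others.
Context {R : pzRingType} {n : nat}.
Implicit Types i j k : 'I_n.

Lemma card_others i : #|[pred j | j != i]| = n.-1.
Proof. by have := cardC (pred1 i); rewrite card1 card_ord => /(congr1 predn). Qed.

Lemma card_others2 i j : j != i -> #|[pred k | (k != i) && (k != j)]| = n.-2.
Proof.
move=> ji; have := cardC (mem [set i; j]%SET); rewrite cards2 [i == j]eq_sym ji card_ord.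
move=> /(congr1 (fun k : nat => k.-2)) <- /=.
by apply: eq_card => k; rewrite !inE negb_or.
Qed.

Lemma sum_cst_others i (c : R) : \sum_(j < n | j != i) c = (n%:R - 1) * c.
Proof.
rewrite sumr_const card_others -[LHS]mulr_natl; congr (_ * _).
by rewrite -subn1 natrB//; case: n i => // -[].
Qed.

Lemma sum_cst_others2 i j (c : R) : j != i ->
  \sum_(k < n | (k != i) && (k != j)) c = (n%:R - 2) * c.
Proof.
move=> ji; rewrite sumr_const card_others2// -[LHS]mulr_natl; congr (_ * _).
rewrite -subn2 natrB//; have := ltn_ord i; have := ltn_ord j.
by move: ji; rewrite -val_eqE /=; case: n i j => [|[|n']] [[|i] ?] [[|j] ?].
Qed.

End Others.

Section Partners.
Context {R : realFieldType}.
Variables (n m : nat).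
Hypotheses (m_gt0 : (0 < m)%N) (m_lt : (m < n)%N).
Implicit Types (i j k : 'I_n) (J : {set 'I_n}).

Definition partners i : {set {set 'I_n}} :=
  [set J : {set 'I_n} | (#|J| == m) && (i \notin J)]%SET.

Definition partner_avg i (f : {set 'I_n} -> R) : R :=
  #|partners i|%:R^-1 * \sum_(J in partners i) f J.

Lemma card_partners i : #|partners i| = 'C(n.-1, m).
Proof.
have -> : n.-1 = #|(~: [set i])%SET| by rewrite cardsCs finset.setCK cards1 card_ord subn1.
rewrite -cards_draws; apply: eq_card => J; rewrite !inE andbC.
by rewrite finset.subsetC finset.sub1set inE.
Qed.

Lemma partners_neq0 i : #|partners i|%:R != 0 :> R.
Proof. by rewrite pnatr_eq0 card_partners -lt0n bin_gt0; case: n m_lt i => // -[]. Qed.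

Lemma partner_sum_perm i (s : {perm 'I_n}) (f : {set 'I_n} -> R) : s i = i ->
  \sum_(J in partners i) f [set s j | j in J]%SET = \sum_(J in partners i) f J.
Proof.
move=> si; rewrite [RHS](reindex_inj (imset_inj (@perm_inj _ s))) /=.
apply: eq_bigl => J; rewrite !inE card_imset; last exact: perm_inj.
by rewrite -{2}si mem_imset//; exact: perm_inj.
Qed.

Let n1_neq0 : n%:R - 1 != 0 :> R.
Proof. by rewrite subr_eq0 (eqr_nat R n 1); case: n m_lt => [|[|]]//; case: m m_gt0. Qed.

(** Membership indicators turn a sum over a varying set into one over fixed indices, which can be
    exchanged with the sum over [J]. *)
Lemma sum_mem i J (a : 'I_n -> R) : J \in partners i ->
  \sum_(j in J) a j = \sum_(j < n | j != i) (j \in J)%:R * a j.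
Proof.
rewrite inE => /andP[_ iJ].
rewrite big_mkcond/= [RHS]big_mkcond/=; apply: eq_bigr => j _.
have [->|_] := eqVneq j i; first by rewrite (negbTE iJ).
by case: (j \in J); rewrite ?mul1r ?mul0r.
Qed.

Lemma sum_mem1 i J : J \in partners i ->
  \sum_(j < n | j != i) (j \in J)%:R = m%:R :> R.
Proof.
move=> JP; have := sum_mem (fun=> 1) JP; rewrite sumr_const.
move: JP; rewrite inE => /andP[/eqP-> _] ->.
by apply: eq_bigr => j _; rewrite mulr1.
Qed.

Let count1 i j := \sum_(J in partners i) (j \in J)%:R : R.
Let count2 i j k := \sum_(J in partners i) (j \in J)%:R * (k \in J)%:R : R.

(** By symmetry the count does not depend on [j], and summed over the n - 1 candidates it counts
    each set m times: the inclusion probability is m/(n-1). *)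
Let count1E i j : j != i -> count1 i j = #|partners i|%:R * m%:R / (n%:R - 1).
Proof.
move=> ji.
have cst k : k != i -> count1 i k = count1 i j.
  move=> ki; rewrite /count1 -(partner_sum_perm _ (tpermD _ _ : tperm j k i = i))//.
  by apply: eq_bigr => J _; rewrite -{1}(tpermL j k) mem_imset//; exact: perm_inj.
have : \sum_(k < n | k != i) count1 i k = #|partners i|%:R * m%:R.
  rewrite exchange_big/= -sumr_const mulr_suml; apply: eq_bigr => J JP.
  by rewrite sum_mem1// mul1r.
rewrite (eq_bigr (fun=> count1 i j))// sum_cst_others => <-.
by field.
Qed.

Lemma partner_avg_sum i (a : 'I_n -> R) :
  partner_avg i (fun J => m%:R^-1 * \sum_(j in J) a j) =
  (n%:R - 1)^-1 * \sum_(j < n | j != i) a j.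
Proof.
rewrite /partner_avg -mulr_sumr.
under eq_bigr => J JP do rewrite (sum_mem _ JP).
rewrite exchange_big/=.
under eq_bigr => j ji do rewrite -mulr_suml [X in X * _]count1E//.
rewrite -mulr_sumr; have := partners_neq0 i.
have : m%:R != 0 :> R by rewrite pnatr_eq0 -lt0n.
by move=> m0 p0; field; rewrite m0 p0 n1_neq0.
Qed.

Hypothesis n_gt2 : (2 < n)%N.

Let n2_neq0 : n%:R - 2 != 0 :> R.
Proof. by rewrite subr_eq0 (eqr_nat R n 2); case: n n_gt2 => [|[|[|]]]. Qed.

(** By symmetry the count is constant on ordered pairs of distinct units. Over all ordered pairs,
    equal ones included, it adds up to m^2 per set; removing the diagonal, which is [count1], leaves
    m(m-1) for the (n-1)(n-2) distinct pairs. *)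
Let count2E i j k : j != i -> k != i -> j != k ->
  count2 i j k = #|partners i|%:R * (m%:R * (m%:R - 1)) / ((n%:R - 1) * (n%:R - 2)).
Proof.
move=> ji ki jk.
have inv x y j1 k1 : x != i -> y != i ->
    count2 i (tperm x y j1) (tperm x y k1) = count2 i j1 k1.
  move=> xi yi; rewrite /count2 -(partner_sum_perm _ (tpermD xi yi)).
  by apply: eq_bigr => J _; rewrite !mem_imset//; exact: perm_inj.
have cst j' k' : j' != i -> k' != i -> j' != k' -> count2 i j' k' = count2 i j k.
  by move=> *; apply: (tperm_invariant2 (A := [pred x | x != i]) inv).
have diag j' : count2 i j' j' = count1 i j'.
  by apply: eq_bigr => J _; case: (j' \in J); rewrite ?mul1r ?mul0r.
have : \sum_(j' < n | j' != i) \sum_(k' < n | k' != i) count2 i j' k' =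
       #|partners i|%:R * (m%:R ^+ 2).
  under eq_bigr do rewrite exchange_big/=.
  rewrite exchange_big/= -sumr_const mulr_suml; apply: eq_bigr => J JP.
  under eq_bigr do rewrite -mulr_sumr sum_mem1//.
  by rewrite -mulr_suml sum_mem1// mul1r expr2.
have step j' : j' != i -> \sum_(k' < n | k' != i) count2 i j' k' =
    #|partners i|%:R * m%:R / (n%:R - 1) + (n%:R - 2) * count2 i j k.
  move=> j'i; rewrite (bigD1 j')//= diag count1E//; congr (_ + _).
  rewrite -(sum_cst_others2 _ j'i); apply: eq_bigr => k' /andP[k'i k'j'].
  by rewrite cst// eq_sym.
rewrite (eq_bigr _ step) sum_cst_others => E.
have {}E : (n%:R - 1) * (n%:R - 2) * count2 i j k =
    #|partners i|%:R * (m%:R * (m%:R - 1)).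
  rewrite [m%:R * _]mulrBr mulr1 -expr2 [RHS]mulrBr -E; field; exact: n1_neq0.
apply: (mulfI (mulf_neq0 n1_neq0 n2_neq0)); rewrite E; field.
by rewrite n1_neq0 n2_neq0.
Qed.

(** The inclusion probabilities of order one and two give the second moments of means under sampling
    without replacement. The diagonal keeps the weight 1/m, which is the origin of the bias of order
    1/m. *)
Lemma partner_avg_sum2 i (a b : 'I_n -> R) :
  partner_avg i (fun J => (m%:R^-1 * \sum_(j in J) a j) * (m%:R^-1 * \sum_(j in J) b j)) =
  m%:R^-1 * ((n%:R - 1)^-1 * \sum_(j < n | j != i) a j * b j) +
  (1 - m%:R^-1) * (((n%:R - 1) * (n%:R - 2))^-1 *
     \sum_(j < n | j != i) \sum_(k < n | (k != i) && (k != j)) a j * b k).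
Proof.
have step1 J : J \in partners i ->
   (m%:R^-1 * \sum_(j in J) a j) * (m%:R^-1 * \sum_(j in J) b j) =
   \sum_(j < n | j != i) \sum_(k < n | k != i)
      m%:R^-1 ^+ 2 * (((j \in J)%:R * (k \in J)%:R) * (a j * b k)).
  move=> JP; rewrite !(sum_mem _ JP) mulrACA -expr2 mulr_suml mulr_sumr.
  by apply: eq_bigr => j _; rewrite !mulr_sumr; apply: eq_bigr => k _; ring.
rewrite /partner_avg (eq_bigr _ step1) exchange_big/=.
have step2 j : j != i ->
   \sum_(J in partners i) \sum_(k < n | k != i)
      m%:R^-1 ^+ 2 * ((j \in J)%:R * (k \in J)%:R * (a j * b k)) =
   #|partners i|%:R * (m%:R^-1 / (n%:R - 1) * (a j * b j) +
    m%:R^-1 * (m%:R - 1) / ((n%:R - 1) * (n%:R - 2)) *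
       \sum_(k < n | (k != i) && (k != j)) a j * b k).
  have m0 : m%:R != 0 :> R by rewrite pnatr_eq0 -lt0n.
  move=> ji; rewrite exchange_big/= (bigD1 j)//= mulrDr; congr (_ + _).
    rewrite -mulr_sumr -mulr_suml.
    rewrite (_ : \sum_(J in partners i) _ = count1 i j); last first.
      by apply: eq_bigr => J _; case: (j \in J); rewrite ?mul1r ?mul0r.
    by rewrite count1E//; field; rewrite m0 n1_neq0.
  rewrite !mulr_sumr; apply: eq_bigr => k /andP[ki kj].
  rewrite -mulr_sumr -mulr_suml [X in _ * (X * _)]count2E// 1?eq_sym//.
  by field; rewrite m0 n1_neq0 n2_neq0.
rewrite (eq_bigr _ step2) -mulr_sumr mulKf ?partners_neq0// big_split/=.
rewrite -!mulr_sumr; congr (_ + _); first by rewrite mulrA.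
rewrite mulrA; congr (_ * _).
have m0 : m%:R != 0 :> R by rewrite pnatr_eq0 -lt0n.
by field; rewrite m0 n1_neq0 n2_neq0.
Qed.

End Partners.

(** * Uniform anchors and the variance of anchor averages *)

Section Anchors.
Context {R : realFieldType}.
Variables (repl : bool) (n s m : nat).
Hypothesis n_gt0 : (0 < n)%N.

(** One set for both ways of drawing. With three draws and no replacement it also indexes the terms
    of a U-statistic of order three. *)
Definition anchors : {set {ffun 'I_s -> 'I_n}} :=
  [set I : {ffun 'I_s -> 'I_n} | repl || injectiveb I]%SET.

Lemma anchors_perm (t : {perm 'I_n}) (F : {ffun 'I_s -> 'I_n} -> R) :
  \sum_(I in anchors) F [ffun a => t (I a)] = \sum_(I in anchors) F I.
Proof.
have inj : injective (fun I : {ffun 'I_s -> 'I_n} => [ffun a => t (I a)]).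
  move=> I I' /ffunP E; apply/ffunP => a.
  by have := E a; rewrite !ffunE; exact: perm_inj.
rewrite [RHS](reindex_inj inj) /=; apply: eq_bigl => I; rewrite !inE.
congr (_ || _); apply/injectiveP/injectiveP => II a b.
  by rewrite !ffunE => /perm_inj; exact: II.
by move=> E; apply: II; rewrite !ffunE E.
Qed.

(** Permuting the units permutes the admissible anchor maps, so every unit is the anchor of draw [a]
    equally often. *)
Lemma sum_anchors1 (a : 'I_s) (g : 'I_n -> R) :
  \sum_(I in anchors) g (I a) = #|anchors|%:R * (n%:R^-1 * \sum_i g i).
Proof.
pose N i : R := \sum_(I in anchors) (I a == i)%:R.
have Ncst i j : N i = N j.
  rewrite /N -(anchors_perm (tperm i j)); apply: eq_bigr => I _.
  by rewrite ffunE -{2}(tpermR i j) (inj_eq perm_inj).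
have sumN : \sum_i N i = #|anchors|%:R.
  rewrite exchange_big/= -sumr_const; apply: eq_bigr => I _.
  by rewrite (bigD1 (I a))//= eqxx big1 ?addr0// => i; rewrite eq_sym => /negbTE->.
have NE i : N i = #|anchors|%:R / n%:R.
  move: sumN; rewrite (eq_bigr (fun=> N i)) ?sumr_const ?card_ord// => <-.
  by rewrite -[N i *+ n]mulr_natr mulfK// pnatr_eq0 -lt0n.
transitivity (\sum_i N i * g i).
  under [RHS]eq_bigr do rewrite mulr_suml.
  rewrite exchange_big/=; apply: eq_bigr => I _.
  rewrite (bigD1 (I a))//= eqxx mul1r big1 ?addr0// => i.
  by rewrite eq_sym => /negbTE->; rewrite mul0r.
under eq_bigr do rewrite NE.
by rewrite -mulr_sumr mulrA.
Qed.

(** The number [N i j] of maps with value i at [a] and j at [b] depends only on whether i = j. Since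
    [g] sums to 0, the sum collapses to minus the sum of the squares of [g] times the off-diagonal
    count less the diagonal one, and the diagonal count is never the larger. *)
Lemma sum_anchors2_le0 (a b : 'I_s) (g : 'I_n -> R) : a != b ->
  \sum_i g i = 0 -> \sum_(I in anchors) g (I a) * g (I b) <= 0.
Proof.
move=> ab g0.
pose N i j : R := \sum_(I in anchors) (I a == i)%:R * (I b == j)%:R.
have inv (t : {perm 'I_n}) i j : N (t i) (t j) = N i j.
  rewrite /N -(anchors_perm t); apply: eq_bigr => I _.
  by rewrite !ffunE !(inj_eq perm_inj).
have -> : \sum_(I in anchors) g (I a) * g (I b) = \sum_i \sum_j N i j * (g i * g j).
  transitivity (\sum_i \sum_j \sum_(I in anchors)
      ((I a == i)%:R * g i) * ((I b == j)%:R * g j)).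
    under [RHS]eq_bigr do rewrite exchange_big/=.
    rewrite exchange_big/=; apply: eq_bigr => I _.
    under eq_bigr do rewrite -mulr_sumr.
    rewrite -mulr_suml; congr (_ * _).
      rewrite (bigD1 (I a))//= eqxx mul1r big1 ?addr0// => i.
      by rewrite eq_sym => /negbTE->; rewrite mul0r.
    rewrite (bigD1 (I b))//= eqxx mul1r big1 ?addr0// => i.
    by rewrite eq_sym => /negbTE->; rewrite mul0r.
  apply: eq_bigr => i _; apply: eq_bigr => j _; rewrite mulr_suml.
  by apply: eq_bigr => I _; rewrite mulrACA.
have diag i j : N i i = N j j by rewrite -(inv (tperm i j)) tpermL.
have offdiag i j i' j' : i != j -> i' != j' -> N i j = N i' j'.
  by move=> *; apply: (tperm_invariant2 (A := predT)) => // *; exact: inv.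
have diag_le i j : i != j -> N i i <= N i j.
  move=> ij; case: (boolP repl) => [replT|replF].
    (* With replacement the value at [b] is free: exchanging i and j there matches the maps counted
       by [N i i] with those counted by [N i j]. *)
    pose h (I : {ffun 'I_s -> 'I_n}) :=
      [ffun x => if x == b then tperm i j (I x) else I x].
    have hK : involutive h.
      by move=> I; apply/ffunP => x; rewrite !ffunE; case: eqP; rewrite ?tpermK.
    rewrite /N [leRHS](reindex_inj (inv_inj hK)) /=.
    rewrite le_eqVlt; apply/orP; left; apply/eqP; apply: eq_big => I.
      by rewrite !inE replT.
    rewrite !ffunE (negbTE ab) eqxx => _.
    by rewrite -{2}(tpermL i j) (inj_eq perm_inj).
  rewrite {1}/N big1 => [|I]; first by apply: sumr_ge0 => I _; rewrite mulr_ge0 ?ler0n.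
  rewrite inE (negbTE replF) => /injectiveP inj.
  have [Ia|] := eqVneq (I a) i; last by rewrite mul0r.
  have [Ib|] := eqVneq (I b) i; last by rewrite mulr0.
  by have := inj a b; rewrite Ia Ib => /(_ erefl) E; rewrite E eqxx in ab.
(* Without two distinct units there is no off-diagonal count to refer to; then [g] itself is 0. *)
case: (pickP (fun x : 'I_n * 'I_n => x.1 != x.2)) => [[i0 j0] /= ij0|eqT]; last first.
  have all_eq (i j : 'I_n) : i = j by have := eqT (i, j) => /= /negbFE/eqP.
  rewrite big1// => i _; rewrite big1// => j _.
  suff -> : g i = 0 by rewrite mul0r mulr0.
  rewrite -[RHS]g0 (bigD1 i)//= big1 ?addr0// => k.
  by rewrite (all_eq k i) eqxx.
have Nj i j : j != i -> N i j = N i0 j0 by move=> ji; apply: offdiag => //; rewrite eq_sym.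
have step i : \sum_j N i j * (g i * g j) = - ((N i0 j0 - N i0 i0) * (g i) ^+ 2).
  rewrite (bigD1 i)//= (diag i i0).
  under eq_bigr => j ji do rewrite Nj//.
  rewrite -!mulr_sumr; move: g0; rewrite (bigD1 i)//= => /eqP.
  by rewrite addrC addr_eq0 => /eqP ->; ring.
under eq_bigr do rewrite step.
rewrite sumrN oppr_le0 -mulr_sumr mulr_ge0 ?subr_ge0 ?diag_le//.
by apply: sumr_ge0 => i _; rewrite sqr_ge0.
Qed.

Hypotheses (m_gt0 : (0 < m)%N) (m_lt : (m < n)%N) (s_gt0 : (0 < s)%N).

Definition pop_avg (f : 'I_n -> {set 'I_n} -> R) : R :=
  n%:R^-1 * \sum_i partner_avg m i (f i).

Definition anchor_avg (D : design n s) (f : 'I_n -> {set 'I_n} -> R) : R :=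
  s%:R^-1 * \sum_(a < s) f (D.1 a) (D.2 a).

(** Once the anchors are fixed, the conditions on the partner sets concern each draw separately, so
    the partner sets range over a product. *)
Lemma sum_designs (F : design n s -> R) :
  \sum_(D in designs repl n s m) F D =
  \sum_(I in anchors) \sum_(J in family (fun a => mem (partners m (I a)))) F (I, J).
Proof.
rewrite pair_big_dep/=; apply: eq_big => [[I J]|[I J] _]//=.
rewrite [LHS]inE [I \in _]inE; congr (_ && _).
apply/andP/familyP => [[/forallP m_ /forallP d_] a|JP].
  by rewrite !inE m_ d_.
by split; apply/forallP => a; have := JP a; rewrite !inE => /andP[].
Qed.

Let C : R := ('C(n.-1, m))%:R.

Let CE (i : 'I_n) : #|partners m i|%:R = C :> R. Proof. by rewrite card_partners. Qed.

Let C_neq0 : C != 0.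
Proof. by rewrite -(CE (Ordinal n_gt0)) partners_neq0. Qed.

(** Distributivity expresses the independence of the partner sets given the anchors; every anchor
    has the same number [C] of candidate sets. *)
Lemma sum_partners (I : {ffun 'I_s -> 'I_n}) (F : 'I_s -> {set 'I_n} -> R) :
  \sum_(J in family (fun a => mem (partners m (I a)))) \prod_a F a (J a) =
  C ^+ s * \prod_a partner_avg m (I a) (F a).
Proof.
rewrite -(bigA_distr_big_dep (fun a => mem (partners m (I a))) F) /=.
rewrite -[in C ^+ s](card_ord s) -prodr_const -big_split/=.
by apply: eq_bigr => a _; rewrite /partner_avg CE mulVKf.
Qed.

Lemma partner_avg_cst (i : 'I_n) (c : R) : partner_avg m i (fun=> c) = c.
Proof. by rewrite /partner_avg sumr_const CE -(CE i) -[c *+ _]mulr_natl CE mulKf. Qed.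

Lemma partner_avgD (i : 'I_n) (f g : {set 'I_n} -> R) :
  partner_avg m i (fun J => f J + g J) = partner_avg m i f + partner_avg m i g.
Proof. by rewrite /partner_avg big_split mulrDr. Qed.

Lemma partner_avgZ (i : 'I_n) (c : R) (f : {set 'I_n} -> R) :
  partner_avg m i (fun J => c * f J) = c * partner_avg m i f.
Proof. by rewrite /partner_avg -mulr_sumr mulrCA. Qed.

Lemma sum_designs1 (a : 'I_s) (g : 'I_n -> {set 'I_n} -> R) :
  \sum_(D in designs repl n s m) g (D.1 a) (D.2 a) =
  C ^+ s * #|anchors|%:R * pop_avg g.
Proof.
rewrite sum_designs -mulrA /pop_avg -(sum_anchors1 a (fun i => partner_avg m i (g i))).
rewrite mulr_sumr; apply: eq_bigr => I _.
(* All draws other than [a] receive the factor 1, whose partner average is 1. *)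
have := sum_partners I (fun b J => if b == a then g (I b) J else 1).
rewrite (bigD1 a)//= eqxx [X in _ = _ * (_ * X)]big1 => [|b /negbTE ba]; last first.
  by rewrite ba partner_avg_cst.
rewrite mulr1 => <-; apply: eq_bigr => J _.
by rewrite (bigD1 a)//= eqxx big1 ?mulr1// => b /negbTE->.
Qed.

Lemma card_designs : #|designs repl n s m|%:R = C ^+ s * #|anchors|%:R :> R.
Proof.
rewrite -[RHS]mulr1 -sumr_const (sum_designs1 (Ordinal s_gt0) (fun _ _ => 1)).
congr (_ * _); rewrite /pop_avg; under eq_bigr do rewrite partner_avg_cst.
by rewrite sumr_const card_ord mulVf// pnatr_eq0 -lt0n.
Qed.

Lemma sum_designs2 (a b : 'I_s) (g : 'I_n -> {set 'I_n} -> R) : a != b ->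
  \sum_(D in designs repl n s m) g (D.1 a) (D.2 a) * g (D.1 b) (D.2 b) =
  C ^+ s * \sum_(I in anchors) partner_avg m (I a) (g (I a)) * partner_avg m (I b) (g (I b)).
Proof.
move=> ab; rewrite sum_designs mulr_sumr; apply: eq_bigr => I _.
have := sum_partners I (fun c J => if (c == a) || (c == b) then g (I c) J else 1).
have ba : b != a by rewrite eq_sym.
rewrite (bigD1 a)//= (bigD1 b)//= !eqxx orbT /= [X in _ = _ * (_ * (_ * X))]big1; last first.
  by move=> c /andP[/negbTE ca /negbTE cb]; rewrite ca cb partner_avg_cst.
rewrite mulr1 => <-; apply: eq_bigr => J _.
rewrite (bigD1 a)//= (bigD1 b)//= !eqxx orbT /= big1 ?mulr1//.
by move=> c /andP[/negbTE-> /negbTE->].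
Qed.

Lemma pop_avg_ge0 f : (forall i J, 0 <= f i J) -> 0 <= pop_avg f.
Proof.
move=> f0; apply: mulr_ge0; rewrite ?invr_ge0 ?ler0n// sumr_ge0// => i _.
by apply: mulr_ge0; rewrite ?invr_ge0 ?ler0n// sumr_ge0.
Qed.

(* Distinct anchors contribute nonpositively correlated terms: independent
   when drawn with replacement, negatively associated otherwise. *)
Lemma anchor_avg_msd (f : 'I_n -> {set 'I_n} -> R) :
  \sum_(D in designs repl n s m) (anchor_avg D f - pop_avg f) ^+ 2 <=
  #|designs repl n s m|%:R * (s%:R^-1 * pop_avg (fun i J => f i J ^+ 2)).
Proof.
set mu := pop_avg f; pose g i J := f i J - mu.
have s0 : s%:R != 0 :> R by rewrite pnatr_eq0 -lt0n.
have n0 : n%:R != 0 :> R by rewrite pnatr_eq0 -lt0n.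
have sumg : \sum_i partner_avg m i (g i) = 0.
  under eq_bigr do rewrite partner_avgD partner_avg_cst.
  rewrite big_split/= sumr_const card_ord -[X in _ + X]mulr_natl.
  by apply: (mulfI (invr_neq0 n0)); rewrite mulr0 mulrDr mulKf// subrr.
(* Centring lowers the mean square by [mu ^+ 2]. *)
have g2 : pop_avg (fun i J => g i J ^+ 2) <= pop_avg (fun i J => f i J ^+ 2).
  have -> : pop_avg (fun i J => g i J ^+ 2) = pop_avg (fun i J => f i J ^+ 2) - mu ^+ 2.
    have step i : partner_avg m i (fun J => g i J ^+ 2) =
        partner_avg m i (fun J => f i J ^+ 2) + (- (2 * mu) * partner_avg m i (f i) + mu ^+ 2).
      rewrite -partner_avgZ -[mu ^+ 2](partner_avg_cst i) -!partner_avgD.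
      by congr (_ * _); apply: eq_bigr => J _; rewrite /g; ring.
    rewrite /pop_avg; under eq_bigr do rewrite step.
    rewrite !big_split/= -mulr_sumr sumr_const card_ord -[mu ^+ 2 *+ n]mulr_natl.
    rewrite !mulrDr mulKf// mulrCA -/(pop_avg f) -/mu; ring.
  by rewrite lerBlDr lerDl sqr_ge0.
have dE (D : design n s) : (anchor_avg D f - mu) ^+ 2 =
    s%:R^-1 ^+ 2 * \sum_a \sum_b g (D.1 a) (D.2 a) * g (D.1 b) (D.2 b).
  have -> : anchor_avg D f - mu = s%:R^-1 * \sum_a g (D.1 a) (D.2 a).
    by rewrite /g sumrB sumr_const card_ord -[mu *+ s]mulr_natl mulrBr mulKf.
  by rewrite exprMn [(\sum_a _) ^+ 2]expr2 big_distrlr.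
under eq_bigr do rewrite dE.
rewrite -mulr_sumr exchange_big/=.
under eq_bigr do rewrite exchange_big/=.
have Cs0 : 0 <= C ^+ s by rewrite exprn_ge0// ler0n.
(* Only the s diagonal terms are kept, and s/s^2 is the factor 1/s. *)
apply: (@le_trans _ _ (s%:R^-1 ^+ 2 * \sum_(a < s)
    (#|designs repl n s m|%:R * pop_avg (fun i J => f i J ^+ 2)))).
  apply: ler_wpM2l; first by rewrite sqr_ge0.
  apply: ler_sum => a _; rewrite (bigD1 a)//= -[leRHS]addr0; apply: lerD.
    rewrite (sum_designs1 a (fun i J => g i J * g i J)) card_designs.
    by apply: ler_wpM2l => //; rewrite mulr_ge0// ler0n.
  apply: sumr_le0 => b ba; rewrite sum_designs2 1?eq_sym//.
  by rewrite mulr_ge0_le0// (sum_anchors2_le0 (g := fun i => partner_avg m i (g i)))// eq_sym.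
have -> : s%:R^-1 ^+ 2 = s%:R^-1 * s%:R^-1 :> R by [].
rewrite sumr_const card_ord -[(_ * _) *+ s]mulr_natl -mulrA mulKf//.
by rewrite mulrCA.
Qed.

End Anchors.

(** * Combinatorics of U-statistics of order three *)

(** Links the two forms of a sum over triples of distinct units: over injections, where the
    permutation arguments for anchors apply, and iterated, as it arises from partner averages. *)
Lemma sum_inj3 (R : realFieldType) (n : nat) (F : 'I_n -> 'I_n -> 'I_n -> R) :
  \sum_(I in anchors false n 3) F (I ord0) (I (inord 1)) (I (inord 2)) =
  \sum_i \sum_(j | j != i) \sum_(k | (k != i) && (k != j)) F i j k.
Proof.
pose h (t : 'I_n * ('I_n * 'I_n)) : {ffun 'I_3 -> 'I_n} :=
  [ffun a : 'I_3 => nth t.1 [:: t.1; t.2.1; t.2.2] a].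
pose h' (I : {ffun 'I_3 -> 'I_n}) := (I ord0, (I (inord 1), I (inord 2))).
have hK : cancel h h'.
  by move=> [i [j k]]; rewrite /h' !ffunE !inordK.
have h'K : cancel h' h.
  move=> I; apply/ffunP => -[[|[|[|//]]] a3]; rewrite !ffunE/=;
    by congr (I _); apply/val_inj => //=; rewrite inordK.
rewrite (reindex h) /=; last by exists h' => ? _.
under [RHS]eq_bigr do rewrite pair_big_dep/=.
rewrite pair_big_dep/=; apply: eq_big => [[i [j k]]|[i [j k]] _]; last first.
  by rewrite !ffunE !inordK.
rewrite inE/=; apply/injectiveP/and3P => [inj|[ji ki kj] a b].
  have ne (a b : 'I_3) : a != b -> h (i, (j, k)) a != h (i, (j, k)) b.
    by rewrite (inj_eq inj).
  split.
  - by have := ne (inord 1) ord0; rewrite -!val_eqE/= !ffunE !inordK//=; exact.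
  - by have := ne (inord 2) ord0; rewrite -!val_eqE/= !ffunE !inordK//=; exact.
  - by have := ne (inord 2) (inord 1); rewrite -!val_eqE/= !ffunE !inordK//=; exact.
rewrite !ffunE/=; case: a b => [[|[|[|//]]] a3] [[|[|[|//]]] b3] /= E;
  apply/val_inj => //=; move: E => /eqP;
  by rewrite ?(negbTE ji) ?(negbTE ki) ?(negbTE kj) // eq_sym
             ?(negbTE ji) ?(negbTE ki) ?(negbTE kj).
Qed.

Section Ustat.
Context {R : realFieldType}.
Variable n : nat.
Hypothesis n_gt2 : (2 < n)%N.

(* Statistics of order two are treated as kernels of order three that ignore
   their last argument, so that a single variance bound covers both. *)
Definition ustat3 (w : 'I_n -> 'I_n -> 'I_n -> R) : R :=
  #|anchors false n 3|%:R^-1 *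
  \sum_(I in anchors false n 3) w (I ord0) (I (inord 1)) (I (inord 2)).

Lemma ustat3E w : ustat3 w = (n%:R * (n%:R - 1) * (n%:R - 2))^-1 *
  \sum_i \sum_(j | j != i) \sum_(k | (k != i) && (k != j)) w i j k.
Proof.
rewrite /ustat3 sum_inj3; congr (_^-1 * _).
rewrite -sumr_const (sum_inj3 (fun _ _ _ => 1)).
under eq_bigr => i _.
  under eq_bigr => j ji do rewrite (sum_cst_others2 _ ji) mulr1.
  rewrite sum_cst_others; over.
by rewrite sumr_const card_ord -[LHS]mulr_natl mulrA.
Qed.

(** A nonzero term requires a coincidence between one of the three indices of [I] and one of those
    of [I']. There are 9 possible coincidences, and for fixed [I] each occurs for a fraction 1/n of
    the [I'] by [sum_anchors1]. *)
Lemma sum_overlap (c : {ffun 'I_3 -> 'I_n} -> {ffun 'I_3 -> 'I_n} -> R) (v : R) :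
  0 <= v ->
  {in anchors false n 3 &, forall I I', c I I' <= v} ->
  {in anchors false n 3 &, forall I I' : {ffun 'I_3 -> 'I_n}, (forall a b, I a != I' b) ->
     c I I' = 0} ->
  \sum_(I in anchors false n 3) \sum_(I' in anchors false n 3) c I I' <=
  #|anchors false n 3|%:R ^+ 2 * (9 * v / n%:R).
Proof.
move=> v0 cv c0.
apply: (@le_trans _ _ (\sum_(I in anchors false n 3) \sum_(I' in anchors false n 3)
   \sum_a \sum_b v * (I' b == I a)%:R)).
  apply: ler_sum => I IA; apply: ler_sum => I' I'A.
  case: (pickP (fun ab : 'I_3 * 'I_3 => I' ab.2 == I ab.1)) => [[a b]/= Eab|ne].
    apply: (le_trans (cv _ _ IA I'A)).
    rewrite (bigD1 a)//= (bigD1 b)//= Eab mulr1 -addrA lerDl addr_ge0//.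
      by apply: sumr_ge0 => *; rewrite mulr_ge0// ler0n.
    by apply: sumr_ge0 => *; apply: sumr_ge0 => *; rewrite mulr_ge0// ler0n.
  rewrite c0// => [|a b]; last by have /= := ne (a, b); rewrite eq_sym => ->.
  by apply: sumr_ge0 => *; apply: sumr_ge0 => *; rewrite mulr_ge0// ler0n.
rewrite le_eqVlt; apply/orP; left; apply/eqP.
have step I : I \in anchors false n 3 ->
    \sum_(I' in anchors false n 3) \sum_a \sum_b v * (I' b == I a)%:R =
    #|anchors false n 3|%:R * (9 * v / n%:R).
  move=> IA; rewrite exchange_big/=.
  have n0 : (0 < n)%N by case: n I IA n_gt2.
  have E a : \sum_(I' in anchors false n 3) \sum_b v * (I' b == I a)%:R =
      #|anchors false n 3|%:R * (3 * v / n%:R).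
    rewrite exchange_big/= (eq_bigr (fun=> #|anchors false n 3|%:R * (v / n%:R))).
      by rewrite sumr_const card_ord -[LHS]mulr_natl mulrCA [in LHS]mulrA !mulrA.
    move=> b _; rewrite -mulr_sumr (sum_anchors1 false n0 b (fun i => (i == I a)%:R)).
    rewrite (bigD1 (I a))//= eqxx big1 ?addr0 ?mulr1; first by rewrite mulrCA.
    by move=> i /negbTE->.
  by rewrite (eq_bigr _ (fun a _ => E a)) sumr_const card_ord -[LHS]mulr_natl; field;
    rewrite pnatr_eq0 -lt0n.
by rewrite (eq_bigr _ step) sumr_const -[LHS]mulr_natl mulrA expr2.
Qed.

(** The divisor is the nominal size [m], as in the estimators; this is a mean when [J] has [m]
    elements. *)
Definition pmean (m : nat) (J : {set 'I_n}) (a : 'I_n -> R) : R :=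
  m%:R^-1 * \sum_(j in J) a j.

Section PopulationAverages.
Variable m : nat.
Hypotheses (m_gt0 : (0 < m)%N) (m_lt : (m < n)%N).

Let n_neq0 : n%:R != 0 :> R.
Proof. by rewrite pnatr_eq0 -lt0n (ltn_trans _ n_gt2). Qed.

Let n1_neq0 : n%:R - 1 != 0 :> R.
Proof. by rewrite subr_eq0 (eqr_nat R n 1); case: n n_gt2 => [|[|]]. Qed.

Let n2_neq0 : n%:R - 2 != 0 :> R.
Proof. by rewrite subr_eq0 (eqr_nat R n 2); case: n n_gt2 => [|[|[|]]]. Qed.

Lemma ustat3_pair (a : 'I_n -> 'I_n -> R) :
  ustat3 (fun i j _ => a i j) = n%:R^-1 * \sum_i (n%:R - 1)^-1 * \sum_(j | j != i) a i j.
Proof.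
rewrite ustat3E (eq_bigr (fun i => (n%:R - 2) * \sum_(j | j != i) a i j)) => [|i _].
  by rewrite -!mulr_sumr; field; rewrite n_neq0 n1_neq0 n2_neq0.
by rewrite mulr_sumr; apply: eq_bigr => j ji; rewrite sum_cst_others2.
Qed.

Lemma pop_avg_pmean (a : 'I_n -> 'I_n -> R) :
  pop_avg m (fun i J => pmean m J (a i)) = ustat3 (fun i j _ => a i j).
Proof.
rewrite ustat3_pair /pop_avg; congr (_ * _); apply: eq_bigr => i _.
exact: partner_avg_sum.
Qed.

(** [partner_avg_sum2] averaged over the anchors: a repeated partner contributes to a kernel of
    order two, distinct partners to one of order three. *)
Lemma pop_avg_pmeanM (a b : 'I_n -> 'I_n -> R) :
  pop_avg m (fun i J => pmean m J (a i) * pmean m J (b i)) =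
  m%:R^-1 * ustat3 (fun i j _ => a i j * b i j) +
  (1 - m%:R^-1) * ustat3 (fun i j k => a i j * b i k).
Proof.
rewrite ustat3_pair ustat3E /pop_avg.
under eq_bigr do rewrite partner_avg_sum2//.
rewrite big_split/= -!mulr_sumr invfM; field.
by rewrite n_neq0 n1_neq0 n2_neq0 pnatr_eq0 -lt0n.
Qed.

End PopulationAverages.
End Ustat.

Definition full_design n : design n n :=
  ([ffun a => a], [ffun a => (~: [set a])%SET]).

Lemma full_designP n : (0 < n)%N -> full_design n \in designs false n n n.-1.
Proof.
move=> n_gt0; rewrite inE/=; apply/and3P; split.
- by apply/injectiveP => a b; rewrite !ffunE.
- by apply/forallP => a; rewrite ffunE cardsC1 card_ord.
- by apply/forallP => a; rewrite !ffunE !inE eqxx.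
Qed.

(** With n - 1 partners the only admissible set is the complement of the anchor, so nothing is left
    to chance. *)
Lemma anchor_avg_full (R : realFieldType) n (f : 'I_n -> {set 'I_n} -> R) : (0 < n)%N ->
  anchor_avg (full_design n) f = pop_avg n.-1 f.
Proof.
move=> n_gt0; congr (_ * _); apply: eq_bigr => i _; rewrite !ffunE.
have -> : partner_avg n.-1 i (f i) = #|[set (~: [set i])%SET]%SET|%:R^-1 *
    \sum_(J in [set (~: [set i])%SET]%SET) f i J.
  suff E : partners n.-1 i = [set (~: [set i])%SET]%SET by rewrite /partner_avg E.
  apply/finset.setP => J; rewrite !inE; apply/andP/eqP => [[/eqP cJ iJ]|->].
    apply/eqP; rewrite eqEcard finset.subsetC finset.sub1set inE iJ cJ.
    by rewrite cardsC1 card_ord leqnn.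
  by rewrite cardsC1 card_ord !inE !eqxx.
by rewrite cards1 invr1 mul1r big_set1.
Qed.

(** * Independent samples and U-statistics *)

Section Independence.
Context {d : measure_display} {Omega : measurableType d} {R : realType}.
Variable P : probability Omega R.
Local Open Scope ereal_scope.

Definition image_measure d' (E : measurableType d') (m : {measure set Omega -> \bar R})
    (Y : Omega -> E) (mY : measurable_fun setT Y) : {measure set E -> \bar R} :=
  measure_function_pushforward__canonical__measure_function_Measure m mY.

Lemma measurable_preimage d' (E : measurableType d') (Y : Omega -> E) (S : set E) :
  measurable_fun setT Y -> measurable S -> measurable (Y @^-1` S).
Proof. by move=> mY mS; rewrite -[X in measurable X]setTI; exact: mY. Qed.

(** Both sides are finite measures in [S], and rectangles form a generating family closed under
    intersection. The events [F], [F'] and the factor [c] let the passage from rectangles to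
    arbitrary sets be made in some coordinates while events on the others stay frozen. *)
Lemma rectangles_determine d1 d2 (E1 : measurableType d1) (E2 : measurableType d2)
    (Y Y' : Omega -> E1 * E2) (F F' : set Omega) (c : {nonneg R}) :
  measurable_fun setT Y -> measurable_fun setT Y' ->
  measurable F -> measurable F' ->
  (forall A B, measurable A -> measurable B ->
     P (Y @^-1` (A `*` B) `&` F) = c%:num%:E * P (Y' @^-1` (A `*` B) `&` F')) ->
  forall S, measurable S ->
     P (Y @^-1` S `&` F) = c%:num%:E * P (Y' @^-1` S `&` F').
Proof.
move=> mY mY' mF mF' E0 S mS.
pose m1 := image_measure (mrestr P mF) mY.
pose m2 := mscale c (image_measure (mrestr P mF') mY').
suff : m1 S = m2 S by [].
apply: (measure_unique [set A `*` B | A in measurable & B in measurable] (fun=> setT)) => //.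
- exact: measurable_prod_measurableType.
- move=> _ _ [A mA [B mB <-]] [A' mA' [B' mB' <-]]; rewrite -setXI.
  by exists (A `&` A'); [exact: measurableI|exists (B `&` B'); [exact: measurableI|]].
- by move=> _; exists setT => //; exists setT => //; rewrite setXTT.
- by rewrite bigcup_const//; exists 0%N.
- by move=> _ [A mA [B mB <-]]; exact: E0.
- move=> _; rewrite /m1 /= /pushforward /mrestr preimage_setT setTI.
  by rewrite (le_lt_trans (probability_le1 _ _)) ?ltry.
Qed.

Definition indep d1 d2 (E1 : measurableType d1) (E2 : measurableType d2)
    (Y : Omega -> E1) (Z : Omega -> E2) :=
  forall A B, measurable A -> measurable B ->
    P (Y @^-1` A `&` Z @^-1` B) = P (Y @^-1` A) * P (Z @^-1` B).

Section IndepFubini.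
Context {d1 d2 : measure_display} {E1 : measurableType d1} {E2 : measurableType d2}.
Variables (Y : Omega -> E1) (Z : Omega -> E2).
Hypotheses (mY : measurable_fun setT Y) (mZ : measurable_fun setT Z).
Hypothesis indepYZ : indep Y Z.

Let mY' : {mfun Omega >-> E1} := mfun_Sub (mem_set mY).
Let mZ' : {mfun Omega >-> E2} := mfun_Sub (mem_set mZ).
Let muY : probability E1 R := distribution P mY'.
Let muZ : probability E2 R := distribution P mZ'.

Let mYZ : measurable_fun setT (fun w => (Y w, Z w)).
Proof. exact: measurable_fun_pair. Qed.

Let lawYZ (S : set (E1 * E2)) : measurable S ->
  (muY \x muZ) S = image_measure P mYZ S.
Proof.
apply: product_measure_unique => A B mA mB.
by rewrite -[RHS]/(P (Y @^-1` A) * P (Z @^-1` B)) -indepYZ.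
Qed.

(** Independence identifies the joint law with the product of the two laws, where Tonelli's theorem
    applies. *)
Lemma indep_tonelli (f : E1 * E2 -> \bar R) : measurable_fun setT f ->
  (forall x, 0 <= f x) ->
  \int[P]_w f (Y w, Z w) = \int[P]_w \int[P]_w' f (Y w, Z w').
Proof.
move=> mf f0.
rewrite -[LHS](ge0_integral_pushforward mYZ P measurableT)//.
rewrite (eq_measure_integral (muY \x muZ)) => [|S mS _]; last exact/esym/lawYZ.
rewrite fubini_tonelli1// /fubini_F.
rewrite [LHS](ge0_integral_pushforward mY P measurableT)//.
- apply: eq_integral => w _ /=.
  rewrite [LHS](ge0_integral_pushforward mZ P measurableT)//.
  exact: measurableT_comp mf (pair1_measurable _).
- exact: measurable_fun_fubini_tonelli_F.
- by move=> x _; apply: integral_ge0.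
Qed.

(** For [Z] independent of [Y] and integrable f(Y, Z), the map [cmean f \o Y] is the regular version
    of the conditional mean given [Y]. Values are extended reals because sections of an integrable
    function may be non-integrable on a null set. *)
Definition cmean (f : E1 * E2 -> \bar R) (x : E1) : \bar R := \int[P]_w' f (x, Z w').

Lemma measurable_section (f : E1 * E2 -> \bar R) x : measurable_fun setT f ->
  measurable_fun setT (fun w' => f (x, Z w')).
Proof.
by move=> mf; apply: measurableT_comp mf _; exact: measurable_fun_pair.
Qed.

Lemma measurable_cmean_ge0 (f : E1 * E2 -> \bar R) : measurable_fun setT f ->
  (forall x, 0 <= f x) -> measurable_fun setT (cmean f).
Proof.
move=> mf f0; have := measurable_fun_fubini_tonelli_F (m2 := muZ) f mf f0.
apply: eq_measurable_fun => x _.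
rewrite /fubini_F [LHS](ge0_integral_pushforward mZ P measurableT)//.
exact: measurableT_comp mf (pair1_measurable _).
Qed.

Lemma cmeanE f x : cmean f x = cmean f^\+ x - cmean f^\- x.
Proof.
rewrite /cmean [LHS]integralE; congr (_ - _); apply: eq_integral => w _.
  by rewrite -[RHS]/((f^\+ \o (fun w' => (x, Z w'))) w) -funepos_comp.
by rewrite -[RHS]/((f^\- \o (fun w' => (x, Z w'))) w) -funeneg_comp.
Qed.

Lemma measurable_cmean f : measurable_fun setT f -> measurable_fun setT (cmean f).
Proof.
move=> mf; rewrite (_ : cmean f = cmean f^\+ \- cmean f^\-); last first.
  by apply/funext => x; exact: cmeanE.
apply: emeasurable_funB; apply: measurable_cmean_ge0 => //.
  exact: measurable_funepos.
exact: measurable_funeneg.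
Qed.

Section Integrable.
Variable f : E1 * E2 -> \bar R.
Hypotheses (mf : measurable_fun setT f)
  (intf : P.-integrable setT (fun w => f (Y w, Z w))).

Lemma indep_cmean_abs_lty : \int[P]_w cmean (abse \o f) (Y w) < +oo.
Proof.
have mabs : measurable_fun setT (abse \o f) by exact: measurableT_comp.
rewrite -(indep_tonelli mabs) => [|x]; last exact: abse_ge0.
by case/integrableP: intf.
Qed.

Lemma cmean_le g x : measurable_fun setT g -> (forall x, `|g x| <= `|f x|) ->
  `|cmean g x| <= cmean (abse \o f) x.
Proof.
move=> mg gf; apply: le_trans (le_abse_integral _ _ _) _ => //.
  exact: measurable_section.
have mabs h : measurable_fun setT h -> measurable_fun setT (abse \o h : E1 * E2 -> \bar R).
  by move=> mh; exact: measurableT_comp.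
apply: ge0_le_integral => //.
- exact: (measurable_section x (mabs _ mg)).
- exact: (measurable_section x (mabs _ mf)).
Qed.

(** The separate [g] lets one statement serve for [f], for its absolute value and for its positive
    and negative parts. *)
Lemma integrable_cmean g : measurable_fun setT g -> (forall x, `|g x| <= `|f x|) ->
  P.-integrable setT (cmean g \o Y).
Proof.
move=> mg gf; apply/integrableP; split.
  by apply: measurableT_comp mY; exact: measurable_cmean.
apply: le_lt_trans indep_cmean_abs_lty; apply: ge0_le_integral => //.
- by apply: measurableT_comp => //; apply: measurableT_comp mY; exact: measurable_cmean.
- apply: measurableT_comp mY; apply: measurable_cmean_ge0.
    exact: measurableT_comp.
  by move=> x; exact: abse_ge0.
- by move=> w _; exact: cmean_le.
Qed.

(** The section integrals of the absolute value of [f] have a finite mean, hence are finite almost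
    everywhere. *)
Lemma indep_ae_integrable :
  {ae P, forall w, P.-integrable setT (fun w' => f (Y w, Z w'))}.
Proof.
have /(integrable_ae measurableT) : P.-integrable setT (cmean (abse \o f) \o Y).
  apply: integrable_cmean; first exact: measurableT_comp.
  by move=> x /=; rewrite abse_id.
apply: filterS => w /(_ I) fin; apply/integrableP; split.
  exact: measurable_section.
by rewrite ltey_eq -/(cmean (abse \o f) (Y w)) fin.
Qed.

Lemma indep_fubini : \int[P]_w f (Y w, Z w) = \int[P]_w cmean f (Y w).
Proof.
have fpos x : `|f^\+ x| <= `|f x|.
  by rewrite gee0_abs// -/((abse \o f) x) fune_abse leeDl.
have fneg x : `|f^\- x| <= `|f x|.
  by rewrite gee0_abs// -/((abse \o f) x) fune_abse leeDr.
have mfp := measurable_funepos mf; have mfn := measurable_funeneg mf.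
rewrite [LHS]integralE.
under [RHS]eq_integral do rewrite cmeanE.
rewrite integralB//; [|exact: integrable_cmean..].
congr (_ - _).
  rewrite -[RHS](indep_tonelli (f := f^\+))//; apply: eq_integral => w _.
  by rewrite -[RHS]/((f^\+ \o (fun w' => (Y w', Z w'))) w) -funepos_comp.
rewrite -[RHS](indep_tonelli (f := f^\-))//; apply: eq_integral => w _.
by rewrite -[RHS]/((f^\- \o (fun w' => (Y w', Z w'))) w) -funeneg_comp.
Qed.

End Integrable.
End IndepFubini.

Context {d' : measure_display} {E : measurableType d'}.
Variables (X : nat -> Omega -> E).
Hypothesis X_iid : iid P X.

Lemma iid_measurable i : measurable_fun setT (X i). Proof. by case: X_iid. Qed.

(** [iid] factorizes over initial segments of the indices. A list of distinct indices is embedded in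
    a long enough segment, with the full space imposed on the indices outside the list. *)
Lemma iid_rectangle (s : seq nat) (A : nat -> set E) : uniq s ->
  (forall k, measurable (A k)) ->
  P [set w | forall k, (k < size s)%N -> A k (X (nth 0%N s k) w)] =
  \prod_(k < size s) P (X 0%N @^-1` A k).
Proof.
move=> us mA; case: X_iid => mX idX indX.
pose n := (foldr maxn 0%N s).+1.
have lt_n k : (k < size s)%N -> (nth 0%N s k < n)%N.
  rewrite /n ltnS; elim: s k {us n} => [|x s IH] [|k] //=; first by rewrite leq_maxl.
  by rewrite ltnS => /IH h; rewrite leq_max h orbT.
pose B (i : 'I_n) : set E := if (i : nat) \in s then A (index (i : nat) s) else setT.
have mB i : measurable (B i) by rewrite /B; case: ifP.
have -> : [set w | forall k, (k < size s)%N -> A k (X (nth 0%N s k) w)] =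
          [set w | forall i : 'I_n, B i (X i w)].
  apply/seteqP; split => w /=.
    move=> H i; rewrite /B; case: ifPn => // si.
    by have := H (index (i : nat) s); rewrite index_mem nth_index//; exact.
  move=> H k ks; have := H (Ordinal (lt_n _ ks)).
  by rewrite /B /= mem_nth// index_uniq.
rewrite indX// (eq_bigr (fun i => P (X 0%N @^-1` B i))) => [|i _]; last exact: idX.
rewrite (bigID (fun i : 'I_n => (i : nat) \in s))/= [X in _ * X]big1 ?mule1; last first.
  by move=> i /negbTE si; rewrite /B si preimage_setT probability_setT.
rewrite (eq_bigr (fun i : 'I_n => P (X 0%N @^-1` A (index (i : nat) s)))); last first.
  by move=> i si; rewrite /B si.
rewrite -(big_mkord (fun i => i \in s) (fun i => P (X 0%N @^-1` A (index i s)))).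
rewrite -big_filter (perm_big s) => [|]; last first.
  apply: uniq_perm; rewrite ?filter_uniq ?iota_uniq// => i.
  rewrite mem_filter mem_iota/= add0n subn0; case: (boolP (i \in s)) => //= si.
  by rewrite -(nth_index 0%N si) lt_n ?index_mem.
rewrite (big_nth 0%N) big_mkord; apply: eq_bigr => k _.
by rewrite index_uniq.
Qed.

End Independence.

(** * Laws and independence of triples of units *)

Section SameLaw.
Context {d d' : measure_display} {Omega : measurableType d} {R : realType}
  {E : measurableType d'}.
Variable P : probability Omega R.
Local Open Scope ereal_scope.

Definition same_law (Y Y' : Omega -> E) :=
  forall S, measurable S -> P (Y @^-1` S) = P (Y' @^-1` S).

Lemma same_law_ge0_integral (Y Y' : Omega -> E) (f : E -> \bar R) :
  measurable_fun setT Y -> measurable_fun setT Y' -> same_law Y Y' ->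
  measurable_fun setT f -> (forall x, 0 <= f x) ->
  \int[P]_w f (Y w) = \int[P]_w f (Y' w).
Proof.
move=> mY mY' YY' mf f0.
rewrite -[LHS](ge0_integral_pushforward mY P measurableT)//.
rewrite -[RHS](ge0_integral_pushforward mY' P measurableT)//.
rewrite (eq_measure_integral (image_measure P mY'))// => S mS _.
exact: YY'.
Qed.

Lemma same_law_integral (Y Y' : Omega -> E) (f : E -> \bar R) :
  measurable_fun setT Y -> measurable_fun setT Y' -> same_law Y Y' ->
  measurable_fun setT f -> \int[P]_w f (Y w) = \int[P]_w f (Y' w).
Proof.
move=> mY mY' YY' mf.
have mfp := measurable_funepos mf; have mfn := measurable_funeneg mf.
have H := same_law_ge0_integral mY mY' YY'.
rewrite [LHS]integralE [RHS]integralE.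
congr (_ - _).
  by have := H _ mfp (funepos_ge0 f); rewrite -2![fun w => f^\+ _]/(f^\+ \o _) -!funepos_comp.
by have := H _ mfn (funeneg_ge0 f); rewrite -2![fun w => f^\- _]/(f^\- \o _) -!funeneg_comp.
Qed.

Lemma same_law_integrable (Y Y' : Omega -> E) (f : E -> \bar R) :
  measurable_fun setT Y -> measurable_fun setT Y' -> same_law Y Y' ->
  measurable_fun setT f -> P.-integrable setT (fun w => f (Y w)) ->
  P.-integrable setT (fun w => f (Y' w)).
Proof.
move=> mY mY' YY' mf /integrableP[_ fi]; apply/integrableP; split.
  exact: measurableT_comp mf mY'.
have mabs : measurable_fun setT (abse \o f) by exact: measurableT_comp.
by rewrite -(same_law_ge0_integral mY mY' YY' mabs)// => x; exact: abse_ge0.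
Qed.

End SameLaw.

Section Triples.
Context {d d' : measure_display} {Omega : measurableType d} {R : realType}
  {E : measurableType d'}.
Variable P : probability Omega R.
Variables (X : nat -> Omega -> E).
Hypothesis X_iid : iid P X.
Local Open Scope ereal_scope.

Definition triple (i j k : nat) (w : Omega) : E * (E * E) := (X i w, (X j w, X k w)).

Let mX i : measurable_fun setT (X i). Proof. exact: (iid_measurable X_iid). Qed.

Let mpair j k : measurable_fun setT (fun w => (X j w, X k w)).
Proof. exact: measurable_fun_pair. Qed.

Lemma measurable_triple i j k : measurable_fun setT (triple i j k).
Proof. exact: measurable_fun_pair. Qed.

Let box i j k (A B C : set E) := X i @^-1` A `&` (X j @^-1` B `&` X k @^-1` C).

Let mbox i j k A B C : measurable A -> measurable B -> measurable C ->
  measurable (box i j k A B C).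
Proof.
move=> mA mB mC; apply: measurableI; first exact: measurable_preimage.
by apply: measurableI; exact: measurable_preimage.
Qed.

(** A triple is a nested pair, so [rectangles_determine] is used twice: for the outer pair, and for
    the inner pair with the event on the first unit frozen. *)
Lemma boxes_determine i j k i' j' k' F F' (c : {nonneg R}) :
  measurable F -> measurable F' ->
  (forall A B C, measurable A -> measurable B -> measurable C ->
    P (box i j k A B C `&` F) = c%:num%:E * P (box i' j' k' A B C `&` F')) ->
  forall S, measurable S ->
    P (triple i j k @^-1` S `&` F) = c%:num%:E * P (triple i' j' k' @^-1` S `&` F').
Proof.
move=> mF mF' H; apply: rectangles_determine => //; try exact: measurable_triple.
move=> A S mA mS.
have assoc i0 j0 k0 F0 : triple i0 j0 k0 @^-1` (A `*` S) `&` F0 =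
    (fun w => (X j0 w, X k0 w)) @^-1` S `&` (X i0 @^-1` A `&` F0).
  by apply/seteqP; split => w /=; tauto.
rewrite !assoc; apply: rectangles_determine => //; try exact: measurable_preimage.
- by apply: measurableI => //; exact: measurable_preimage.
- by apply: measurableI => //; exact: measurable_preimage.
move=> B C mB mC; have := H _ _ _ mA mB mC.
have assoc2 i0 j0 k0 F0 : (fun w => (X j0 w, X k0 w)) @^-1` (B `*` C) `&`
    (X i0 @^-1` A `&` F0) =
    box i0 j0 k0 A B C `&` F0.
  by apply/seteqP; split => w /=; rewrite /box /=; tauto.
by rewrite !assoc2.
Qed.

Let p A := P (X 0%N @^-1` A).

Lemma box_prob i j k A B C : uniq [:: i; j; k] ->
  measurable A -> measurable B -> measurable C ->
  P (box i j k A B C) = p A * (p B * p C).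
Proof.
move=> us mA mB mC.
have := iid_rectangle X_iid (A := nth setT [:: A; B; C]) us.
rewrite !big_ord_recl big_ord0/= mule1 => <-; last by case=> [|[|[|k']]] //=; rewrite nth_nil.
congr (P _); apply/seteqP; split => w /=.
  by move=> [? [? ?]] [|[|[|//]]].
by move=> H; split; [exact: (H 0%N)|split; [exact: (H 1%N)|exact: (H 2%N)]].
Qed.

Lemma box_prob2 i j k i' j' k' A B C A' B' C' : uniq [:: i; j; k; i'; j'; k'] ->
  measurable A -> measurable B -> measurable C ->
  measurable A' -> measurable B' -> measurable C' ->
  P (box i j k A B C `&` box i' j' k' A' B' C') =
  P (box i j k A B C) * P (box i' j' k' A' B' C').
Proof.
move=> us mA mB mC mA' mB' mC'.
rewrite !box_prob//; last 2 first.
  by move: us => /(subseq_uniq _); apply;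
    rewrite -[X in subseq _ X]/([:: i; j; k] ++ [:: i'; j'; k']) suffix_subseq.
  by move: us => /(subseq_uniq _); apply;
    rewrite -[X in subseq _ X]/([:: i; j; k] ++ [:: i'; j'; k']) prefix_subseq.
have := iid_rectangle X_iid (A := nth setT [:: A; B; C; A'; B'; C']) us.
rewrite !big_ord_recl big_ord0/= mule1 -!muleA => <-; last first.
  by case=> [|[|[|[|[|[|k0]]]]]] //=; rewrite nth_nil.
congr (P _); apply/seteqP; split => w /=.
  by move=> [[? [? ?]] [? [? ?]]] [|[|[|[|[|[|//]]]]]].
move=> H; split.
  by split; [exact: (H 0%N)|split; [exact: (H 1%N)|exact: (H 2%N)]].
by split; [exact: (H 3%N)|split; [exact: (H 4%N)|exact: (H 5%N)]].
Qed.

Let prob_nng (F : set Omega) : {nonneg R} := NngNum (fine_ge0 (measure_ge0 P F)).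

Let prob_nngE F : measurable F -> P F = (prob_nng F)%:num%:E.
Proof. by move=> mF; rewrite /= fineK// fin_num_measure. Qed.

Lemma triple_law i j k i' j' k' : uniq [:: i; j; k] -> uniq [:: i'; j'; k'] ->
  same_law P (triple i j k) (triple i' j' k').
Proof.
move=> us us' S mS.
have := @boxes_determine i j k i' j' k' setT setT (prob_nng setT) measurableT measurableT _ S mS.
rewrite -(prob_nngE measurableT) probability_setT !setIT mul1e; apply => A B C mA mB mC.
by rewrite !setIT mul1e !box_prob.
Qed.

(** Arbitrary sets are reduced to boxes one triple at a time: for the first with the event on the
    second frozen, then for the second with a box of the first frozen. For two boxes this is the
    product formula over six distinct indices. *)
Lemma triple_indep i j k i' j' k' : uniq [:: i; j; k; i'; j'; k'] ->
  indep P (triple i j k) (triple i' j' k').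
Proof.
move=> us S S' mS mS'.
have mT := measurable_preimage (measurable_triple i' j' k') mS'.
have := @boxes_determine i j k i j k (triple i' j' k' @^-1` S') setT
  (prob_nng (triple i' j' k' @^-1` S')) mT measurableT _ S mS.
rewrite -(prob_nngE mT) setIT [RHS]muleC => -> // A B C mA mB mC.
have mB0 : measurable (box i j k A B C) by exact: mbox.
have := @boxes_determine i' j' k' i' j' k' (box i j k A B C) setT
  (prob_nng (box i j k A B C)) mB0 measurableT _ S' mS'.
rewrite -(prob_nngE mB0) !setIT muleC setIC => -> // A' B' C' mA' mB' mC'.
by rewrite setIT setIC box_prob2// muleC.
Qed.

End Triples.

(** * Real-valued expectations *)

Section RealExpectation.
Context {d : measure_display} {Omega : measurableType d} {R : realType}.
Variable P : probability Omega R.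

Definition rintegrable (f : Omega -> R) := P.-integrable setT (EFin \o f).

(** A total real-valued expectation; [fine] sends infinite values to 0, so the linearity rules ask
    for [rintegrable]. *)
Definition rexp (f : Omega -> R) : R := fine (\int[P]_w (f w)%:E).

Lemma rexpE f : rintegrable f -> (\int[P]_w (f w)%:E)%E = (rexp f)%:E.
Proof. by move=> fi; rewrite /rexp fineK//; exact: integrable_fin_num. Qed.

Lemma rintegrable_le (f g : Omega -> R) : measurable_fun setT f ->
  (forall w, `|f w| <= g w) -> rintegrable g -> rintegrable f.
Proof.
move=> mf fg; apply: le_integrable => //; first exact/measurable_EFinP.
by move=> w _; rewrite lee_fin (le_trans (fg w))// ler_norm.
Qed.

Lemma rintegrableD f g : rintegrable f -> rintegrable g ->
  rintegrable (fun w => f w + g w).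
Proof. by move=> fi gi; exact: (integrableD measurableT fi gi). Qed.

Lemma rintegrableZ c f : rintegrable f -> rintegrable (fun w => c * f w).
Proof. by move=> fi; exact: (integrableZl measurableT c fi). Qed.

Lemma rintegrable_cst c : rintegrable (fun=> c).
Proof. exact: finite_measure_integrable_cst. Qed.

Lemma rintegrable_sum (I : Type) (s : seq I) (A : pred I) (f : I -> Omega -> R) :
  (forall i, A i -> rintegrable (f i)) ->
  rintegrable (fun w => \sum_(i <- s | A i) f i w).
Proof.
move=> fi; elim: s => [|i s IH].
  by under [fun w => _]eq_fun do rewrite big_nil; exact: rintegrable_cst.
case: (boolP (A i)) => Ai; last first.
  by under [fun w => _]eq_fun do rewrite big_cons (negbTE Ai).
under [fun w => _]eq_fun do rewrite big_cons Ai.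
by apply: rintegrableD => //; exact: fi.
Qed.

Lemma rexpD f g : rintegrable f -> rintegrable g ->
  rexp (fun w => f w + g w) = rexp f + rexp g.
Proof.
move=> fi gi; rewrite /rexp.
rewrite (_ : (\int[P]_w (f w + g w)%:E)%E = (\int[P]_w (f w)%:E + \int[P]_w (g w)%:E)%E).
  by rewrite fineD//; exact: integrable_fin_num.
exact: (integralD measurableT fi gi).
Qed.

Lemma rexpZ c f : rintegrable f -> rexp (fun w => c * f w) = c * rexp f.
Proof.
move=> fi; rewrite /rexp.
rewrite (_ : (\int[P]_w (c * f w)%:E)%E = (c%:E * \int[P]_w (f w)%:E)%E).
  by rewrite fineM//; exact: integrable_fin_num.
exact: (integralZl measurableT fi).
Qed.

Lemma rexp_cst c : rexp (fun=> c) = c.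
Proof. by rewrite /rexp integral_cst//= probability_setT mule1. Qed.

Lemma rexp_sum (I : Type) (s : seq I) (A : pred I) (f : I -> Omega -> R) :
  (forall i, A i -> rintegrable (f i)) ->
  rexp (fun w => \sum_(i <- s | A i) f i w) = \sum_(i <- s | A i) rexp (f i).
Proof.
move=> fi; elim: s => [|i s IH].
  by under [fun w => _]eq_fun do rewrite big_nil; rewrite rexp_cst big_nil.
rewrite big_cons; case: (boolP (A i)) => Ai; last first.
  by under [fun w => _]eq_fun do rewrite big_cons (negbTE Ai).
under [fun w => _]eq_fun do rewrite big_cons Ai.
by rewrite rexpD ?IH//; [exact: fi|exact: rintegrable_sum].
Qed.

Lemma le_rexp f g : rintegrable f -> rintegrable g ->
  (forall w, f w <= g w) -> rexp f <= rexp g.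
Proof.
move=> fi gi fg; rewrite -lee_fin -!rexpE//.
by apply: le_integral => // w _; rewrite lee_fin.
Qed.

Lemma rexp_ge0 f : (forall w, 0 <= f w) -> 0 <= rexp f.
Proof. by move=> f0; apply: fine_ge0; apply: integral_ge0 => w _; rewrite lee_fin. Qed.

Lemma rintegrable_sqr_lty (f : Omega -> R) : measurable_fun setT f ->
  (\int[P]_w (f w ^+ 2)%:E < +oo)%E -> rintegrable (fun w => f w ^+ 2).
Proof.
move=> mf fi; apply/integrableP; split.
  by apply/measurable_EFinP; exact: measurable_funX.
rewrite (eq_integral (fun w => (f w ^+ 2)%:E))// => w _ /=.
by rewrite ger0_norm// sqr_ge0.
Qed.

Lemma markov_prob (f : Omega -> R) (t : R) : measurable_fun setT f ->
  (forall w, 0 <= f w) -> rintegrable f -> 0 < t ->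
  (P [set w | (t <= f w)%R] <= (rexp f / t)%:E)%E.
Proof.
move=> mf f0 fi t0.
have mA : measurable [set w | t <= f w].
  rewrite [X in measurable X](_ : _ = f @^-1` `[t, +oo[%classic).
    exact: measurable_preimage.
  by apply/seteqP; split => w /=; rewrite in_itv/= andbT.
have EA : (\int[P]_w (\1_[set w | t <= f w] w)%:E)%E = P [set w | t <= f w].
  by rewrite integral_indic// setIT.
have iA : rintegrable (\1_[set w | t <= f w] : Omega -> R) by exact: integrable_indic.
rewrite -EA rexpE// lee_fin ler_pdivlMr// mulrC -rexpZ//.
apply: le_rexp => //; first exact: rintegrableZ.
move=> w; rewrite indicE; case: (boolP (w \in _)) => [|_]; last by rewrite mulr0.
by rewrite inE /= mulr1.
Qed.

End RealExpectation.

Lemma measurable_sum_cond d (E : measurableType d) (R : realType) (I : Type)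
    (s : seq I) (A : pred I) (h : I -> E -> R) :
  (forall i, A i -> measurable_fun setT (h i)) ->
  measurable_fun setT (fun x => \sum_(i <- s | A i) h i x).
Proof.
move=> mh; under eq_fun do rewrite big_mkcond.
by apply: measurable_sum => i; case: (boolP (A i)) => // /mh.
Qed.

(** * Variance of a U-statistic *)

Section UstatMoments.
Context {d d' : measure_display} {Omega : measurableType d} {R : realType}
  {E : measurableType d'}.
Variable P : probability Omega R.
Variables (X : nat -> Omega -> E).
Hypothesis X_iid : iid P X.

Local Notation T3 := (triple X).

Lemma rexp_triple (w : E * (E * E) -> R) i j k : measurable_fun setT w ->
  uniq [:: i; j; k] ->
  rexp P (fun o => w (T3 i j k o)) = rexp P (fun o => w (T3 0 1 2 o)).
Proof.
move=> mw us; congr fine.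
apply: (same_law_integral (f := fun t => (w t)%:E)); try exact: (measurable_triple X_iid).
  exact: triple_law.
exact/measurable_EFinP.
Qed.

Lemma rintegrable_triple (w : E * (E * E) -> R) i j k : measurable_fun setT w ->
  uniq [:: i; j; k] ->
  rintegrable P (fun o => w (T3 0 1 2 o)) -> rintegrable P (fun o => w (T3 i j k o)).
Proof.
move=> mw us; apply: (same_law_integrable (f := fun t => (w t)%:E));
  try exact: (measurable_triple X_iid).
  exact: triple_law.
exact/measurable_EFinP.
Qed.

(** With the first triple fixed, the second keeps its law and hence its mean zero, so the inner
    integral vanishes. *)
Lemma rexp_indep_centered (g : E * (E * E) -> R) i j k i' j' k' :
  measurable_fun setT g -> rintegrable P (fun o => g (T3 0 1 2 o)) ->
  rexp P (fun o => g (T3 0 1 2 o)) = 0 ->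
  rintegrable P (fun o => g (T3 i j k o) * g (T3 i' j' k' o)) ->
  uniq [:: i; j; k; i'; j'; k'] ->
  rexp P (fun o => g (T3 i j k o) * g (T3 i' j' k' o)) = 0.
Proof.
move=> mg gi g0 ggi us.
have us' : uniq [:: i'; j'; k'].
  apply: subseq_uniq us.
  by rewrite -[X in subseq _ X]/([:: i; j; k] ++ [:: i'; j'; k']) suffix_subseq.
pose f (t : (E * (E * E)) * (E * (E * E))) : \bar R := (g t.1 * g t.2)%:E.
have mf : measurable_fun setT f.
  by apply/measurable_EFinP; apply: measurable_funM; exact: measurableT_comp.
have := indep_fubini (measurable_triple X_iid i j k) (measurable_triple X_iid i' j' k')
  (triple_indep X_iid us) mf ggi.
rewrite /rexp /f /= => ->.
rewrite (eq_integral (cst 0%E)) ?integral_cst ?mul0e// => o _ /=.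
have gi' := rintegrable_triple mg us' gi.
rewrite /cmean /=; under eq_integral do rewrite EFinM.
rewrite (integralZl measurableT gi') [X in (_ * X)%E](rexpE gi').
by rewrite rexp_triple// g0 mule0.
Qed.

Variable n : nat.
Hypothesis n_gt2 : (2 < n)%N.

Lemma anchors3_uniq (I : {ffun 'I_3 -> 'I_n}) : I \in anchors false n 3 ->
  uniq [:: (I ord0 : nat); (I (inord 1) : nat); (I (inord 2) : nat)].
Proof.
rewrite inE/= => /injectiveP inj.
by rewrite /= !inE !(inj_eq val_inj) !(inj_eq inj) -!val_eqE /= !inordK.
Qed.

Lemma anchors3_uniq2 (I I' : {ffun 'I_3 -> 'I_n}) :
  I \in anchors false n 3 -> I' \in anchors false n 3 -> (forall a b, I a != I' b) ->
  uniq [:: (I ord0 : nat); (I (inord 1) : nat); (I (inord 2) : nat);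
           (I' ord0 : nat); (I' (inord 1) : nat); (I' (inord 2) : nat)].
Proof.
move=> /anchors3_uniq uI /anchors3_uniq uI' ne.
rewrite -[X in uniq X]/([:: (I ord0 : nat); (I (inord 1) : nat); (I (inord 2) : nat)] ++ _).
rewrite cat_uniq uI uI' andbT /=.
by rewrite !inE !(inj_eq val_inj) ![_ == I _]eq_sym !(negbTE (ne _ _)).
Qed.

Section Kernel.
Variable w : E * (E * E) -> R.
Hypothesis mw : measurable_fun setT w.
Hypothesis w2 : rintegrable P (fun o => w (T3 0 1 2 o) ^+ 2).

Let mu : R := rexp P (fun o => w (T3 0 1 2 o)).
Let g t : R := w t - mu.

Let mg : measurable_fun setT g. Proof. exact: measurable_funB. Qed.

Let mwT (h : E * (E * E) -> R) i j k : measurable_fun setT h ->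
  measurable_fun setT (fun o => h (T3 i j k o)).
Proof. by move=> mh; apply: measurableT_comp mh _; exact: (measurable_triple X_iid). Qed.

Lemma rintegrable_kernel : rintegrable P (fun o => w (T3 0 1 2 o)).
Proof.
apply: (@rintegrable_le _ _ _ _ _ (fun o => 1 + w (T3 0 1 2 o) ^+ 2)).
- exact: mwT.
- move=> o; rewrite ler_norml; apply/andP; split; nra.
- by apply: rintegrableD => //; exact: rintegrable_cst.
Qed.

Let gi : rintegrable P (fun o => g (T3 0 1 2 o)).
Proof. by apply: rintegrableD rintegrable_kernel _; exact: rintegrable_cst. Qed.

Let g0 : rexp P (fun o => g (T3 0 1 2 o)) = 0.
Proof.
rewrite /g rexpD; [|exact: rintegrable_kernel|exact: rintegrable_cst].
by rewrite rexp_cst subrr.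
Qed.

Let g2i : rintegrable P (fun o => g (T3 0 1 2 o) ^+ 2).
Proof.
apply: (@rintegrable_le _ _ _ _ _ (fun o => 2 * w (T3 0 1 2 o) ^+ 2 + 2 * mu ^+ 2)).
- by apply: measurable_funX; exact: mwT.
- move=> o; rewrite ger0_norm ?sqr_ge0// /g; set x := w _.
  by have := sqr_ge0 (x + mu); nra.
- by apply: rintegrableD; [exact: rintegrableZ|exact: rintegrable_cst].
Qed.

Let v : R := rexp P (fun o => g (T3 0 1 2 o) ^+ 2).

Definition kernel_var : R := v.

Lemma kernel_var_ge0 : 0 <= kernel_var.
Proof. by apply: rexp_ge0 => o; exact: sqr_ge0. Qed.

Definition ustat_of o : R := ustat3 (fun i j k : 'I_n => w (T3 i j k o)).

Let gI (I : {ffun 'I_3 -> 'I_n}) o : R := g (T3 (I ord0) (I (inord 1)) (I (inord 2)) o).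

Let gI2i I : I \in anchors false n 3 -> rintegrable P (fun o => gI I o ^+ 2).
Proof.
move=> /anchors3_uniq us; apply: (@rintegrable_triple (fun t => g t ^+ 2)) => //.
exact: measurable_funX.
Qed.

Let gIE I : I \in anchors false n 3 -> rexp P (fun o => gI I o ^+ 2) = v.
Proof.
move=> /anchors3_uniq us; apply: (@rexp_triple (fun t => g t ^+ 2)) => //.
exact: measurable_funX.
Qed.

Let ggi I I' : I \in anchors false n 3 -> I' \in anchors false n 3 ->
  rintegrable P (fun o => gI I o * gI I' o).
Proof.
move=> IA I'A; apply: (@rintegrable_le _ _ _ _ _ (fun o => gI I o ^+ 2 + gI I' o ^+ 2)).
- by apply: measurable_funM; exact: mwT.
- move=> o; set x := gI I o; set y := gI I' o.
  rewrite ler_norml; apply/andP; split.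
    by have := sqr_ge0 (x + y); nra.
  by have := sqr_ge0 (x - y); nra.
- by apply: rintegrableD; exact: gI2i.
Qed.

Let A3_neq0 : #|anchors false n 3|%:R != 0 :> R.
Proof.
rewrite pnatr_eq0 -lt0n; apply/card_gt0P.
exists [ffun a : 'I_3 => widen_ord n_gt2 a]; rewrite inE/=; apply/injectiveP => a b.
by rewrite !ffunE => /(congr1 val)/= ab; exact: val_inj.
Qed.

Let ustat_centered o : (ustat_of o - mu) ^+ 2 = #|anchors false n 3|%:R^-1 ^+ 2 *
  \sum_(I in anchors false n 3) \sum_(I' in anchors false n 3) gI I o * gI I' o.
Proof.
have -> : ustat_of o - mu = #|anchors false n 3|%:R^-1 * \sum_(I in anchors false n 3) gI I o.
  rewrite /gI /g sumrB sumr_const -[mu *+ _]mulr_natl mulrBr mulKf//.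
by rewrite exprMn [(\sum_(I in _) _) ^+ 2]expr2 big_distrlr.
Qed.

Lemma measurable_ustat : measurable_fun setT ustat_of.
Proof.
apply: measurable_funM => //; apply: measurable_sum_cond => I _; exact: mwT.
Qed.

(** The expanded square is a double sum of covariances over pairs of triples. Disjoint triples
    contribute 0, all others at most the variance of the kernel, and [sum_overlap] counts the
    latter. *)
Lemma ustat_msd : rintegrable P (fun o => (ustat_of o - mu) ^+ 2) /\
  rexp P (fun o => (ustat_of o - mu) ^+ 2) <= 9 * kernel_var / n%:R.
Proof.
have si : rintegrable P (fun o =>
   \sum_(I in anchors false n 3) \sum_(I' in anchors false n 3) gI I o * gI I' o).
  by apply: rintegrable_sum => I IA; apply: rintegrable_sum => I' I'A; exact: ggi.
under [fun o => _ ^+ 2]eq_fun do rewrite ustat_centered.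
split; first exact: rintegrableZ.
rewrite rexpZ// rexp_sum => [|I IA]; last by apply: rintegrable_sum => I' I'A; exact: ggi.
rewrite (eq_bigr (fun I : {ffun 'I_3 -> 'I_n} => \sum_(I' in anchors false n 3)
    rexp P (fun o => gI I o * gI I' o))) => [|I IA]; last first.
  by rewrite rexp_sum// => I' I'A; exact: ggi.
rewrite exprVn ler_pdivrMl ?exprn_gt0 ?lt0r ?A3_neq0 ?ler0n//.
apply: sum_overlap => //.
- exact: kernel_var_ge0.
- move=> I I' IA I'A.
  (* Both squares have the kernel variance as mean, so xy <= (x^2 + y^2)/2 bounds the covariance by
     it. *)
  have ->: kernel_var = 2^-1 * (rexp P (fun o => gI I o ^+ 2) + rexp P (fun o => gI I' o ^+ 2)).
    by rewrite !gIE// /kernel_var; lra.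
  rewrite -rexpD ?gI2i// -rexpZ; last by apply: rintegrableD; exact: gI2i.
  apply: le_rexp; first exact: ggi.
    by apply: rintegrableZ; apply: rintegrableD; exact: gI2i.
  move=> o; set x := gI I o; set y := gI I' o.
  by have := sqr_ge0 (x - y); nra.
- move=> I I' IA I'A ne; apply: rexp_indep_centered => //; first exact: ggi.
  exact: anchors3_uniq2.
Qed.

End Kernel.
End UstatMoments.

(** * Conditional means given one unit *)

Section ConditionalMean.
Context {d d' : measure_display} {Omega : measurableType d} {R : realType}
  {E : measurableType d'}.
Variable P : probability Omega R.
Variables (X : nat -> Omega -> E).
Hypothesis X_iid : iid P X.

Let mX i : measurable_fun setT (X i). Proof. exact: (iid_measurable X_iid). Qed.

Lemma iid_indep01 : indep P (X 0%N) (X 1%N).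
Proof.
move=> A B mA mB; have := iid_rectangle X_iid (A := nth setT [:: A; B]) (s := [:: 0%N; 1%N]) isT.
case: (X_iid) => _ idX _; rewrite (idX 1%N)// !big_ord_recl big_ord0/= mule1 => <-.
  congr (P _); apply/seteqP; split => w /=; first by move=> [? ?] [|[|//]].
  by move=> H; split; [exact: (H 0%N)|exact: (H 1%N)].
by case=> [|[|k]] //=; rewrite nth_nil.
Qed.

Lemma iid_indep01_2 : indep P (fun w => (X 0%N w, X 1%N w)) (X 2%N).
Proof.
move=> S C mS mC.
have mC2 := measurable_preimage (mX 2%N) mC.
have mY : measurable_fun setT (fun w => (X 0%N w, X 1%N w)) by exact: measurable_fun_pair.
pose c : {nonneg R} := NngNum (fine_ge0 (measure_ge0 P (X 2%N @^-1` C))).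
have cE : c%:num%:E = P (X 2%N @^-1` C) by rewrite /= fineK// fin_num_measure.
have := rectangles_determine (c := c) mY mY mC2 measurableT _ mS.
rewrite setIT cE [RHS]muleC; apply => A B mA mB; rewrite setIT.
have rect2 : (fun w => (X 0%N w, X 1%N w)) @^-1` (A `*` B) = X 0%N @^-1` A `&` X 1%N @^-1` B by [].
rewrite rect2 iid_indep01//.
have := iid_rectangle X_iid (A := nth setT [:: A; B; C]) (s := [:: 0%N; 1%N; 2%N]) isT.
case: (X_iid) => _ idX _; rewrite (idX 1%N)// (idX 2%N)// !big_ord_recl big_ord0/= mule1.
move=> prodE; rewrite [RHS]muleC -[RHS]muleA -prodE; last by case=> [|[|[|k]]] //=; rewrite nth_nil.
congr (P _); apply/seteqP; split => w /=; first by move=> [[? ?] ?] [|[|[|//]]].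
by move=> H; split; [split; [exact: (H 0%N)|exact: (H 1%N)]|exact: (H 2%N)].
Qed.

Lemma ae_preimage d1 (E1 : measurableType d1) (Y : Omega -> E1)
    (mY : measurable_fun setT Y) (Q : E1 -> Prop) :
  {ae image_measure P mY, forall x, Q x} -> {ae P, forall w, Q (Y w)}.
Proof.
move=> [N [mN N0 QN]]; exists (Y @^-1` N); split.
- exact: measurable_preimage.
- exact: N0.
- by move=> w nQ; exact: QN.
Qed.

(** [cmean] and [c] have the same integrals over all preimages under [X 0], hence agree almost
    everywhere for the law of [X 0]. This makes an abstract version accessible to Fubini's
    theorem. *)
Lemma cond_exp_ge0_cmean (f : E * E -> R) (c : E -> R) :
  measurable_fun setT f -> (forall x, 0 <= f x) ->
  rintegrable P (fun w => f (X 0%N w, X 1%N w)) ->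
  cond_exp_ge0 P (X 0%N) (fun w => f (X 0%N w, X 1%N w)) c ->
  {ae P, forall w, cmean P (X 1%N) (EFin \o f) (X 0%N w) = (c (X 0%N w))%:E}.
Proof.
move=> mf f0 fi [mc c0 Hc].
have mf' : measurable_fun setT (EFin \o f) by exact/measurable_EFinP.
have mc' : measurable_fun setT (EFin \o c) by exact/measurable_EFinP.
have F0 x : (0 <= cmean P (X 1%N) (EFin \o f) x)%E.
  by apply: integral_ge0 => w _; rewrite lee_fin.
have mF : measurable_fun setT (cmean P (X 1%N) (EFin \o f)).
  by apply: measurable_cmean_ge0 => // x; rewrite lee_fin.
have intS S : measurable S ->
     (\int[P]_(w in X 0%N @^-1` S) cmean P (X 1%N) (EFin \o f) (X 0%N w) =
    \int[P]_(w in X 0%N @^-1` S) (f (X 0%N w, X 1%N w))%:E)%E.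
  move=> mS.
  (* The restriction to a preimage of [S] becomes a factor of the integrand, so Tonelli's theorem
     applies over the whole space. *)
  pose h (x : E * E) : \bar R := (\1_S x.1 * f x)%:E.
  have mh : measurable_fun setT h.
    apply/measurable_EFinP; apply: measurable_funM => //.
    by apply: measurableT_comp => //; exact: measurable_indic.
  have h0 x : (0 <= h x)%E by rewrite lee_fin mulr_ge0// indicE ler0n.
  rewrite [LHS]integral_mkcond [RHS]integral_mkcond !epatch_indic.
  transitivity (\int[P]_w h (X 0%N w, X 1%N w))%E; last first.
    by apply: eq_integral => w _; rewrite /= /h /= [RHS]muleC EFinM.
  rewrite (indep_tonelli (mX 0%N) (mX 1%N) iid_indep01 mh h0).
  apply: eq_integral => w _ /=; rewrite /h /=.
  under [RHS]eq_integral do rewrite EFinM.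
  rewrite ge0_integralZl_EFin//; first by rewrite muleC.
  - by move=> ? _; rewrite lee_fin.
  - exact: (measurable_section (mX 1%N) (X 0%N w) mf').
have : ae_eq (image_measure P (mX 0%N)) setT (cmean P (X 1%N) (EFin \o f)) (EFin \o c).
  apply: integral_ae_eq => //.
    apply: integrable_pushforward => //.
    apply: (@integrable_cmean _ _ _ _ _ _ _ _ _ _ (mX 0%N) (mX 1%N) iid_indep01 (EFin \o f) mf' fi) => //.
  move=> S _ mS.
  rewrite [LHS](ge0_integral_pushforward (mX 0%N) P mS (measurable_funTS mF))
    => [|x _]; last exact: F0.
  rewrite [RHS](ge0_integral_pushforward (mX 0%N) P mS (measurable_funTS mc'))
    => [|x _]; last by rewrite lee_fin.
  by rewrite -[RHS](Hc S mS) -intS//.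
move=> /ae_preimage; apply: filterS => w H; exact: (H Logic.I).
Qed.

Lemma cond_exp_measurable d1 (E1 : measurableType d1) (W : Omega -> E1) f (c : E1 -> R) :
  cond_exp P W f c -> measurable_fun setT c.
Proof.
move=> [cp [cn [[mcp _ _] [mcn _ _] cE]]].
rewrite (_ : c = fun x => cp x - cn x); last exact/funext.
exact: measurable_funB.
Qed.

(** [cond_exp] is defined through the positive and the negative part, and [cmean] splits in the same
    way. *)
Lemma cond_exp_cmean (u : E * E -> R) (a : E -> R) :
  measurable_fun setT u -> rintegrable P (fun w => u (X 0%N w, X 1%N w)) ->
  cond_exp P (X 0%N) (fun w => u (X 0%N w, X 1%N w)) a ->
  {ae P, forall w, cmean P (X 1%N) (EFin \o u) (X 0%N w) = (a (X 0%N w))%:E}.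
Proof.
move=> mu ui [cp [cn [Hp Hn aE]]].
have mY : measurable_fun setT (fun w => (X 0%N w, X 1%N w)) by exact: measurable_fun_pair.
have mup : measurable_fun setT (fun x => Num.max (u x) 0) by exact: measurable_funrpos mu.
have mun : measurable_fun setT (fun x => Num.max (- u x) 0) by exact: measurable_funrneg mu.
have uip : rintegrable P (fun w => Num.max (u (X 0%N w, X 1%N w)) 0).
  apply: (@rintegrable_le _ _ _ _ _ (fun w => `|u (X 0%N w, X 1%N w)|)).
  - exact: measurableT_comp mup mY.
  - by move=> w; rewrite ger0_norm ?le_max ?lexx ?orbT// ge_max ler_norm normr_ge0.
  - exact: integrable_norm.
have uin : rintegrable P (fun w => Num.max (- u (X 0%N w, X 1%N w)) 0).
  apply: (@rintegrable_le _ _ _ _ _ (fun w => `|u (X 0%N w, X 1%N w)|)).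
  - exact: measurableT_comp mun mY.
  - by move=> w; rewrite ger0_norm ?le_max ?lexx ?orbT// ge_max -normrN ler_norm normr_ge0.
  - exact: integrable_norm.
have max0 x : 0 <= Num.max (u x) 0 by rewrite le_max lexx orbT.
have max0' x : 0 <= Num.max (- u x) 0 by rewrite le_max lexx orbT.
have := cond_exp_ge0_cmean mup max0 uip Hp; have := cond_exp_ge0_cmean mun max0' uin Hn.
apply: filterS2 => w Hn' Hp'; rewrite cmeanE aE EFinB -Hp' -Hn'.
have -> : (EFin \o u)^\+%E = EFin \o (fun x => Num.max (u x) 0).
  by apply/funext => x; rewrite unlock /= EFin_max.
have -> // : (EFin \o u)^\-%E = EFin \o (fun x => Num.max (- u x) 0).
by apply/funext => x; rewrite unlock /= EFin_max EFinN.
Qed.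

(** Given [X 0], the two factors are independent with conditional means a(X_0) and b(X_0). The third
    unit is integrated out first, then the second. *)
Lemma rexp_cmeanM (u v : E * E -> R) (a b : E -> R) :
  measurable_fun setT u -> measurable_fun setT v ->
  rintegrable P (fun w => u (X 0%N w, X 1%N w)) ->
  rintegrable P (fun w => v (X 0%N w, X 1%N w)) ->
  rintegrable P (fun w => u (X 0%N w, X 1%N w) * v (X 0%N w, X 2%N w)) ->
  cond_exp P (X 0%N) (fun w => u (X 0%N w, X 1%N w)) a ->
  cond_exp P (X 0%N) (fun w => v (X 0%N w, X 1%N w)) b ->
  rintegrable P (fun w => a (X 0%N w) * b (X 0%N w)) /\
  rexp P (fun w => u (X 0%N w, X 1%N w) * v (X 0%N w, X 2%N w)) =
  rexp P (fun w => a (X 0%N w) * b (X 0%N w)).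
Proof.
move=> mu mv ui vi uvi ca cb.
have ma := cond_exp_measurable ca; have mb := cond_exp_measurable cb.
have mY : measurable_fun setT (fun w => (X 0%N w, X 1%N w)) by exact: measurable_fun_pair.
have := cond_exp_cmean mu ui ca; have := cond_exp_cmean mv vi cb => Hb Ha.
have mu' : measurable_fun setT (EFin \o u) by exact/measurable_EFinP.
have mv' : measurable_fun setT (EFin \o v) by exact/measurable_EFinP.
have Ia := indep_ae_integrable (mX 0%N) (mX 1%N) iid_indep01 mu' ui.
have Ib := indep_ae_integrable (mX 0%N) (mX 1%N) iid_indep01 mv' vi.
(* [b] is a conditional mean for the pair of units 0 and 1, but is needed for the pair 0 and 2. *)
have law12 : same_law P (X 1%N) (X 2%N).
  by case: X_iid => _ idX _ S mS; rewrite (idX 1%N)// (idX 2%N).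
pose f (t : (E * E) * E) : \bar R := (u t.1 * v (t.1.1, t.2))%:E.
have mf : measurable_fun setT f.
  apply/measurable_EFinP; apply: measurable_funM; first exact: measurableT_comp.
  apply: measurableT_comp mv _; apply: measurable_fun_pair => //.
  exact: measurableT_comp.
pose q (x : E * E) : R := u x * b x.1.
have mq : measurable_fun setT q.
  by apply: measurable_funM => //; exact: measurableT_comp.
(* Integrating out unit 2 replaces the factor [v] by [b]. *)
have fq : {ae P, forall w, cmean P (X 2%N) f (X 0%N w, X 1%N w) = (q (X 0%N w, X 1%N w))%:E}.
  move: Hb Ib; apply: filterS2 => w Hbw Ibw.
  rewrite /cmean /f /=; under eq_integral do rewrite EFinM.
  have mvw : measurable_fun setT (fun x => (v (X 0%N w, x))%:E).
    exact: measurableT_comp mv' (pair1_measurable _).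
  have Ibw2 := same_law_integrable (mX 1%N) (mX 2%N) law12 mvw Ibw.
  rewrite (integralZl measurableT Ibw2) -(same_law_integral (mX 1%N) (mX 2%N) law12 mvw).
  by rewrite -[X in (_ * X)%E]/(cmean P (X 1%N) (EFin \o v) (X 0%N w)) Hbw.
have mfY := measurable_cmean P (mX 2%N) mf.
have Ifq := integrable_cmean mY (mX 2%N) iid_indep01_2 mf uvi mf (fun=> lexx _).
have Fub1 := indep_fubini mY (mX 2%N) iid_indep01_2 mf uvi.
have mfYw : measurable_fun setT (fun w => cmean P (X 2%N) f (X 0%N w, X 1%N w)).
  exact: measurableT_comp mfY mY.
have mqw : measurable_fun setT (fun w => (q (X 0%N w, X 1%N w))%:E).
  by apply/measurable_EFinP; exact: measurableT_comp mq mY.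
have qi : rintegrable P (fun w => q (X 0%N w, X 1%N w)).
  case/integrableP: Ifq => _ fin; apply/integrableP; split => //.
  rewrite (ae_eq_integral (fun w => `|cmean P (X 2%N) f (X 0%N w, X 1%N w)|%E))//.
  - exact: measurableT_comp.
  - exact: measurableT_comp.
  - by move: fq; apply: filterS => w Hw _ /=; rewrite Hw.
have E1 : (\int[P]_w (u (X 0%N w, X 1%N w) * v (X 0%N w, X 2%N w))%:E =
           \int[P]_w (q (X 0%N w, X 1%N w))%:E)%E.
  rewrite [LHS]Fub1; apply: ae_eq_integral => //.
  by move: fq; apply: filterS => w Hw _.
have mq' : measurable_fun setT (EFin \o q) by exact/measurable_EFinP.
have Fub2 := indep_fubini (mX 0%N) (mX 1%N) iid_indep01 mq' qi.
have Iq := integrable_cmean (mX 0%N) (mX 1%N) iid_indep01 mq' qi mq' (fun=> lexx _).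
have mab : measurable_fun setT (fun w => (a (X 0%N w) * b (X 0%N w))%:E).
  by apply/measurable_EFinP; apply: measurable_funM; exact: measurableT_comp.
have mqc : measurable_fun setT (fun w => cmean P (X 1%N) (EFin \o q) (X 0%N w)).
  by apply: measurableT_comp (mX 0%N); apply: measurable_cmean => //; exact: mX.
(* Integrating out unit 1 replaces the factor [u] by [a]. *)
have qab : {ae P, forall w, cmean P (X 1%N) (EFin \o q) (X 0%N w) = (a (X 0%N w) * b (X 0%N w))%:E}.
  move: Ha Ia; apply: filterS2 => w Haw Iaw.
  rewrite /cmean /q /=; under eq_integral do rewrite mulrC EFinM.
  rewrite (integralZl measurableT Iaw) -[X in (_ * X)%E]/(cmean P (X 1%N) (EFin \o u) (X 0%N w)).
  by rewrite Haw mulrC EFinM.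
split.
  case/integrableP: Iq => _ fin; apply/integrableP; split => //.
  rewrite (ae_eq_integral (fun w => `|cmean P (X 1%N) (EFin \o q) (X 0%N w)|%E))//.
  - exact: measurableT_comp.
  - exact: measurableT_comp.
  - by move: qab; apply: filterS => w Hw _ /=; rewrite Hw.
rewrite /rexp E1 [X in fine X = _]Fub2; congr fine; apply: ae_eq_integral => //.
by move: qab; apply: filterS => w Hw _.
Qed.

Lemma rexp_cmean (u : E * E -> R) (a : E -> R) :
  measurable_fun setT u -> rintegrable P (fun w => u (X 0%N w, X 1%N w)) ->
  cond_exp P (X 0%N) (fun w => u (X 0%N w, X 1%N w)) a ->
  rintegrable P (fun w => a (X 0%N w)) /\
  rexp P (fun w => u (X 0%N w, X 1%N w)) = rexp P (fun w => a (X 0%N w)).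
Proof.
move=> mu ui ca; have ma := cond_exp_measurable ca.
have qa := cond_exp_cmean mu ui ca.
have mu' : measurable_fun setT (EFin \o u) by exact/measurable_EFinP.
have Fub := indep_fubini (mX 0%N) (mX 1%N) iid_indep01 mu' ui.
have Iq := integrable_cmean (mX 0%N) (mX 1%N) iid_indep01 mu' ui mu' (fun=> lexx _).
have mac : measurable_fun setT (fun w => (a (X 0%N w))%:E).
  by apply/measurable_EFinP; exact: measurableT_comp.
have mqc : measurable_fun setT (fun w => cmean P (X 1%N) (EFin \o u) (X 0%N w)).
  by apply: measurableT_comp (mX 0%N); apply: measurable_cmean => //; exact: mX.
split.
  case/integrableP: Iq => _ fin; apply/integrableP; split => //.
  rewrite (ae_eq_integral (fun w => `|cmean P (X 1%N) (EFin \o u) (X 0%N w)|%E))//.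
  - exact: measurableT_comp.
  - exact: measurableT_comp.
  - by move: qa; apply: filterS => w Hw _ /=; rewrite Hw.
rewrite /rexp [X in fine X = _]Fub; congr fine; apply: ae_eq_integral => //.
by move: qa; apply: filterS => w Hw _.
Qed.

(** The mean of [a] is that of [u], hence 0, so the covariance is the mean of the product, which
    [rexp_cmeanM] evaluates. *)
Lemma covariance_cmean (u v : E * E -> R) (a b : E -> R) :
  measurable_fun setT u -> measurable_fun setT v ->
  rintegrable P (fun w => u (X 0%N w, X 1%N w)) ->
  rintegrable P (fun w => v (X 0%N w, X 1%N w)) ->
  rintegrable P (fun w => u (X 0%N w, X 1%N w) * v (X 0%N w, X 2%N w)) ->
  cond_exp P (X 0%N) (fun w => u (X 0%N w, X 1%N w)) a ->
  cond_exp P (X 0%N) (fun w => v (X 0%N w, X 1%N w)) b ->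
  rexp P (fun w => u (X 0%N w, X 1%N w)) = 0 ->
  fine (covariance P (fun w => a (X 0%N w)) (fun w => b (X 0%N w))) =
  rexp P (fun w => u (X 0%N w, X 1%N w) * v (X 0%N w, X 2%N w)).
Proof.
move=> mu mv ui vi uvi ca cb u0.
have [ai uE] := rexp_cmean mu ui ca; have [bi _] := rexp_cmean mv vi cb.
have [abi ->] := rexp_cmeanM mu mv ui vi uvi ca cb.
have a0 : (\int[P]_w (a (X 0%N w))%:E = 0)%E by rewrite rexpE// -uE u0.
rewrite covarianceE; try exact/Lfun1_integrable.
by rewrite !expectation.unlock a0 mul0e sube0.
Qed.

End ConditionalMean.

(** * Perturbation of the sandwich *)

Section MatrixNorm.
Context {R : realType}.

Lemma mx_entry_le p q (M : 'M[R]_(p, q)) i j : `|M i j| <= `|M|.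
Proof.
rewrite [leRHS](_ : _ = mx_norm M)// mx_normrE.
exact: (le_bigmax _ (fun ij => `|M ij.1 ij.2|) (i, j)).
Qed.

Lemma mx_norm_le p q (M : 'M[R]_(p, q)) c : 0 <= c ->
  (forall i j, `|M i j| <= c) -> `|M| <= c.
Proof.
move=> c0 Mc; rewrite [leLHS](_ : _ = mx_norm M)// mx_normrE.
by apply/bigmax_leP; split => // -[i j] _; exact: Mc.
Qed.

Lemma mx_norm_le_sum p q (M : 'M[R]_(p, q)) : `|M| <= \sum_i \sum_j `|M i j|.
Proof.
apply: mx_norm_le => [|i j]; first by apply: sumr_ge0 => i _; exact: sumr_ge0.
rewrite (bigD1 i)//= (bigD1 j)//= -addrA lerDl addr_ge0//; first exact: sumr_ge0.
by apply: sumr_ge0 => ? _; exact: sumr_ge0.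
Qed.

(** The norm is the largest absolute entry, and an entry of the product has q terms; hence the
    factor [q]. *)
Lemma mulmx_norm_le p q r (A : 'M[R]_(p, q)) (B : 'M[R]_(q, r)) :
  `|A *m B| <= q%:R * `|A| * `|B|.
Proof.
apply: mx_norm_le => [|i j]; first by rewrite !mulr_ge0.
rewrite mxE (le_trans (ler_norm_sum _ _ _))//.
apply: (@le_trans _ _ (\sum_(k < q) `|A| * `|B|)).
  by apply: ler_sum => k _; rewrite normrM ler_pM ?mx_entry_le.
by rewrite sumr_const card_ord -[leLHS]mulr_natl mulrA.
Qed.

Lemma trmx_norm p q (A : 'M[R]_(p, q)) : `|A^T| = `|A|.
Proof.
apply/eqP; rewrite eq_le; apply/andP; split.
  by apply: mx_norm_le => // i j; rewrite mxE mx_entry_le.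
by apply: mx_norm_le => // i j; have := mx_entry_le A^T j i; rewrite mxE.
Qed.

Lemma mulmx3_norm_le q (A B C : 'M[R]_q) :
  `|A *m B *m C| <= q%:R ^+ 2 * (`|A| * `|B| * `|C|).
Proof.
apply: le_trans (mulmx_norm_le _ _) _.
rewrite expr2 -!mulrA ler_wpM2l// !mulrA ler_wpM2r//.
by rewrite -mulrA (le_trans (mulmx_norm_le _ _))// mulrA.
Qed.

(** Invertibility of [B']: its kernel K satisfies K = -K (B' - B) B^(-1), whose norm is at most half
    that of K, so K = 0. The bounds then follow from the resolvent identity for the difference of
    two inverses. *)
Lemma invmx_perturb q (B B' : 'M[R]_q) : B \in unitmx ->
  q%:R ^+ 2 * `|invmx B| * `|B' - B| <= 2^-1 ->
  `|invmx B'| <= 2 * `|invmx B| /\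
  `|invmx B' - invmx B| <= 2 * q%:R ^+ 2 * `|invmx B| ^+ 2 * `|B' - B|.
Proof.
move=> uB small.
have uB' : B' \in unitmx.
  rewrite -row_free_unit -kermx_eq0; apply/eqP/normr0_eq0; apply/eqP.
  set K := kermx B'; have KE : K = - (K *m (B' - B) *m invmx B).
    by rewrite mulmxBr mulmx_ker sub0r mulNmx opprK mulmxK.
  have : `|K| <= `|K| * 2^-1.
    rewrite {1}KE normrN (le_trans (mulmx3_norm_le _ _ _))//.
    apply: le_trans (ler_wpM2l (normr_ge0 K) small).
    by rewrite le_eqVlt; apply/orP; left; apply/eqP; ring.
  by have := normr_ge0 K; rewrite eq_le; lra.
have XE : invmx B' - invmx B = - (invmx B' *m (B' - B) *m invmx B).
  by rewrite mulmxBr mulmxBl mulVmx// mul1mx mulmxK// opprB.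
have dX : `|invmx B' - invmx B| <= q%:R ^+ 2 * `|invmx B| * `|B' - B| * `|invmx B'|.
  rewrite XE normrN (le_trans (mulmx3_norm_le _ _ _))//.
  by rewrite le_eqVlt; apply/orP; left; apply/eqP; ring.
have X'le : `|invmx B'| <= 2 * `|invmx B|.
  have : `|invmx B'| <= `|invmx B| + `|invmx B' - invmx B|.
    by rewrite -{1}[invmx B'](subrK (invmx B)) addrC ler_normD.
  have : `|invmx B' - invmx B| <= 2^-1 * `|invmx B'|.
    by apply: (le_trans dX); rewrite ler_wpM2r.
  lra.
split => //; apply: (le_trans dX).
apply: le_trans (ler_wpM2l _ X'le) _; first by rewrite !mulr_ge0 ?exprn_ge0.
by rewrite le_eqVlt; apply/orP; left; apply/eqP; ring.
Qed.

Lemma sandwich_lipschitz q (B Sigma : 'M[R]_q) : B \in unitmx ->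
  exists c C : R, [/\ 0 < c, 0 <= C & forall B' Sigma', `|B' - B| <= c ->
    `|sandwich B' Sigma' - sandwich B Sigma| <= C * (`|B' - B| + `|Sigma' - Sigma|)].
Proof.
move=> uB; pose X := invmx B; pose x := `|X|; have x0 : 0 <= x by exact: normr_ge0.
have M3 (A1 A2 A3 : 'M[R]_q) := mulmx3_norm_le A1 A2 A3.
have IP B' := @invmx_perturb q B B' uB.
set k := q%:R ^+ 2 : R in M3 IP; have k0 : 0 <= k by rewrite exprn_ge0.
clearbody k; rewrite -/X -/x in IP.
(* The radius c gives k x c <= 1/2, and the 1 keeps it positive. In the Lipschitz constant, 4 x^2
   bounds the square of the perturbed inverse, 3 = 2 + 1 collects the two terms that are linear in
   the error of the inverse, and the outer 4 is the factor in [sandwich]. *)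
exists (2 * (k * x + 1))^-1, (4 * (k * (4 * x ^+ 2) + k * (3 * x * `|Sigma|) * (2 * k * x ^+ 2))).
have kx0 : 0 <= k * x by rewrite mulr_ge0.
split; first by rewrite invr_gt0; lra.
  by rewrite !(mulr_ge0, addr_ge0, exprn_ge0).
move=> B' Sigma' dB.
have small : k * x * `|B' - B| <= 2^-1.
  apply: (le_trans (ler_wpM2l kx0 dB)).
  by rewrite invfM mulrCA ler_piMr// ler_pdivrMr; lra.
have [X'le dX] := IP _ small.
set X' := invmx B' in X'le dX *.
(* Telescoping over the three factors, one of them changing in each term. *)
have -> : sandwich B' Sigma' - sandwich B Sigma =
    4 *: (X' *m (Sigma' - Sigma) *m X'^T + (X' - X) *m Sigma *m X'^T
          + X *m Sigma *m (X' - X)^T).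
  rewrite /sandwich -/X -/X' -scalerBr; congr (_ *: _).
  by rewrite [(_ - _)^T]raddfB !(mulmxBr, mulmxBl) !addrA !subrK.
rewrite normrZ ger0_norm// -mulrA ler_wpM2l//.
set dS := `|Sigma' - Sigma|; set dBn := `|B' - B| in small dX *.
have dS0 : 0 <= dS by exact: normr_ge0.
have dB0 : 0 <= dBn by exact: normr_ge0.
have t1 : `|X' *m (Sigma' - Sigma) *m X'^T| <= k * (4 * x ^+ 2) * dS.
  apply: (le_trans (M3 _ _ _)); rewrite trmx_norm -[leRHS]mulrA ler_wpM2l//.
  rewrite -/dS mulrAC ler_wpM2r//.
  rewrite (le_trans (ler_pM _ _ X'le X'le))//.
  by rewrite le_eqVlt; apply/orP; left; apply/eqP; ring.
have t2 : `|(X' - X) *m Sigma *m X'^T| <= k * (2 * x * `|Sigma|) * (2 * k * x ^+ 2) * dBn.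
  apply: (le_trans (M3 _ _ _)); rewrite trmx_norm -!mulrA ler_wpM2l//.
  apply: (@le_trans _ _ ((2 * k * x ^+ 2 * dBn) * (`|Sigma| * (2 * x)))).
    by apply: ler_pM => //; rewrite ler_wpM2l.
  by rewrite le_eqVlt; apply/orP; left; apply/eqP; ring.
have t3 : `|X *m Sigma *m (X' - X)^T| <= k * (x * `|Sigma|) * (2 * k * x ^+ 2) * dBn.
  apply: (le_trans (M3 _ _ _)); rewrite trmx_norm -!mulrA ler_wpM2l//.
  rewrite -/x ler_wpM2l// ler_wpM2l//.
  by move: dX; rewrite !mulrA.
apply: le_trans (ler_normD _ _) _; apply: le_trans (lerD (ler_normD _ _) (lexx _)) _.
apply: le_trans (lerD (lerD t1 t2) t3) _.
set Z := k * x * `|Sigma| * (2 * k * x ^+ 2).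
have Z0 : 0 <= Z by rewrite !mulr_ge0 ?exprn_ge0.
have W0 : 0 <= k * (4 * x ^+ 2) by rewrite !mulr_ge0 ?exprn_ge0.
have -> : k * (2 * x * `|Sigma|) * (2 * k * x ^+ 2) * dBn = 2 * Z * dBn by rewrite /Z; ring.
have -> : k * (x * `|Sigma|) * (2 * k * x ^+ 2) * dBn = Z * dBn by rewrite /Z; ring.
have -> : k * (3 * x * `|Sigma|) * (2 * k * x ^+ 2) = 3 * Z by rewrite /Z; ring.
have := mulr_ge0 Z0 dS0; have := mulr_ge0 W0 dB0.
set W := k * (4 * x ^+ 2) in W0 *; nra.
Qed.

End MatrixNorm.

(** * Stochastic orders *)

Section StochasticBounds.
Context {d : measure_display} {Omega : measurableType d} {R : realType}.
Variable P : probability Omega R.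
Implicit Types (N : nat -> Omega -> R) (a b : nat -> R) (A : nat -> set Omega).

(* [bigOp P X a] is [sbd (fun r w => `|X r w|) a] by conversion. *)
Definition sbd N a :=
  forall eps : R, 0 < eps -> exists C : R, \forall r \near \oo,
    exists E : set Omega, [/\ measurable E, ((1 - eps)%:E <= P E)%E &
      forall omega, E omega -> N r omega <= C * a r].

Lemma prob_setI_ge (E F : set Omega) (e f : R) : measurable E -> measurable F ->
  ((1 - e)%:E <= P E)%E -> ((1 - f)%:E <= P F)%E ->
  ((1 - (e + f))%:E <= P (E `&` F))%E.
Proof.
move=> mE mF PE PF.
have mC (G : set Omega) : measurable G -> P (~` G) = (1 - P G)%E.
  by move=> mG; exact: probability_setC.
have fin (G : set Omega) : measurable G -> P G = (fine (P G))%:E.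
  by move=> mG; rewrite fineK// fin_num_measure.
have mEF : measurable (E `&` F) by exact: measurableI.
have H : (P (~` (E `&` F)) <= P (~` E) + P (~` F))%E.
  by rewrite setCI; apply: measureU2; exact: measurableC.
move: H PE PF; rewrite !mC// (fin _ mE) (fin _ mF) (fin _ mEF).
rewrite -!EFinB -EFinD !lee_fin; lra.
Qed.

Lemma wp_to_oneI A A' : wp_to_one P A -> wp_to_one P A' ->
  wp_to_one P (fun r => A r `&` A' r).
Proof.
move=> HA HA' eps e0; have e20 : 0 < eps / 2 by lra.
have := HA _ e20; have := HA' _ e20; apply: filterS2 => r [F [mF PF FA]] [E [mE PE EA]].
exists (E `&` F); split; first exact: measurableI.
  by have := prob_setI_ge mE mF PE PF; rewrite -splitr.
by move=> w [/EA ? /FA ?].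
Qed.

Lemma wp_to_oneS A A' : (\forall r \near \oo, A r `<=` A' r) ->
  wp_to_one P A -> wp_to_one P A'.
Proof.
move=> AA' HA eps e0; move: (HA _ e0); move: AA'; apply: filterS2 => r AA' [E [mE PE EA]].
by exists E; split => //; exact: subset_trans AA'.
Qed.

(** The comparison may fail outside [A r]; this is how bounds that hold only near the true parameter
    enter. *)
Lemma sbd_le_wp N N' a A : wp_to_one P A ->
  (\forall r \near \oo, forall w, A r w -> N' r w <= N r w) -> sbd N a -> sbd N' a.
Proof.
move=> HA NN' HN eps e0; have e20 : 0 < eps / 2 by lra.
have [C HC] := HN _ e20; exists C.
near=> r.
have [E [mE PE EN]] : exists E : set Omega, [/\ measurable E, ((1 - eps / 2)%:E <= P E)%E &
      forall omega, E omega -> N r omega <= C * a r] by near: r.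
have [F [mF PF FA]] : exists E : set Omega,
      [/\ measurable E, ((1 - eps / 2)%:E <= P E)%E & E `<=` A r] by near: r; exact: HA.
have NN'r : forall w, A r w -> N' r w <= N r w by near: r.
exists (E `&` F); split; first exact: measurableI.
  by have := prob_setI_ge mE mF PE PF; rewrite -splitr.
by move=> w [Ew /FA Aw]; apply: le_trans (NN'r _ Aw) (EN _ Ew).
Unshelve. all: by end_near. Qed.

Lemma wp_to_oneT : wp_to_one P (fun=> setT).
Proof.
move=> eps e0; near=> r; exists setT; split => //.
by rewrite probability_setT lee_fin; lra.
Unshelve. all: by end_near. Qed.

Lemma sbd_le N N' a : (\forall r \near \oo, forall w, N' r w <= N r w) ->
  sbd N a -> sbd N' a.
Proof.
by move=> NN'; apply: sbd_le_wp wp_to_oneT _; apply: filterS NN' => r H w _.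
Qed.

Lemma sbdD N N' a : sbd N a -> sbd N' a -> sbd (fun r w => N r w + N' r w) a.
Proof.
move=> HN HN' eps e0; have e20 : 0 < eps / 2 by lra.
have [C HC] := HN _ e20; have [C' HC'] := HN' _ e20; exists (C + C').
move: HC HC'; apply: filterS2 => r [E [mE PE EN]] [F [mF PF FN]].
exists (E `&` F); split; first exact: measurableI.
  by have := prob_setI_ge mE mF PE PF; rewrite -splitr.
by move=> w [/EN ? /FN ?]; rewrite mulrDl lerD.
Qed.

Lemma sbdZ K N a : 0 <= K -> sbd N a -> sbd (fun r w => K * N r w) a.
Proof.
move=> K0 HN eps /HN[C HC]; exists (K * C).
move: HC; apply: filterS => r [E [mE PE EN]]; exists E; split => // w /EN H.
by rewrite -mulrA ler_wpM2l.
Qed.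

Lemma sbd_rate K N a b : (\forall r \near \oo, 0 <= a r <= K * b r) ->
  sbd N a -> sbd N b.
Proof.
(* The constant [C] may be negative, hence the absolute value. *)
move=> ab HN eps /HN[C HC]; exists (`|C| * K).
move: ab HC; apply: filterS2 => r /andP[a0 ab] [E [mE PE EN]]; exists E; split => // w /EN H.
apply: (le_trans H); rewrite -mulrA; apply: (@le_trans _ _ (`|C| * a r)).
  by rewrite ler_wpM2r// ler_norm.
by rewrite ler_wpM2l.
Qed.

Lemma sbd_cst K N a : (\forall r \near \oo, forall w, N r w <= K * a r) -> sbd N a.
Proof.
move=> H eps e0; exists K; move: H; apply: filterS => r H; exists setT; split => //.
by rewrite probability_setT lee_fin; lra.
Qed.

Lemma sbdM N N' a b : (forall r w, 0 <= N r w) -> (forall r w, 0 <= N' r w) ->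
  sbd N a -> sbd N' b -> sbd (fun r w => N r w * N' r w) (fun r => a r * b r).
Proof.
move=> N0 N'0 HN HN' eps e0; have e20 : 0 < eps / 2 by lra.
have [C HC] := HN _ e20; have [C' HC'] := HN' _ e20; exists (C * C').
move: HC HC'; apply: filterS2 => r [E [mE PE EN]] [F [mF PF FN]].
exists (E `&` F); split; first exact: measurableI.
  by have := prob_setI_ge mE mF PE PF; rewrite -splitr.
by move=> w [/EN ? /FN ?]; rewrite mulrACA ler_pM.
Qed.

Lemma sbd_sum (I : Type) (s : seq I) (N : I -> nat -> Omega -> R) a :
  (forall i, sbd (N i) a) -> sbd (fun r w => \sum_(i <- s) N i r w) a.
Proof.
move=> HN; elim: s => [|i s IH].
  by apply: (@sbd_cst 0); near=> r => w; rewrite big_nil mul0r.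
by apply: sbd_le (sbdD (HN i) IH); near=> r => w; rewrite big_cons.
Unshelve. all: by end_near. Qed.

Lemma sbd_mx p q (X : nat -> Omega -> 'M[R]_(p, q)) a :
  (forall i j, sbd (fun r w => `|X r w i j|) a) -> sbd (fun r w => `|X r w|) a.
Proof.
move=> HX.
apply: sbd_le (_ : sbd (fun r w => \sum_i \sum_j `|X r w i j|) a).
  by near=> r => w; exact: mx_norm_le_sum.
by apply: sbd_sum => i; apply: sbd_sum => j; exact: HX.
Unshelve. all: by end_near. Qed.

Lemma sbd_sqr N a : (forall r, 0 <= a r) ->
  sbd (fun r w => N r w ^+ 2) (fun r => a r ^+ 2) -> sbd (fun r w => `|N r w|) a.
Proof.
(* The square of this constant is at least [C]. *)
move=> a0 HN eps /HN[C HC]; exists (`|C| + 1); move: HC; apply: filterS.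
move=> r [E [mE PE EN]]; exists E; split => // w /EN H.
rewrite -(ger0_norm (a0 r)) -[X in X * _](@ger0_norm _ (`|C| + 1)) ?addr_ge0//.
rewrite -normrM -ler_sqr ?nnegrE// !real_normK ?num_real//.
apply: (le_trans H); rewrite exprMn ler_wpM2r ?sqr_ge0//.
by have := ler_norm C; have := normr_ge0 C; nra.
Qed.

Lemma sbd_wp N a (c : R) : 0 < c -> a @ \oo --> (0 : R) -> (forall r, 0 <= a r) ->
  sbd N a -> wp_to_one P (fun r => [set w | N r w <= c]).
Proof.
move=> c0 a0 age0 HN eps /HN[C HC].
have D0 : 0 < `|C| + 1 by rewrite ltr_wpDl.
near=> r.
have [E [mE PE EN]] : exists E : set Omega, [/\ measurable E, ((1 - eps)%:E <= P E)%E &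
      forall omega, E omega -> N r omega <= C * a r] by near: r.
exists E; split => // w /EN H /=.
have : a r <= c / (`|C| + 1).
  have : `|0 - a r| < c / (`|C| + 1).
    by near: r; move/cvgrPdist_lt : a0; apply; rewrite divr_gt0.
  by rewrite sub0r normrN ger0_norm// => /ltW.
rewrite ler_pdivlMr// => H2; apply: (le_trans H).
apply: le_trans H2; rewrite mulrC ler_wpM2l//.
by have := ler_norm C; lra.
Unshelve. all: by end_near. Qed.

Lemma sbd_markov (f : nat -> Omega -> R) a K :
  (\forall r \near \oo, [/\ measurable_fun setT (f r), rintegrable P (f r),
     (forall w, 0 <= f r w), rexp P (f r) <= K * a r & 0 < a r]) -> sbd f a.
Proof.
move=> H eps e0.
have D0 : 0 < `|K| + 1 by rewrite ltr_wpDl.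
(* Markov's inequality at this level leaves a probability of at most [eps]; the 1 keeps the level
   positive. *)
exists ((`|K| + 1) / eps); move: H; apply: filterS => r [mf fi f0 fK a0].
set t := (`|K| + 1) / eps * a r.
have t0 : 0 < t by rewrite mulr_gt0// divr_gt0.
have mt : measurable [set w | t <= f r w].
  rewrite [X in measurable X](_ : _ = f r @^-1` `[t, +oo[%classic).
    exact: measurable_preimage.
  by apply/seteqP; split => w /=; rewrite in_itv/= andbT.
exists (~` [set w | t <= f r w]); split; first exact: measurableC.
  rewrite probability_setC// EFinB; apply: leeB => //.
  apply: le_trans (markov_prob mf f0 fi t0) _; rewrite lee_fin.
  rewrite ler_pdivrMr// /t mulrA mulrCA mulfV ?gt_eqF// mulr1.
  by apply: (le_trans fK); rewrite ler_wpM2r ?(ltW a0)//; have := ler_norm K; lra.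
by move=> w /= /negP; rewrite -ltNge => /ltW.
Qed.

End StochasticBounds.

(** * Random designs *)

Section Design.
Context {d d' : measure_display} {Omega : measurableType d} {R : realType}
  {E : measurableType d'}.
Variables (P : probability Omega R) (X : nat -> Omega -> E).
Hypothesis X_iid : iid P X.

Definition sample n (o : Omega) : n.-tuple E := [tuple X i o | i < n].

Lemma tnth_sample n o i : tnth (sample n o) i = X i o.
Proof. by rewrite tnth_mktuple. Qed.

Lemma measurable_sample n : measurable_fun setT (sample n).
Proof.
apply/measurable_fun_tnthP => i; rewrite (_ : _ \o _ = X i).
  exact: iid_measurable X_iid i.
by apply/funext => o /=; rewrite tnth_sample.
Qed.

Variables (n s : nat) (D : Omega -> design n s) (w : design n s -> R).

Definition random_design :=
  [/\ (forall D0, measurable (D @^-1` [set D0])),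
      (forall D0 (S : set (n.-tuple E)), measurable S ->
         (P (sample n @^-1` S `&` D @^-1` [set D0]) =
          P (sample n @^-1` S) * (w D0)%:E)%E),
      (forall D0, 0 <= w D0) & \sum_D0 w D0 <= 1].

Lemma prob_bigsetU_le (I : Type) (l : seq I) (A : I -> set Omega) :
  (forall i, measurable (A i)) ->
  (P (\big[setU/set0]_(i <- l) A i) <= \sum_(i <- l) P (A i))%E.
Proof.
move=> mA; elim: l => [|i l IH]; first by rewrite !big_nil measure0.
rewrite !big_cons; apply: le_trans (measureU2 _ _ _) _ => //.
  exact: bigsetU_measurable.
exact: leeD2l.
Qed.

Hypothesis rD : random_design.

(** The design takes finitely many values. By independence the event that [Phi] reaches [t] while
    the design is [D0] has probability w(D0) times that for a fixed design, to which Markov's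
    inequality applies; a union bound adds these up. *)
Lemma design_markov (Phi : design n s -> n.-tuple E -> R) (c t : R) :
  (forall D0, measurable_fun setT (Phi D0)) -> (forall D0 y, 0 <= Phi D0 y) ->
  (forall D0, w D0 != 0 -> rintegrable P (fun o => Phi D0 (sample n o))) ->
  \sum_D0 w D0 * rexp P (fun o => Phi D0 (sample n o)) <= c -> 0 < t ->
  exists F : set Omega, [/\ measurable F, ((1 - c / t)%:E <= P F)%E &
    forall o, F o -> Phi (D o) (sample n o) <= t].
Proof.
case: rD => mD indD w0 _ mPhi Phi0 iPhi Hc t0.
have mt D0 : measurable [set y | t <= Phi D0 y].
  rewrite [X in measurable X](_ : _ = Phi D0 @^-1` `[t, +oo[%classic).
    exact: measurable_preimage.
  by apply/seteqP; split => y /=; rewrite in_itv/= andbT.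
pose bad D0 := sample n @^-1` [set y | t <= Phi D0 y] `&` D @^-1` [set D0].
have mbad D0 : measurable (bad D0).
  by apply: measurableI => //; apply: measurable_preimage => //; exact: measurable_sample.
have mB : measurable (\big[setU/set0]_(D0 <- index_enum (design n s)) bad D0).
  exact: bigsetU_measurable.
exists (~` \big[setU/set0]_(D0 <- index_enum (design n s)) bad D0); split.
- exact: measurableC.
- rewrite probability_setC// EFinB; apply: leeB => //.
  apply: le_trans (prob_bigsetU_le _ mbad) _.
  apply: (@le_trans _ _ (\sum_D0 (w D0 * rexp P (fun o => Phi D0 (sample n o)) / t)%:E)%E).
    apply: lee_sum => D0 _; rewrite /bad indD//.
    have [->|wD] := eqVneq (w D0) 0; first by rewrite mule0 !mul0r.
    rewrite -mulrA mulrC EFinM; apply: lee_wpmul2r; first by rewrite lee_fin.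
    have mPs : measurable_fun setT (fun o => Phi D0 (sample n o)).
      exact: measurableT_comp (mPhi D0) (@measurable_sample n).
    exact: (markov_prob mPs (fun o => Phi0 D0 _) (iPhi _ wD) t0).
  by rewrite sumEFin lee_fin -mulr_suml ler_wpM2r// invr_ge0 ltW.
- move=> o; rewrite -bigcup_seq => nbad; rewrite leNgt; apply/negP => /ltW tPhi.
  by apply: nbad; exists (D o); rewrite /= ?mem_index_enum.
Qed.

End Design.

Section SquareIntegrable.
Context {d : measure_display} {Omega : measurableType d} {R : realType}.
Variable P : probability Omega R.

Definition sqintegrable (f : Omega -> R) :=
  measurable_fun setT f /\ rintegrable P (fun o => f o ^+ 2).

Lemma sqintegrableD f g : sqintegrable f -> sqintegrable g ->
  sqintegrable (fun o => f o + g o).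
Proof.
move=> [mf fi] [mg gi]; split; first exact: measurable_funD.
apply: (@rintegrable_le _ _ _ _ _ (fun o => 2 * (f o ^+ 2 + g o ^+ 2))).
- by apply: measurable_funX; exact: measurable_funD.
- by move=> o; rewrite ger0_norm ?sqr_ge0//; have := sqr_ge0 (f o - g o); nra.
- by apply: rintegrableZ; exact: rintegrableD.
Qed.

Lemma sqintegrableZ c f : sqintegrable f -> sqintegrable (fun o => c * f o).
Proof.
move=> [mf fi]; split; first exact: measurable_funM.
under [fun o => _]eq_fun do rewrite exprMn.
exact: rintegrableZ.
Qed.

Lemma sqintegrable_sum (I : Type) (l : seq I) (A : pred I) (f : I -> Omega -> R) :
  (forall i, A i -> sqintegrable (f i)) ->
  sqintegrable (fun o => \sum_(i <- l | A i) f i o).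
Proof.
move=> fi; elim: l => [|i l IH].
  under [fun o => _]eq_fun do rewrite big_nil.
  by split => //; exact: rintegrable_cst.
case: (boolP (A i)) => Ai; last first.
  by under [fun w => _]eq_fun do rewrite big_cons (negbTE Ai).
under [fun w => _]eq_fun do rewrite big_cons Ai.
by apply: sqintegrableD => //; exact: fi.
Qed.

End SquareIntegrable.

(** * Anchor averages over a random design *)

Section Scheme.
Context {d d' : measure_display} {Omega : measurableType d} {R : realType}
  {E : measurableType d'}.
Variables (P : probability Omega R) (X : nat -> Omega -> E).
Hypothesis X_iid : iid P X.

Let mX i : measurable_fun setT (X i). Proof. exact: (iid_measurable X_iid). Qed.

Let mpair (K : E * E -> R) i j : measurable_fun setT K ->
  measurable_fun setT (fun o => K (X i o, X j o)).
Proof. by move=> mK; apply: measurableT_comp mK _; exact: measurable_fun_pair. Qed.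

Lemma rexp_pair (K : E * E -> R) i j : measurable_fun setT K -> i != j ->
  rexp P (fun o => K (X i o, X j o)) = rexp P (fun o => K (X 0%N o, X 1%N o)).
Proof.
move=> mK ij; pose w (t : E * (E * E)) := K (t.1, t.2.1).
have mw : measurable_fun setT w.
  apply: measurableT_comp mK _; apply: measurable_fun_pair => //.
  exact: measurableT_comp.
(* The index [(i + j).+1] exceeds both others and so completes them to a triple of distinct
   indices. *)
apply: (rexp_triple X_iid (w := w) (i := i) (j := j) (k := (i + j).+1) mw).
by rewrite /= !inE negb_or ij/= andbT !neq_ltn !ltnS leq_addr leq_addl.
Qed.

Lemma rintegrable_pair (K : E * E -> R) i j : measurable_fun setT K -> i != j ->
  rintegrable P (fun o => K (X 0%N o, X 1%N o)) -> rintegrable P (fun o => K (X i o, X j o)).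
Proof.
move=> mK ij; pose w (t : E * (E * E)) := K (t.1, t.2.1).
have mw : measurable_fun setT w.
  apply: measurableT_comp mK _; apply: measurable_fun_pair => //.
  exact: measurableT_comp.
apply: (rintegrable_triple X_iid (w := w) (i := i) (j := j) (k := (i + j).+1) mw).
by rewrite /= !inE negb_or ij/= andbT !neq_ltn !ltnS leq_addr leq_addl.
Qed.

Definition arr n (K : E * E -> R) (y : n.-tuple E) (i j : 'I_n) : R :=
  K (tnth y i, tnth y j).

Lemma arr_sample n K o (i j : 'I_n) : arr K (sample X n o) i j = K (X i o, X j o).
Proof. by rewrite /arr !tnth_sample. Qed.

Lemma measurable_arr n K (i j : 'I_n) : measurable_fun setT K ->
  measurable_fun setT (fun y => arr K y i j).
Proof.
move=> mK; apply: measurableT_comp mK _.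
by apply: measurable_fun_pair; exact: measurable_tnth.
Qed.

Variables (n s m : nat -> nat) (D : forall r, Omega -> design (n r) (s r))
  (w : forall r, design (n r) (s r) -> R).
Arguments w : clear implicits.

(* Covers both the anchor-partner scheme and, with a deterministic design, the
   estimator based on all pairs. *)
Definition sampling_scheme :=
  [/\ (forall r, random_design P X (D r) (w r)),
      (forall r D0, w r D0 != 0 -> forall a, D0.2 a \in partners (m r) (D0.1 a)) &
      (forall r (f : 'I_(n r) -> {set 'I_(n r)} -> R),
        \sum_D0 w r D0 * (anchor_avg D0 f - pop_avg (m r) f) ^+ 2 <=
        (s r)%:R^-1 * pop_avg (m r) (fun i J => f i J ^+ 2))].

Hypothesis scheme : sampling_scheme.
Hypotheses (n_infty : n @ \oo --> \oo) (s_gt0 : forall r, (0 < s r)%N)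
  (m_range : forall r, (0 < m r < n r)%N).

Lemma design_sbd (Phi : forall r, design (n r) (s r) -> (n r).-tuple E -> R) K b :
  (forall r D0, measurable_fun setT (Phi r D0)) -> (forall r D0 y, 0 <= Phi r D0 y) ->
  (forall r D0, w r D0 != 0 -> rintegrable P (fun o => Phi r D0 (sample X (n r) o))) ->
  (\forall r \near \oo, 0 < b r /\
     \sum_D0 w r D0 * rexp P (fun o => Phi r D0 (sample X (n r) o)) <= K * b r) ->
  sbd P (fun r o => Phi r (D r o) (sample X (n r) o)) b.
Proof.
move=> mPhi Phi0 iPhi H eps e0; case: scheme => rD _ _.
have D0 : 0 < `|K| + 1 by rewrite ltr_wpDl.
exists ((`|K| + 1) / eps); move: H; apply: filterS => r [b0 Hr].
have t0 : 0 < (`|K| + 1) / eps * b r by rewrite mulr_gt0// divr_gt0.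
have [F [mF PF FP]] :=
  design_markov X_iid (rD r) (mPhi r) (Phi0 r) (iPhi r) Hr t0.
exists F; split => //; apply: le_trans PF; rewrite lee_fin lerB//.
rewrite ler_pdivrMr// mulrA mulrCA mulfV ?gt_eqF// mulr1.
by rewrite ler_wpM2r ?(ltW b0)//; have := ler_norm K; lra.
Qed.

Let m_gt0 r : (0 < m r)%N. Proof. by case/andP: (m_range r). Qed.
Let m_lt r : (m r < n r)%N. Proof. by case/andP: (m_range r). Qed.

Lemma measurable_pmean r (J : {set 'I_(n r)}) (i : 'I_(n r)) K : measurable_fun setT K ->
  measurable_fun setT (fun y : (n r).-tuple E => pmean (m r) J (arr K y i)).
Proof.
move=> mK; apply: measurable_funM => //; apply: measurable_sum_cond => j _.
exact: measurable_arr.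
Qed.

Section Average.
Variable K : E * E -> R.
Hypotheses (mK : measurable_fun setT K) (K0 : forall x, 0 <= K x)
  (Ki : rintegrable P (fun o => K (X 0%N o, X 1%N o))).

Lemma partners_neq r (i j : 'I_(n r)) J : J \in partners (m r) i -> j \in J -> (i : nat) != j.
Proof.
by rewrite inE => /andP[_ iJ] jJ; apply: contraNneq iJ => /val_inj ->.
Qed.

Lemma rintegrable_pmean r (i : 'I_(n r)) J : J \in partners (m r) i ->
  rintegrable P (fun o => pmean (m r) J (arr K (sample X (n r) o) i)).
Proof.
move=> JP; apply: rintegrableZ; apply: rintegrable_sum => j jJ.
under [fun o => _]eq_fun do rewrite arr_sample.
by apply: rintegrable_pair => //; exact: partners_neq JP jJ.
Qed.

Lemma rexp_pmean r (i : 'I_(n r)) J : J \in partners (m r) i ->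
  rexp P (fun o => pmean (m r) J (arr K (sample X (n r) o) i)) =
  rexp P (fun o => K (X 0%N o, X 1%N o)).
Proof.
move=> JP; have Kij j : j \in J -> rintegrable P (fun o => arr K (sample X (n r) o) i j).
  move=> jJ; under [fun o => _]eq_fun do rewrite arr_sample.
  by apply: rintegrable_pair => //; exact: partners_neq JP jJ.
rewrite rexpZ; last exact: rintegrable_sum.
rewrite rexp_sum// (eq_bigr (fun=> rexp P (fun o => K (X 0%N o, X 1%N o)))).
  have := JP; rewrite sumr_const inE => /andP[/eqP-> _].
  by rewrite -[X in _ * X]mulr_natl mulKf// pnatr_eq0 -lt0n m_gt0.
move=> j jJ; under [fun o => _]eq_fun do rewrite arr_sample.
by apply: rexp_pair => //; exact: partners_neq JP jJ.
Qed.

Lemma pmean_ge0 r (i : 'I_(n r)) J y : 0 <= pmean (m r) J (arr K y i).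
Proof. by apply: mulr_ge0; [rewrite invr_ge0 ler0n|apply: sumr_ge0 => j _; exact: K0]. Qed.

(** Each design in the support averages [K] over pairs of distinct units, so its mean is that of [K]
    whatever the design, and Markov's inequality applies. *)
Lemma sbd_anchor_avg : sbd P (fun r o =>
    anchor_avg (D r o) (fun i J => pmean (m r) J (arr K (sample X (n r) o) i))) (fun=> 1).
Proof.
case: scheme => rD supp _.
apply: (@design_sbd (fun r D0 y => anchor_avg D0 (fun i J => pmean (m r) J (arr K y i)))
   (rexp P (fun o => K (X 0%N o, X 1%N o)))).
- move=> r D0; apply: measurable_funM => //; apply: measurable_sum => a.
  exact: measurable_pmean.
- move=> r D0 y; apply: mulr_ge0; first by rewrite invr_ge0 ler0n.
  by apply: sumr_ge0 => a _; exact: pmean_ge0.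
- move=> r D0 wD; apply: rintegrableZ; apply: rintegrable_sum => a _.
  by apply: rintegrable_pmean; exact: supp.
- near=> r; split => //; case: (rD r) => _ _ w0 w1.
  apply: (@le_trans _ _ (\sum_D0 w r D0 * rexp P (fun o => K (X 0%N o, X 1%N o)))).
    apply: ler_sum => D0 _; have [->|wD] := eqVneq (w r D0) 0; first by rewrite !mul0r.
    apply: ler_wpM2l => //; rewrite rexpZ; last first.
      by apply: rintegrable_sum => a _; apply: rintegrable_pmean; exact: supp.
    rewrite rexp_sum; last by move=> a _; apply: rintegrable_pmean; exact: supp.
    rewrite (eq_bigr (fun=> rexp P (fun o => K (X 0%N o, X 1%N o)))).
      by rewrite sumr_const card_ord -[X in _ * X]mulr_natl mulKf// pnatr_eq0 -lt0n s_gt0.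
    by move=> a _; apply: rexp_pmean; exact: supp.
  rewrite -mulr_suml mulr1 ler_piMl//; apply: rexp_ge0 => o; exact: K0.
Unshelve. all: by end_near. Qed.

Lemma rintegrable_pop_avg r : rintegrable P (fun o =>
    pop_avg (m r) (fun i J => pmean (m r) J (arr K (sample X (n r) o) i))).
Proof.
apply: rintegrableZ; apply: rintegrable_sum => i _; apply: rintegrableZ.
by apply: rintegrable_sum => J JP; exact: rintegrable_pmean.
Qed.

Lemma rexp_pop_avg r : rexp P (fun o =>
    pop_avg (m r) (fun i J => pmean (m r) J (arr K (sample X (n r) o) i))) =
  rexp P (fun o => K (X 0%N o, X 1%N o)).
Proof.
set e := RHS.
have iPA i : rintegrable P (fun o => partner_avg (m r) i
    (fun J => pmean (m r) J (arr K (sample X (n r) o) i))).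
  by apply: rintegrableZ; apply: rintegrable_sum => J JP; exact: rintegrable_pmean.
have ePA i : rexp P (fun o => partner_avg (m r) i
    (fun J => pmean (m r) J (arr K (sample X (n r) o) i))) = e.
  rewrite rexpZ; last by apply: rintegrable_sum => J JP; exact: rintegrable_pmean.
  rewrite rexp_sum => [|J JP]; last exact: rintegrable_pmean.
  rewrite (eq_bigr (fun=> e)) => [|J JP]; last exact: rexp_pmean.
  by rewrite sumr_const -[X in _ * X]mulr_natl mulKf// partners_neq0.
rewrite rexpZ; last by apply: rintegrable_sum => i _; exact: iPA.
rewrite rexp_sum => [|i _]; last exact: iPA.
rewrite (eq_bigr (fun=> e)) => [|i _]; last exact: ePA.
rewrite sumr_const card_ord -[X in _ * X]mulr_natl mulKf// pnatr_eq0 -lt0n.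
exact: leq_ltn_trans (m_lt r).
Qed.

(** For fixed data the scheme bounds the sampling variance by 1/s times the population average of
    the squares. The mean over the data of that average is at most the mean of the majorant [K]. *)
Lemma sbd_anchor_fluct (f : forall r, (n r).-tuple E -> 'I_(n r) -> {set 'I_(n r)} -> R) :
  (forall r i J, measurable_fun setT (fun y => f r y i J)) ->
  (forall r y i J, J \in partners (m r) i -> f r y i J ^+ 2 <= pmean (m r) J (arr K y i)) ->
  sbd P (fun r o => `|anchor_avg (D r o) (f r (sample X (n r) o)) -
                      pop_avg (m r) (f r (sample X (n r) o))|)
        (fun r => rsqrt (s r)).
Proof.
move=> mf fK; case: scheme => rD supp msd.
have mfs r i J : measurable_fun setT (fun o => f r (sample X (n r) o) i J).
  by apply: measurableT_comp (mf r i J) _; exact: (measurable_sample X_iid).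
have fi r i J : J \in partners (m r) i -> sqintegrable P (fun o => f r (sample X (n r) o) i J).
  move=> JP; split => //.
  apply: (@rintegrable_le _ _ _ _ _
    (fun o => pmean (m r) J (arr K (sample X (n r) o) i))).
  - exact: measurable_funX.
  - by move=> o; rewrite ger0_norm ?sqr_ge0// fK.
  - exact: rintegrable_pmean.
have mA r (D0 : design (n r) (s r)) : measurable_fun setT (fun y => anchor_avg D0 (f r y)).
  by apply: measurable_funM => //; apply: measurable_sum => a; exact: mf.
have mPop r : measurable_fun setT (fun y => pop_avg (m r) (f r y)).
  apply: measurable_funM => //; apply: measurable_sum => i.
  by apply: measurable_funM => //; apply: measurable_sum_cond => J _; exact: mf.
have sqi r D0 : w r D0 != 0 -> sqintegrable P (fun o =>
    anchor_avg D0 (f r (sample X (n r) o)) - pop_avg (m r) (f r (sample X (n r) o))).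
  move=> wD; apply: sqintegrableD.
    by apply: sqintegrableZ; apply: sqintegrable_sum => a _; apply: fi; exact: supp.
  under [fun o => _]eq_fun do rewrite -mulN1r.
  apply: sqintegrableZ; apply: sqintegrableZ; apply: sqintegrable_sum => i _.
  by apply: sqintegrableZ; apply: sqintegrable_sum => J JP; exact: fi.
apply: sbd_sqr => [r|]; first by rewrite /rsqrt invr_ge0 sqrtr_ge0.
apply: (@design_sbd (fun r D0 y => (anchor_avg D0 (f r y) - pop_avg (m r) (f r y)) ^+ 2)
   (rexp P (fun o => K (X 0%N o, X 1%N o)))).
- by move=> r D0; apply: measurable_funX; exact: measurable_funB (mA r D0) (mPop r).
- by move=> r D0 y; exact: sqr_ge0.
- by move=> r D0 wD; case: (sqi r D0 wD).
near=> r; rewrite /rsqrt exprVn sqr_sqrtr ?ler0n//; split.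
  by rewrite invr_gt0 ltr0n s_gt0.
have wi D0 : rintegrable P (fun o => w r D0 *
    (anchor_avg D0 (f r (sample X (n r) o)) - pop_avg (m r) (f r (sample X (n r) o))) ^+ 2).
  have [->|wD] := eqVneq (w r D0) 0.
    by under [fun o => _]eq_fun do rewrite mul0r; exact: rintegrable_cst.
  by apply: rintegrableZ; case: (sqi r D0 wD).
(* The sum over the designs moves inside the expectation, where the variance bound of the scheme
   holds sample by sample. *)
rewrite (eq_bigr (fun D0 => rexp P (fun o => w r D0 *
    (anchor_avg D0 (f r (sample X (n r) o)) - pop_avg (m r) (f r (sample X (n r) o))) ^+ 2))).
  rewrite -rexp_sum; last by move=> D0 _; exact: wi.
  rewrite -(rexp_pop_avg r) mulrC -rexpZ; last exact: rintegrable_pop_avg.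
  apply: le_rexp; first by apply: rintegrable_sum => D0 _; exact: wi.
    by apply: rintegrableZ; exact: rintegrable_pop_avg.
  move=> o; apply: (le_trans (msd r _)).
  apply: ler_wpM2l; first by rewrite invr_ge0 ler0n.
  apply: ler_wpM2l; first by rewrite invr_ge0 ler0n.
  apply: ler_sum => i _; apply: ler_wpM2l; first by rewrite invr_ge0 ler0n.
  by apply: ler_sum => J JP; exact: fK.
move=> D0 _; have [->|wD] := eqVneq (w r D0) 0.
  by rewrite mul0r; under [fun o => _]eq_fun do rewrite mul0r; rewrite rexp_cst.
by rewrite rexpZ//; case: (sqi r D0 wD).
Unshelve. all: by end_near. Qed.

End Average.

Lemma sbd_ustat (g : E * (E * E) -> R) : measurable_fun setT g ->
  rintegrable P (fun o => g (triple X 0 1 2 o) ^+ 2) ->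
  sbd P (fun r o => `|ustat3 (fun i j k : 'I_(n r) => g (triple X i j k o)) -
                     rexp P (fun o => g (triple X 0 1 2 o))|)
        (fun r => rsqrt (n r)).
Proof.
move=> mg g2; apply: sbd_sqr => [r|]; first by rewrite /rsqrt invr_ge0 sqrtr_ge0.
apply: (@sbd_markov _ _ _ _ _ _ (9 * kernel_var P X g)).
near=> r.
(* Triples of distinct units exist only from n = 3 on, hence eventually. *)
have n2 : (2 < n r)%N.
  by near: r; move: n_infty => /cvgnyPgt; apply.
have [ui ule] := ustat_msd X_iid n2 mg g2.
rewrite /rsqrt exprVn sqr_sqrtr ?ler0n//; split => //.
- apply: measurable_funX; apply: measurable_funB => //.
  exact: (measurable_ustat X_iid (n r) mg).
- by move=> o; exact: sqr_ge0.
- by rewrite invr_gt0 ltr0n; exact: ltn_trans n2.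
Unshelve. all: by end_near. Qed.

End Scheme.

(** * The uniform scheme and the scheme of all pairs *)

Section Schemes.
Context {d d' : measure_display} {Omega : measurableType d} {R : realType}
  {E : measurableType d'}.
Variables (P : probability Omega R) (X : nat -> Omega -> E).
Variable n : nat -> nat.

Definition uniform_weight (repl : bool) (s m : nat -> nat) r (D0 : design (n r) (s r)) : R :=
  (D0 \in designs repl (n r) (s r) (m r))%:R / #|designs repl (n r) (s r) (m r)|%:R.

Lemma designs_partners repl n0 s0 m0 (D0 : design n0 s0) a :
  D0 \in designs repl n0 s0 m0 -> D0.2 a \in partners m0 (D0.1 a).
Proof.
rewrite inE => /and3P[_ /forallP/(_ a) cD /forallP/(_ a) nD].
by rewrite inE cD nD.
Qed.

Lemma uniform_scheme repl s m (D : forall r, Omega -> design (n r) (s r)) :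
  (forall r, (0 < s r)%N) -> (forall r, (0 < m r < n r)%N) ->
  (forall r (D0 : design (n r) (s r)), measurable (D r @^-1` [set D0])) ->
  (forall r (D0 : design (n r) (s r)) (S : set ((n r).-tuple E)), measurable S ->
     (P (sample X (n r) @^-1` S `&` D r @^-1` [set D0]) =
      P (sample X (n r) @^-1` S) * (@uniform_weight repl s m r D0)%:E)%E) ->
  sampling_scheme P X m D (@uniform_weight repl s m).
Proof.
move=> s_gt0 m_range mD D_law; split.
- move=> r; split; [exact: mD|exact: D_law| |].
    by move=> D0; rewrite /uniform_weight mulr_ge0 ?invr_ge0 ?ler0n.
  rewrite /uniform_weight -mulr_suml.
  have -> : \sum_D0 (D0 \in designs repl (n r) (s r) (m r))%:R =
      #|designs repl (n r) (s r) (m r)|%:R :> R.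
    by rewrite -sumr_const [in RHS]big_mkcond /=; apply: eq_bigr => D0 _; case: (D0 \in _).
  have [->|q0] := eqVneq (#|designs repl (n r) (s r) (m r)|%:R : R) 0; first by rewrite mul0r.
  by rewrite divff.
- move=> r D0 wD a; apply: (@designs_partners repl).
  by apply: contraNT wD => nD; rewrite /uniform_weight (negbTE nD) mul0r.
- move=> r f; have /andP[m0 mn] := m_range r.
  have -> : \sum_D0 @uniform_weight repl s m r D0 * (anchor_avg D0 f - pop_avg (m r) f) ^+ 2 =
      #|designs repl (n r) (s r) (m r)|%:R^-1 * \sum_(D0 in designs repl (n r) (s r) (m r))
        (anchor_avg D0 f - pop_avg (m r) f) ^+ 2.
    rewrite mulr_sumr [in RHS]big_mkcond /=; apply: eq_bigr => D0 _; rewrite /uniform_weight.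
    by case: (D0 \in _); rewrite ?mul0r// mul1r.
  have pop0 : 0 <= (s r)%:R^-1 * pop_avg (m r) (fun i J => f i J ^+ 2).
    by rewrite mulr_ge0 ?invr_ge0 ?ler0n// pop_avg_ge0// => i J; exact: sqr_ge0.
  have [q0|q0] := eqVneq (#|designs repl (n r) (s r) (m r)|%:R : R) 0.
    by rewrite q0 invr0 mul0r.
  rewrite ler_pdivrMl ?lt_neqAle ?ler0n 1?eq_sym ?q0//.
  by apply: anchor_avg_msd => //; exact: ltn_trans mn.
Qed.

Definition full_weight r (D0 : design (n r) (n r)) : R := (D0 == full_design (n r))%:R.

(** A constant design is independent of the data, and by [anchor_avg_full] its sampling error is
    0. *)
Lemma full_scheme : (forall r, (1 < n r)%N) ->
  sampling_scheme P X (fun r => (n r).-1) (fun r (_ : Omega) => full_design (n r)) full_weight.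
Proof.
move=> n_gt1; split.
- move=> r; split.
  + move=> D0; have [eqD|ne] := pselect (full_design (n r) = D0).
      by rewrite (_ : _ @^-1` _ = setT)//; apply/seteqP; split.
    by rewrite (_ : _ @^-1` _ = set0)//; apply/seteqP; split.
  + move=> D0 S mS; rewrite /full_weight; have [->|ne] := eqVneq D0 (full_design (n r)).
      by rewrite mule1; congr (P _); apply/seteqP; split => o //= [].
    rewrite mule0 (_ : _ `&` _ = set0) ?measure0//.
    by apply/seteqP; split => o //= [_ E0]; rewrite E0 eqxx in ne.
  + by move=> D0; exact: ler0n.
  + rewrite (bigD1 (full_design (n r)))//= /full_weight eqxx big1 ?addr0// => D0.
    by move/negbTE => ->.
- move=> r D0; rewrite /full_weight; have [-> _ a|_] := eqVneq D0 (full_design (n r)).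
    apply: (@designs_partners false); apply: full_designP.
    exact: ltn_trans (n_gt1 r).
  by rewrite eqxx.
- move=> r f; rewrite (bigD1 (full_design (n r)))//= big1 => [|D0].
    rewrite anchor_avg_full ?subrr ?expr0n/= ?mulr0 ?addr0; last exact: ltn_trans (n_gt1 r).
    by rewrite mulr_ge0 ?invr_ge0 ?ler0n// pop_avg_ge0// => i J; exact: sqr_ge0.
  by rewrite /full_weight => /negbTE ->; rewrite mul0r.
Qed.

End Schemes.

(** * Measurability of the estimating function *)

Section DirectionalDerivatives.
Context {R : realType} {V : normedModType R}.
Implicit Types (f g : V -> R) (x v : V).

Lemma derivable_add f g x v : derivable f x v -> derivable g x v ->
  derivable (fun y => f y + g y) x v.
Proof. by move=> df dg; rewrite -[X in derivable X]/(f + g); apply: derivableD. Qed.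

Lemma derivable_sub f g x v : derivable f x v -> derivable g x v ->
  derivable (fun y => f y - g y) x v.
Proof. by move=> df dg; rewrite -[X in derivable X]/(f - g); apply: derivableB. Qed.

Lemma derivable_mul f g x v : derivable f x v -> derivable g x v ->
  derivable (fun y => f y * g y) x v.
Proof. by move=> df dg; have := derivableM df dg; rewrite mulrfctE. Qed.

(** On the line through [x] in direction [v] the map [l] is affine in one real variable, which
    leaves the chain rule on the reals. Both links are applied to linear forms in theta. *)
Lemma derivable_affine (l : V -> R) (phi : R -> R) x v :
  (forall h, l (h *: v + x) = h * l v + l x) -> (forall r : R, derivable phi r 1) ->
  derivable (fun y => phi (l y)) x v.
Proof.
move=> lE dphi; apply/derivable1P.
rewrite (_ : (fun h : R => _) = phi \o (fun h : R => h * l v + l x)); last first.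
  by apply/funext => h /=; rewrite lE.
apply/derivable1_diffP; apply: differentiable_comp; last exact/derivable1_diffP.
apply: differentiableD => //.
Qed.

(** The derivative is the pointwise limit of the difference quotients with steps 1/(k+1), each of
    which is measurable. *)
Lemma measurable_derive d (E : measurableType d) (F : E -> V -> R) x v :
  (forall y, derivable (F y) x v) -> (forall x', measurable_fun setT (F ^~ x')) ->
  measurable_fun setT (fun y => 'D_v (F y) x).
Proof.
move=> dF mF.
pose u (k : nat) : R := k.+1%:R^-1.
pose q k y := (u k)^-1 * (F y (u k *: v + x) - F y x).
apply: (@measurable_fun_cvg _ _ _ _ q) => [k|y _].
  by apply: measurable_funM => //; apply: measurable_funB; exact: mF.
have : cvg (h^-1 *: ((F y \o shift x) (h *: v) - F y x) @[h --> 0^']) by exact: dF.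
rewrite -[X in _ -> _ --> X]/(lim (h^-1 *: ((F y \o shift x) (h *: v) - F y x) @[h --> 0^'])).
move=> /cvgr_dnbhsP /(_ u); apply; split.
  by move=> k; rewrite invr_eq0 pnatr_eq0.
exact: cvg_harmonic.
Qed.

End DirectionalDerivatives.

(* x / (x^2 + 1/k) tends to 1/x, also at x = 0 where the inverse is 0. *)
Lemma measurable_inv d (E : measurableType d) (R : realType) (f : E -> R) :
  measurable_fun setT f -> measurable_fun setT (fun x => (f x)^-1).
Proof.
move=> mf; pose g (k : nat) (x : R) : R := x / (x ^+ 2 + k.+1%:R^-1).
have g_gt0 k (x : R) : 0 < x ^+ 2 + k.+1%:R^-1 :> R.
  by rewrite ltr_wpDl ?sqr_ge0// invr_gt0 ltr0n.
apply: (@measurable_fun_cvg _ _ _ _ (fun k x => g k (f x))) => [k|x _].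
  apply: measurableT_comp mf; apply: continuous_measurable_fun => x.
  apply: cvgM; first exact: cvg_id.
  apply: cvgV; first by rewrite gt_eqF// g_gt0.
  by apply: cvgD; [exact: exprn_continuous|exact: cvg_cst].
have [->|fx0] := eqVneq (f x) 0.
  rewrite invr0 (_ : (fun k => _) = fun=> 0); first exact: cvg_cst.
  by apply/funext => k; rewrite /g mul0r.
rewrite -[X in _ --> X](_ : f x / (f x ^+ 2 + 0) = _); last first.
  by rewrite addr0 expr2 invfM mulVKf.
apply: cvgM; first exact: cvg_cst.
apply: cvgV; first by rewrite addr0 sqrf_eq0.
by apply: cvgD; [exact: cvg_cst|exact: cvg_harmonic].
Qed.

Section ModelMeasurability.
Context {R : realType} {T p : nat}.
Notation E := (unit_data R T p).
Variable G : gee_model R T p.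
Hypotheses (varphi_monotone :
     {homo varphi G : x y / x <= y} \/ {homo varphi G : x y /~ x <= y})
  (link_pi_derivable : forall x : R, derivable (link_pi G) x 1)
  (link_pi_range : forall x : R, 0 < link_pi G x < 1)
  (link_g_derivable : forall x : R, derivable (link_g G) x 1)
  (sd_measurable : forall theta k, measurable_fun setT (fun ww => sd_h G theta ww k)).

Let derivable_measurable (phi : R -> R) : (forall x : R, derivable phi x 1) ->
  measurable_fun setT phi.
Proof.
move=> dphi; apply: continuous_measurable_fun => x.
exact/differentiable_continuous/derivable1_diffP.
Qed.

Let mphi : measurable_fun setT (varphi G).
Proof.
case: varphi_monotone => H.
  by apply: nondecreasing_measurable => // x y xy; exact: H.
by apply: nonincreasing_measurable => // x y xy; exact: H.
Qed.

Section Functions.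
Context {d0 : measure_display} {S : measurableType d0}.
Variables (o o' : S -> E).
Hypotheses (mo : measurable_fun setT o) (mo' : measurable_fun setT o').

Lemma measurable_cov (x : S -> E) : measurable_fun setT x ->
  measurable_fun setT (fun a => cov (x a)).
Proof.
move=> mx; apply: measurableT_comp measurable_snd _.
exact: measurableT_comp measurable_fst mx.
Qed.

Lemma measurable_trtR (x : S -> E) : measurable_fun setT x ->
  measurable_fun setT (fun a => trtR (x a)).
Proof.
move=> mx.
have mb : measurable_fun setT (fun b : bool => b%:R : R) by move=> _ Y _.
apply: measurableT_comp mb _; apply: measurableT_comp measurable_fst _.
exact: measurableT_comp measurable_fst mx.
Qed.

Lemma measurable_contrast (x y : S -> E) t : measurable_fun setT x -> measurable_fun setT y ->
  measurable_fun setT (fun a => contrast G (x a) (y a) t).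
Proof.
move=> mx my; apply: measurableT_comp mphi _; apply: measurable_funB.
  apply: measurableT_comp (measurable_tnth t) _; apply: measurableT_comp measurable_fst _.
  exact: measurableT_comp measurable_snd mx.
apply: measurableT_comp (measurable_tnth t) _; apply: measurableT_comp measurable_snd _.
exact: measurableT_comp measurable_snd my.
Qed.

Let measurable_mulmx_cst q (A : S -> 'rV[R]_q) (b : 'cV[R]_q) :
  (forall j, measurable_fun setT (fun a => A a 0 j)) ->
  measurable_fun setT (fun a => (A a *m b) 0 0).
Proof.
move=> mA; under [fun a => _]eq_fun do rewrite mxE.
by apply: measurable_sum => j; apply: measurable_funM.
Qed.

Lemma measurable_cov_mx (x : S -> covariates R T p) t k : measurable_fun setT x ->
  measurable_fun setT (fun a => cov_mx (x a) t k).
Proof.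
move=> mx; under [fun a => _]eq_fun do rewrite mxE.
apply: measurableT_comp (measurable_tnth k) _.
exact: measurableT_comp (measurable_tnth t) mx.
Qed.

Lemma measurable_prop_model theta (x : S -> covariates R T p) : measurable_fun setT x ->
  measurable_fun setT (fun a => prop_model G theta (x a)).
Proof.
move=> mx; apply: measurableT_comp (derivable_measurable link_pi_derivable) _.
apply: measurable_mulmx_cst => j.
under [fun a => _]eq_fun do rewrite mxE.
case: (fintype.split j) => j'; first exact: measurable_cst.
case/mxvec_indexP: j' => t k; under [fun a => _]eq_fun do rewrite mxvecE.
exact: measurable_cov_mx.
Qed.

Lemma measurable_outcome_model theta (x y : S -> covariates R T p) t :
  measurable_fun setT x -> measurable_fun setT y ->
  measurable_fun setT (fun a => outcome_model G theta (x a) (y a) t).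
Proof.
move=> mx my; apply: measurableT_comp (derivable_measurable link_g_derivable) _.
apply: measurable_mulmx_cst => j.
under [fun a => _]eq_fun do rewrite mxE.
case: (fintype.split j) => j'; first exact: measurable_cst.
under [fun a => _]eq_fun do rewrite mxE; case: (fintype.split j') => k;
  under [fun a => _]eq_fun do rewrite mxE; exact: measurable_cov_mx.
Qed.

Lemma measurable_h_fun theta (x y : S -> E) k :
  measurable_fun setT x -> measurable_fun setT y ->
  measurable_fun setT (fun a => h_fun G theta (x a) (y a) k 0).
Proof.
move=> mx my.
have mzx := measurable_trtR mx; have mzy := measurable_trtR my.
have mqx := measurable_prop_model theta (measurable_cov mx).
have mqy := measurable_prop_model theta (measurable_cov my).
under [fun a => _]eq_fun do rewrite mxE.
case: (fintype.split k) => i; under [fun a => _]eq_fun do rewrite mxE.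
  have mg := measurable_outcome_model theta i (measurable_cov mx) (measurable_cov my).
  have mg' := measurable_outcome_model theta i (measurable_cov my) (measurable_cov mx).
  have mc := measurable_contrast i mx my.
  have mc' := measurable_contrast i my mx.
  apply: measurable_funD; last by apply: measurable_funM => //; exact: measurable_funD.
  by apply: measurable_funD; apply: measurable_funM;
    [apply: measurable_funM; [apply: measurable_funM => //; exact: measurable_funB|
       apply: measurable_inv; apply: measurable_funM;
         [exact: measurable_funM|exact: measurable_funB]]|exact: measurable_funB
    |apply: measurable_funM; [apply: measurable_funM => //; exact: measurable_funB|
       apply: measurable_inv; apply: measurable_funM;
         [exact: measurable_funM|exact: measurable_funB]]|exact: measurable_funB].
case: (fintype.split i) => j; under [fun a => _]eq_fun do rewrite mxE.
  exact: measurable_funD.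
have mc := measurable_contrast j mx my; have mc' := measurable_contrast j my mx.
by apply: measurable_funD; apply: measurable_funM => //; apply: measurable_funM => //;
  exact: measurable_funB.
Qed.

Lemma measurable_f_fun theta (x y : S -> covariates R T p) k :
  measurable_fun setT x -> measurable_fun setT y ->
  measurable_fun setT (fun a => f_fun G theta (x a) (y a) k 0).
Proof.
move=> mx my.
have mqx := measurable_prop_model theta mx.
have mqy := measurable_prop_model theta my.
under [fun a => _]eq_fun do rewrite mxE.
case: (fintype.split k) => i; first exact: measurable_cst.
under [fun a => _]eq_fun do rewrite mxE.
case: (fintype.split i) => j; under [fun a => _]eq_fun do rewrite mxE.
  exact: measurable_funD.
have mg := measurable_outcome_model theta j mx my.
have mg' := measurable_outcome_model theta j my mx.
by apply: measurable_funD; apply: measurable_funM => //; apply: measurable_funM => //;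
  exact: measurable_funB.
Qed.

End Functions.

Let derivable_prop w theta v : derivable (fun x => prop_model G x w) theta v.
Proof.
apply: (derivable_affine (l := fun x =>
  (row_mx (1%:M : 'M[R]_1) (mxvec (cov_mx w)) *m (beta_of x)^T) 0 0)) => // h.
by rewrite /beta_of !linearP/= mxE [in LHS]mxE.
Qed.

Let derivable_outcome w w' t theta v : derivable (fun x => outcome_model G x w w' t) theta v.
Proof.
apply: (derivable_affine (l := fun x =>
  (row_mx (1%:M : 'M[R]_1) (row_mx (row t (cov_mx w)) (row t (cov_mx w')))
             *m (row t (gamma_of x))^T) 0 0)) => // h.
by rewrite /gamma_of !linearP/= mxE [in LHS]mxE.
Qed.

(** Existence of the partial derivatives lets the entries of [jac] be written as limits of
    difference quotients, hence as measurable functions of the data. *)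
Lemma derivable_f_fun w w' k theta v : derivable (fun x => f_fun G x w w' k 0) theta v.
Proof.
rewrite (_ : (fun x => _) = fun x => match fintype.split k with
  | inl i => delta_of x 0 i
  | inr i => match fintype.split i with
    | inl _ => prop_model G x w + prop_model G x w'
    | inr j => prop_model G x w * (1 - prop_model G x w') * outcome_model G x w w' j
             + prop_model G x w' * (1 - prop_model G x w) * outcome_model G x w' w j
    end end); last first.
  apply/funext => x; rewrite mxE; case: (fintype.split k) => i; rewrite mxE//.
  by case: (fintype.split i) => j; rewrite mxE.
case: (fintype.split k) => [i|i].
  have lin h : delta_of (h *: v + theta) 0 i = h * delta_of v 0 i + delta_of theta 0 i.
    by rewrite /delta_of linearP/= mxE [in LHS]mxE.
  exact: (derivable_affine (phi := id) lin (fun r => @derivable_id _ _ r 1)).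
case: (fintype.split i) => [_|j]; first exact: derivable_add.
have cst (c : R) : derivable (fun=> c : R) theta v by exact: derivable_cst.
by apply: derivable_add; apply: derivable_mul => //; apply: derivable_mul => //;
  exact: derivable_sub.
Qed.

Let prop_neq0 w theta : prop_model G theta w != 0.
Proof.
by rewrite /prop_model; set c := (_ *m _) 0 0; have /andP[H _] := link_pi_range c; rewrite gt_eqF.
Qed.

Let prop_neq1 w theta : 1 - prop_model G theta w != 0.
Proof.
rewrite /prop_model; set c := (_ *m _) 0 0; have /andP[_ H] := link_pi_range c.
by rewrite subr_eq0 gt_eqF.
Qed.

Let derivable_weight c w w' theta v :
  derivable (fun x => c / (2 * prop_model G x w * (1 - prop_model G x w'))) theta v.
Proof.
have cst (c' : R) : derivable (fun=> c' : R) theta v by exact: derivable_cst.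
apply: (derivable_mul (cst c)); apply: derivableV.
  by rewrite !mulf_neq0// pnatr_eq0.
apply: derivable_mul; first exact: (derivable_mul (cst 2)).
exact: (derivable_sub (cst 1)).
Qed.

(** The propensity link stays strictly between 0 and 1, so no denominator vanishes; the contrasts
    are constant in theta. *)
Lemma derivable_h_fun o o' k theta v : derivable (fun x => h_fun G x o o' k 0) theta v.
Proof.
pose z := trtR o; pose z' := trtR o'.
pose q x := prop_model G x (cov o); pose q' x := prop_model G x (cov o').
pose g x i := outcome_model G x (cov o) (cov o') i.
pose g' x i := outcome_model G x (cov o') (cov o) i.
rewrite (_ : (fun x => _) = fun x => match fintype.split k with
  | inl i => z * (1 - z') / (2 * q x * (1 - q' x)) * (contrast G o o' i - g x i)
           + z' * (1 - z) / (2 * q' x * (1 - q x)) * (contrast G o' o i - g' x i)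
           + (g x i + g' x i) / 2
  | inr i => match fintype.split i with
    | inl _ => z + z'
    | inr j => z * (1 - z') * contrast G o o' j + z' * (1 - z) * contrast G o' o j
    end end); last first.
  apply/funext => x; rewrite mxE; case: (fintype.split k) => i; rewrite mxE//.
  by case: (fintype.split i) => j; rewrite mxE.
case: (fintype.split k) => [i|i]; last first.
  by case: (fintype.split i) => *; exact: derivable_cst.
have dg : derivable (fun x => g x i) theta v by exact: derivable_outcome.
have dg' : derivable (fun x => g' x i) theta v by exact: derivable_outcome.
have cst (c : R) : derivable (fun=> c : R) theta v by exact: derivable_cst.
apply: derivable_add; last exact: derivable_mul (derivable_add dg dg') (cst _).
by apply: derivable_add; (apply: derivable_mul;
  [exact: derivable_weight|exact: (derivable_sub (cst _))]).
Qed.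

Section Matrices.
Context {d0 : measure_display} {S : measurableType d0}.

Lemma measurable_mulmx q1 q2 q3 (A : S -> 'M[R]_(q1, q2)) (B : S -> 'M[R]_(q2, q3)) :
  (forall i j, measurable_fun setT (fun a => A a i j)) ->
  (forall i j, measurable_fun setT (fun a => B a i j)) ->
  forall i j, measurable_fun setT (fun a => (A a *m B a) i j).
Proof.
move=> mA mB i j; under [fun a => _]eq_fun do rewrite mxE.
by apply: measurable_sum => k; exact: measurable_funM.
Qed.

Lemma measurable_det q (A : S -> 'M[R]_q) :
  (forall i j, measurable_fun setT (fun a => A a i j)) ->
  measurable_fun setT (fun a => \det (A a)).
Proof.
move=> mA; apply: measurable_sum => s; apply: measurable_funM => //.
by apply: measurable_prod => i _.
Qed.

Lemma measurable_invmx q (A : S -> 'M[R]_q) :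
  (forall i j, measurable_fun setT (fun a => A a i j)) ->
  forall i j, measurable_fun setT (fun a => invmx (A a) i j).
Proof.
move=> mA i j.
(* Cramer's rule; [invmx] returns a singular matrix unchanged, which is the first branch. *)
rewrite (_ : (fun a => _) = fun a => if \det (A a) == 0 then A a i j
    else (\det (A a))^-1 * \adj (A a) i j); last first.
  apply/funext => a; rewrite /invmx unitmxE unitfE.
  by case: eqP => //= _; rewrite mxE.
apply: measurable_fun_ifT => //.
  by apply: measurable_fun_eqr => //; exact: measurable_det.
apply: measurable_funM; first by apply: measurable_inv; exact: measurable_det.
under [fun a => _]eq_fun do rewrite mxE.
apply: measurable_funM => //; apply: measurable_det => k l.
by under [fun a => _]eq_fun do rewrite !mxE; exact: mA.
Qed.

Variables (x y : S -> E).
Hypotheses (mx : measurable_fun setT x) (my : measurable_fun setT y).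

Lemma measurable_G_mx theta i j :
  measurable_fun setT (fun a => G_mx G theta (cov (x a)) (cov (y a)) i j).
Proof.
apply: measurable_mulmx => {i j} [i j|].
  under [fun a => _]eq_fun do rewrite mxE mxE.
  apply: measurable_derive => [a|th]; first exact: derivable_f_fun.
  by apply: measurable_f_fun; exact: measurable_cov.
apply: measurable_invmx => i j.
have mA i0 j0 : measurable_fun setT (fun a =>
    diag_mx (\row_k sd_h G theta (cov (x a), cov (y a)) k) i0 j0).
  under [fun a => _]eq_fun do rewrite mxE mxE.
  case: (i0 == j0) => /=; last exact: measurable_cst.
  apply: measurableT_comp (sd_measurable theta i0) _.
  by apply: measurable_fun_pair; exact: measurable_cov.
by apply: measurable_mulmx => // i0 j0; apply: measurable_mulmx.
Qed.

Lemma measurable_u_fun theta k :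
  measurable_fun setT (fun a => u_fun G theta (x a) (y a) k 0).
Proof.
apply: measurable_mulmx => [i j|i j]; first exact: measurable_G_mx.
rewrite (ord1 j); under [fun a => _]eq_fun do rewrite mxE [X in _ + X]mxE.
apply: measurable_funB; first exact: measurable_h_fun.
by apply: measurable_f_fun; exact: measurable_cov.
Qed.

Lemma measurable_B_fun theta k l :
  measurable_fun setT (fun a => B_fun G theta (x a) (y a) k l).
Proof.
apply: measurable_mulmx => [i j|i j]; first exact: measurable_G_mx.
under [fun a => _]eq_fun do rewrite mxE.
have E0 a : (fun z => (f_fun G z (cov (x a)) (cov (y a)) - h_fun G z (x a) (y a)) i 0) =
    (fun z => f_fun G z (cov (x a)) (cov (y a)) i 0 - h_fun G z (x a) (y a) i 0).
  by apply/funext => z; rewrite mxE [X in _ + X]mxE.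
under [fun a => _]eq_fun do rewrite E0.
apply: measurable_derive => [a|th].
  by apply: derivable_sub; [exact: derivable_f_fun|exact: derivable_h_fun].
apply: measurable_funB; last exact: measurable_h_fun.
by apply: measurable_f_fun; exact: measurable_cov.
Qed.

End Matrices.
End ModelMeasurability.

(** * Anchor-partner estimators *)

Section PartnerMeans.
Context {R : realType} {n : nat}.
Variables (m : nat) (J : {set 'I_n}).
Hypotheses (m_gt0 : (0 < m)%N) (cardJ : #|J| = m).
Implicit Types (a b L : 'I_n -> R).

Let m_neq0 : m%:R != 0 :> R. Proof. by rewrite pnatr_eq0 -lt0n. Qed.

Lemma pmean_le a b : (forall j, j \in J -> a j <= b j) -> pmean m J a <= pmean m J b.
Proof. by move=> ab; apply: ler_wpM2l; [rewrite invr_ge0 ler0n|exact: ler_sum]. Qed.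

Lemma pmean_norm a : `|pmean m J a| <= pmean m J (fun j => `|a j|).
Proof.
rewrite normrM ger0_norm ?invr_ge0 ?ler0n// ler_wpM2l ?invr_ge0 ?ler0n//.
exact: ler_norm_sum.
Qed.

Lemma pmeanD a b : pmean m J (fun j => a j + b j) = pmean m J a + pmean m J b.
Proof. by rewrite /pmean big_split mulrDr. Qed.

Lemma pmeanZ c a : pmean m J (fun j => c * a j) = c * pmean m J a.
Proof. by rewrite /pmean -mulr_sumr mulrCA. Qed.

Lemma pmean_cst (c : R) : pmean m J (fun=> c) = c.
Proof. by rewrite /pmean sumr_const cardJ -[c *+ m]mulr_natl mulKf. Qed.

(** The mean of the squared deviations from [e] over [J] is nonnegative. *)
Lemma pmean_sqr a : pmean m J a ^+ 2 <= pmean m J (fun j => a j ^+ 2).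
Proof.
set e := pmean m J a.
have : 0 <= pmean m J (fun j => a j ^+ 2 + (- (2 * e) * a j + e ^+ 2)).
  apply: mulr_ge0; rewrite ?invr_ge0 ?ler0n//; apply: sumr_ge0 => j _.
  by have := sqr_ge0 (a j - e); nra.
rewrite !pmeanD pmeanZ pmean_cst -/e; nra.
Qed.

Lemma pmean_cov a b :
  pmean m J (fun j => (a j - pmean m J a) * (b j - pmean m J b)) =
  pmean m J (fun j => a j * b j) - pmean m J a * pmean m J b.
Proof.
set A := pmean m J a; set B := pmean m J b.
have -> : pmean m J (fun j => (a j - A) * (b j - B)) =
    pmean m J (fun j => a j * b j + (- B * a j + (- A * b j + A * B))).
  by congr (_ * _); apply: eq_bigr => j _ /=; ring.
by rewrite !pmeanD (pmeanZ (- B)) (pmeanZ (- A)) pmean_cst -/A -/B; ring.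
Qed.

Variable lam : R.
Hypothesis lam01 : 0 <= lam <= 1.

(* [Sigma_within] is a multiple of the partner mean of a product minus the
   product of the partner means; hence every entry of [Sigma_hat], de-biased or
   not, is an anchor average of a [qform]. *)
Definition qform a b : R :=
  (1 + lam) * (pmean m J a * pmean m J b) - lam * pmean m J (fun j => a j * b j).

(** This is where fourth moments enter. The squares of the product of means and of the mean product
    are both at most half the sum of the mean fourth powers; with (1 + lam)^2 <= 4 and lam^2 <= 1
    the constant is 2 (4 + 1)/2 = 5. *)
Lemma qform_sqr a b :
  qform a b ^+ 2 <= pmean m J (fun j => 5 * (a j ^+ 4 + b j ^+ 4)).
Proof.
have fourth (c : 'I_n -> R) : pmean m J c ^+ 2 * pmean m J c ^+ 2 <= pmean m J (fun j => c j ^+ 4).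
  have s := pmean_sqr c; have s2 := pmean_sqr (fun j => c j ^+ 2).
  have E4 : pmean m J (fun j => c j ^+ 4) = pmean m J (fun j => (c j ^+ 2) ^+ 2).
    by congr (_ * _); apply: eq_bigr => j _; rewrite -exprM.
  rewrite E4; apply: le_trans s2; rewrite -expr2.
  by rewrite ler_pXn2r ?nnegrE ?sqr_ge0// (le_trans _ s)// sqr_ge0.
have ab4 : pmean m J (fun j => a j * b j) ^+ 2 <=
    2^-1 * (pmean m J (fun j => a j ^+ 4) + pmean m J (fun j => b j ^+ 4)).
  rewrite (le_trans (pmean_sqr _))// -pmeanD -pmeanZ; apply: pmean_le => j _.
  have E4 (c : R) : c ^+ 4 = c ^+ 2 * c ^+ 2 by rewrite -exprD.
  by rewrite exprMn !E4; have := sqr_ge0 (a j ^+ 2 - b j ^+ 2); nra.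
rewrite pmeanZ pmeanD /qform.
have := fourth a; have := fourth b.
set A := pmean m J a; set B := pmean m J b; set C := pmean m J (fun j => a j * b j) in ab4 *.
set A4 := pmean m J (fun j => a j ^+ 4) in ab4 *.
set B4 := pmean m J (fun j => b j ^+ 4) in ab4 *.
move=> HB HA; case/andP: lam01 => l0 l1.
have AB : (A * B) ^+ 2 <= 2^-1 * (A4 + B4).
  by rewrite exprMn; have := sqr_ge0 (A ^+ 2 - B ^+ 2); nra.
have h1 : ((1 + lam) * (A * B) - lam * C) ^+ 2 <=
    2 * ((1 + lam) ^+ 2 * (A * B) ^+ 2) + 2 * (lam ^+ 2 * C ^+ 2).
  by rewrite -!exprMn; set x := _ * (A * B); set y := lam * C; have := sqr_ge0 (x + y); nra.
apply: (le_trans h1).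
have h2 : (1 + lam) ^+ 2 * (A * B) ^+ 2 <= 4 * (A * B) ^+ 2.
  by rewrite ler_wpM2r ?sqr_ge0//; nra.
have h3 : lam ^+ 2 * C ^+ 2 <= 1 * C ^+ 2.
  by rewrite ler_wpM2r ?sqr_ge0//; nra.
lra.
Qed.

(** A product changes by the product of the two changes plus two mixed terms. One factor [e] is kept
    and the other bounded by [rho], the mixed terms are split by xy <= (x^2 + y^2)/2, and 3 bounds
    (1 + lam) + lam. The bound is a single partner mean, so it averages over the anchors. *)
Lemma qform_lipschitz a b a' b' L e rho : 0 <= e <= rho ->
  (forall j, j \in J -> 0 <= L j /\ `|a' j - a j| <= L j * e /\ `|b' j - b j| <= L j * e) ->
  `|qform a' b' - qform a b| <=
  e * pmean m J (fun j => 3 * ((1 + rho) * L j ^+ 2 + 2^-1 * (a j ^+ 2 + b j ^+ 2))).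
Proof.
move=> /andP[e0 er] ab.
set K := fun j => (1 + rho) * L j ^+ 2 + 2^-1 * (a j ^+ 2 + b j ^+ 2).
have prodlip (A B A' B' l : R) : 0 <= l -> `|A' - A| <= l * e -> `|B' - B| <= l * e ->
    `|A' * B' - A * B| <= e * ((1 + rho) * l ^+ 2 + 2^-1 * (A ^+ 2 + B ^+ 2)).
  move=> l0 dA dB.
  have -> : A' * B' - A * B = (A' - A) * (B' - B) + (A' - A) * B + A * (B' - B) by ring.
  apply: le_trans (ler_normD _ _) _; apply: le_trans (lerD (ler_normD _ _) (lexx _)) _.
  rewrite !normrM.
  have t1 : `|A' - A| * `|B' - B| <= (l * e) * (l * e) by exact: ler_pM.
  have t2 : `|A' - A| * `|B| <= (l * e) * `|B| by exact: ler_wpM2r.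
  have t3 : `|A| * `|B' - B| <= `|A| * (l * e) by exact: ler_wpM2l.
  have t4 : e * (l * `|B|) <= e * (2^-1 * (l ^+ 2 + B ^+ 2)).
    rewrite ler_wpM2l// -(real_normK (num_real B)).
    by have := sqr_ge0 (l - `|B|); nra.
  have t5 : e * (l * `|A|) <= e * (2^-1 * (l ^+ 2 + A ^+ 2)).
    rewrite ler_wpM2l// -(real_normK (num_real A)).
    by have := sqr_ge0 (l - `|A|); nra.
  have t6 : (l * e) * (l * e) <= e * (rho * l ^+ 2).
    have -> : (l * e) * (l * e) = e * (e * l ^+ 2) by ring.
    by rewrite ler_wpM2l// ler_wpM2r// sqr_ge0.
  have -> : e * ((1 + rho) * l ^+ 2 + 2^-1 * (A ^+ 2 + B ^+ 2)) =
     e * (rho * l ^+ 2) + e * (2^-1 * (l ^+ 2 + B ^+ 2)) + e * (2^-1 * (l ^+ 2 + A ^+ 2)) by field.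
  rewrite [l * e * `|B|](_ : _ = e * (l * `|B|)) in t2; last by ring.
  rewrite [`|A| * (l * e)](_ : _ = e * (l * `|A|)) in t3; last by ring.
  lra.
have rho0 : 0 <= rho by exact: le_trans er.
have dmean (c c' : 'I_n -> R) : (forall j, j \in J -> `|c' j - c j| <= L j * e) ->
    `|pmean m J c' - pmean m J c| <= pmean m J L * e.
  move=> H; have -> : pmean m J c' - pmean m J c = pmean m J (fun j => c' j - c j).
    by rewrite /pmean sumrB mulrBr.
  apply: (le_trans (pmean_norm _)); rewrite mulrC -pmeanZ; apply: pmean_le => j jJ.
  by rewrite mulrC H.
have L0 : 0 <= pmean m J L.
  apply: mulr_ge0; rewrite ?invr_ge0 ?ler0n//; apply: sumr_ge0 => j /ab[]//.
have d1 : `|pmean m J a' * pmean m J b' - pmean m J a * pmean m J b| <= e * pmean m J K.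
  apply: (le_trans (prodlip _ _ _ _ _ L0 _ _)).
  - by apply: dmean => j /ab[_ []].
  - by apply: dmean => j /ab[_ []].
  rewrite ler_wpM2l// /K pmeanD !pmeanZ pmeanD.
  apply: lerD; apply: ler_wpM2l; rewrite ?addr_ge0 ?invr_ge0//; first exact: pmean_sqr.
  by apply: lerD; exact: pmean_sqr.
have d2 : `|pmean m J (fun j => a' j * b' j) - pmean m J (fun j => a j * b j)| <= e * pmean m J K.
  have -> : pmean m J (fun j => a' j * b' j) - pmean m J (fun j => a j * b j) =
      pmean m J (fun j => a' j * b' j - a j * b j) by rewrite /pmean sumrB mulrBr.
  apply: (le_trans (pmean_norm _)); rewrite -pmeanZ; apply: pmean_le => j /ab[lj0 [da db]].
  exact: prodlip.
case/andP: lam01 => l0 l1.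
have -> : qform a' b' - qform a b =
    (1 + lam) * (pmean m J a' * pmean m J b' - pmean m J a * pmean m J b)
    - lam * (pmean m J (fun j => a' j * b' j) - pmean m J (fun j => a j * b j)).
  by rewrite /qform; ring.
rewrite pmeanZ; apply: (le_trans (ler_normB _ _)).
rewrite !normrM (ger0_norm l0) ger0_norm ?addr_ge0//.
have K0 : 0 <= e * pmean m J K by exact: le_trans d1.
have := ler_wpM2l l0 d2; have := @ler_wpM2l _ (1 + lam) (addr_ge0 ler01 l0) _ _ d1.
have : lam * (e * pmean m J K) <= 1 * (e * pmean m J K) by rewrite ler_wpM2r.
rewrite mulrDl mul1r [(1 + lam) * (e * _)]mulrDl mul1r.
have -> : e * (3 * pmean m J K) = 3 * (e * pmean m J K) by ring.
lra.
Qed.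

End PartnerMeans.

Lemma outer_entry {R : pzRingType} q (c e : 'cV[R]_q) k l : (c *m e^T) k l = c k 0 * e l 0.
Proof. by rewrite mxE big_ord1 [_^T _ _]mxE. Qed.

Lemma subr_entry {R : zmodType} p q (A B : 'M[R]_(p, q)) k l : (A - B) k l = A k l - B k l.
Proof. by rewrite mxE [X in _ + X]mxE. Qed.

Section Entries.
Context {R : realType} {T p : nat}.
Variables (G : gee_model R T p) (n : nat) (x : 'I_n -> unit_data R T p)
  (theta : 'rV[R]_(dim_theta T p)) (s m : nat) (D : design n s).

Lemma B_hat_entry k l : B_hat G x theta m D k l =
  anchor_avg D (fun i J => pmean m J (fun j => B_fun G theta (x i) (x j) k l)).
Proof.
rewrite /B_hat mxE summxE; congr (_ * _); apply: eq_bigr => a _.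
by rewrite mxE summxE.
Qed.

Lemma u_bar_entry a k : u_bar G x theta m D a k 0 =
  pmean m (D.2 a) (fun j => u_fun G theta (x (D.1 a)) (x j) k 0).
Proof. by rewrite mxE summxE. Qed.

(** The value of lam for which an entry of [Sigma_hat] averages [qform]; the factor m/(m-1) turns
    the unbiased within-anchor covariance into a difference of partner means. *)
Definition debias_coef (alpha : R) : R :=
  alpha * (m%:R^-1 - (n%:R - 1)^-1) * (m%:R / (m%:R - 1)).

Hypotheses (m_gt0 : (0 < m)%N) (cardD : forall a, #|D.2 a| = m).

Lemma Sigma_within_entry a k l : Sigma_within G x theta m D a k l =
  (m%:R / (m%:R - 1)) *
  (pmean m (D.2 a) (fun j => u_fun G theta (x (D.1 a)) (x j) k 0 * u_fun G theta (x (D.1 a)) (x j) l 0)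
   - pmean m (D.2 a) (fun j => u_fun G theta (x (D.1 a)) (x j) k 0) *
     pmean m (D.2 a) (fun j => u_fun G theta (x (D.1 a)) (x j) l 0)).
Proof.
have m0 : m%:R != 0 :> R by rewrite pnatr_eq0 -lt0n.
pose u k j := u_fun G theta (x (D.1 a)) (x j) k 0.
have := pmean_cov m_gt0 (cardD a) (u k) (u l); rewrite /u => <-.
rewrite mxE summxE [RHS]mulrAC {1}/pmean mulrA mulfV// mul1r mulrC; congr (_ * _).
by apply: eq_bigr => j _; rewrite outer_entry !subr_entry !u_bar_entry.
Qed.

Lemma Sigma_hat_entry alpha k l : Sigma_hat G x theta m D alpha k l =
  anchor_avg D (fun i J => qform m J (debias_coef alpha)
    (fun j => u_fun G theta (x i) (x j) k 0) (fun j => u_fun G theta (x i) (x j) l 0)).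
Proof.
rewrite /Sigma_hat /anchor_avg subr_entry.
have scaleE (c : R) (A : 'M[R]_(dim_theta T p)) : (c *: A) k l = c * A k l by rewrite mxE.
rewrite !scaleE !summxE mulrCA -mulrBr; congr (_ * _).
rewrite mulr_sumr -sumrB; apply: eq_bigr => a _.
rewrite Sigma_within_entry outer_entry !u_bar_entry /qform /debias_coef.
set A := pmean _ _ _; set B := pmean _ _ _; set C := pmean _ _ _.
ring.
Qed.

End Entries.

(** * The de-biasing coefficient *)

Section DebiasCoefficient.
Context {R : realType}.
Variables (n m : nat).
Hypotheses (m_gt0 : (0 < m)%N) (m_lt : (m < n)%N).

Let n1_gt0 : 0 < n%:R - 1 :> R.
Proof. by rewrite subr_gt0 ltr1n (leq_ltn_trans m_gt0). Qed.

Let m_le : m%:R <= n%:R - 1 :> R.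
Proof. by rewrite lerBrDr -(natrD _ m 1) ler_nat addn1. Qed.

(** With lam = [debias_coef], the mean of [qform] gives Q, the average over equal partners, the
    weight (1 + lam)/m - lam, which is this coefficient. *)
Definition bias_coef (alpha : R) : R :=
  m%:R^-1 - debias_coef n m alpha * (1 - m%:R^-1).

Lemma debias_coef0 : debias_coef n m (0 : R) = 0.
Proof. by rewrite /debias_coef !mul0r. Qed.

Lemma bias_coef0 : bias_coef 0 = m%:R^-1.
Proof. by rewrite /bias_coef debias_coef0 mul0r subr0. Qed.

(** For m > 1 the coefficient is (1 - m/(n-1))/(m-1), where m <= n - 1 and m - 1 >= 1. *)
Lemma debias_coef1_itv : 0 <= debias_coef n m (1 : R) <= 1.
Proof.
have m0 : 0 < m%:R :> R by rewrite ltr0n.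
have le_inv : (n%:R - 1)^-1 <= m%:R^-1 :> R by rewrite lef_pV2// posrE.
have inv0 : 0 < (n%:R - 1)^-1 :> R by rewrite invr_gt0.
rewrite /debias_coef mul1r; case: (ltngtP m 1%N) => [|m1|->].
- by rewrite ltnNge m_gt0.
- have m1R : 0 < m%:R - 1 :> R by rewrite subr_gt0 ltr1n.
  have m2R : 1 <= m%:R - 1 :> R by rewrite lerBrDr -(natrD _ 1 1) ler_nat.
  apply/andP; split; first by rewrite mulr_ge0 ?subr_ge0// divr_ge0// ltW.
  rewrite mulrA ler_pdivrMr// mul1r; apply: le_trans m2R.
  by rewrite mulrBl mulVf ?gt_eqF// lerBlDr lerDl mulr_ge0// ltW.
(* For m = 1 the inverse of 0 is 0, so the correction disappears. *)
- by rewrite subrr invr0 mulr0 mulr0 lexx ler01.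
Qed.

(** Full de-biasing makes lam (1 - 1/m) equal to 1/m - 1/(n-1), leaving the bias of an estimator
    that uses all partners. With a single partner there is no within-anchor variation to correct
    with. *)
Lemma bias_coef1 : (1 < m)%N -> bias_coef 1 = (n%:R - 1)^-1.
Proof.
move=> m1.
have m0 : m%:R != 0 :> R by rewrite pnatr_eq0 -lt0n.
have m1R : m%:R - 1 != 0 :> R by rewrite gt_eqF// subr_gt0 ltr1n.
by rewrite /bias_coef /debias_coef; field; rewrite m0 m1R gt_eqF.
Qed.

End DebiasCoefficient.

Section AlmostSureEvents.
Context {d : measure_display} {Omega : measurableType d} {R : realType}.
Variable P : probability Omega R.

Lemma prob1_setI (A B : set Omega) : measurable A -> measurable B ->
  P A = 1%E -> P B = 1%E -> P (A `&` B) = 1%E.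
Proof.
move=> mA mB PA PB; apply/eqP; rewrite eq_le probability_le1 ?andbT; last exact: measurableI.
have := @prob_setI_ge _ _ _ P A B 0 0 mA mB.
by rewrite addr0 subr0 PA PB; apply.
Qed.

Lemma prob1_big (I : Type) (l : seq I) (A : I -> set Omega) :
  (forall i, measurable (A i)) -> (forall i, P (A i) = 1%E) ->
  P (\big[setI/setT]_(i <- l) A i) = 1%E /\ measurable (\big[setI/setT]_(i <- l) A i).
Proof.
move=> mA PA; elim: l => [|i l [PI mI]].
  by rewrite !big_nil; split => //; exact: probability_setT.
by rewrite !big_cons; split; [exact: prob1_setI|exact: measurableI].
Qed.

End AlmostSureEvents.

Lemma rsqrt_cvg0 (R : realType) (k : nat -> nat) :
  k @ \oo --> \oo -> (fun r => rsqrt (k r) : R) @ \oo --> (0 : R).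
Proof.
move=> kinf; apply/cvgrPdist_lt => e e0.
near=> r; rewrite sub0r normrN ger0_norm; last by rewrite invr_ge0 sqrtr_ge0.
have ke : (Num.truncn (e^-1 ^+ 2) < k r)%N by near: r; move/cvgnyPgt : kinf; apply.
have kR : e^-1 ^+ 2 < (k r)%:R.
  by apply: lt_le_trans (truncnS_gt _) _; rewrite ler_nat.
have sk : e^-1 < Num.sqrt (k r)%:R.
  rewrite -(ger0_norm (ltW (_ : 0 < e^-1))) ?invr_gt0// -sqrtr_sqr ltr_sqrt//.
  by apply: le_lt_trans kR; exact: sqr_ge0.
by rewrite /rsqrt invf_plt// posrE// (lt_trans _ sk)// invr_gt0.
Unshelve. all: by end_near. Qed.

Section PopulationQform.
Context {R : realType} {n : nat}.
Variable m : nat.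
Hypotheses (n_gt2 : (2 < n)%N) (m_gt0 : (0 < m)%N) (m_lt : (m < n)%N).

Lemma pop_avg_lin (f g : 'I_n -> {set 'I_n} -> R) a b :
  pop_avg m (fun i J => a * f i J - b * g i J) = a * pop_avg m f - b * pop_avg m g.
Proof.
rewrite /pop_avg mulrCA [b * _]mulrCA -mulrBr; congr (_ * _).
rewrite !mulr_sumr -sumrB; apply: eq_bigr => i _.
rewrite /partner_avg mulrCA [b * _]mulrCA -mulrBr; congr (_ * _).
by rewrite !mulr_sumr -sumrB.
Qed.

Lemma pop_avg_qform alpha (a b : 'I_n -> 'I_n -> R) :
  let Q := ustat3 (fun i j _ => a i j * b i j) in
  let W := ustat3 (fun i j k => a i j * b i k) in
  pop_avg m (fun i J => qform m J (debias_coef n m alpha) (a i) (b i)) =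
  W + bias_coef n m alpha * (Q - W).
Proof.
move=> Q W; rewrite /qform pop_avg_lin (pop_avg_pmeanM n_gt2 m_gt0 m_lt).
rewrite (pop_avg_pmean n_gt2 m_gt0 m_lt (fun i j => a i j * b i j)).
rewrite -/Q -/W /bias_coef; ring.
Qed.

End PopulationQform.

(** In use, [a] and [c] are anchor averages at the estimate and at the true parameter, [e] is the
    population average and [b] its centring value. Removing the fluctuation c - e leaves an
    estimation error and a U-statistic error. *)
Lemma norm_four (R : realType) (a b c e : R) : `|a - b - (c - e)| <= `|a - c| + `|e - b|.
Proof. by rewrite (_ : a - b - (c - e) = (a - c) + (e - b)) ?ler_normD//; ring. Qed.

Lemma anchor_avg_lip (R : realType) n s (D : design n s) (f g h : 'I_n -> {set 'I_n} -> R) e :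
  (forall a, `|f (D.1 a) (D.2 a) - g (D.1 a) (D.2 a)| <= e * h (D.1 a) (D.2 a)) ->
  `|anchor_avg D f - anchor_avg D g| <= e * anchor_avg D h.
Proof.
move=> H; rewrite /anchor_avg -mulrBr -sumrB normrM ger0_norm ?invr_ge0 ?ler0n//.
rewrite mulrCA ler_wpM2l ?invr_ge0 ?ler0n// mulr_sumr.
by apply: le_trans (ler_norm_sum _ _ _) _; apply: ler_sum => a _; exact: H.
Qed.

(** * Stochastic orders of the estimators *)

Section Asymptotics.
Context {d : measure_display} {Omega : measurableType d} {R : realType} {T p : nat}.
Notation E := (unit_data R T p).
Variables (P : probability Omega R) (O : nat -> Omega -> E).
Hypothesis O_iid : iid P O.
Variables (G : gee_model R T p) (theta0 : 'rV[R]_(dim_theta T p)).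

Definition ku k (oo : E * E) : R := u_fun G theta0 oo.1 oo.2 k 0.
Definition kB k l (oo : E * E) : R := B_fun G theta0 oo.1 oo.2 k l.

Hypotheses (meas_u : forall k, measurable_fun setT (ku k))
  (meas_B : forall k l, measurable_fun setT (kB k l))
  (u4 : forall k, rintegrable P (fun o => ku k (O 0%N o, O 1%N o) ^+ 4))
  (B2 : forall k l, rintegrable P (fun o => kB k l (O 0%N o, O 1%N o) ^+ 2)).

Variables (rho : R) (N : set (E * E)) (L : E * E -> R).
Hypotheses (rho_gt0 : 0 < rho) (mN : measurable N)
  (PN : P [set o | N (O 0%N o, O 1%N o)] = 1%E)
  (mL : measurable_fun setT L)
  (L2 : rintegrable P (fun o => L (O 0%N o, O 1%N o) ^+ 2))
  (lip : forall o o' theta, N (o, o') -> `|theta - theta0| <= rho ->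
     `|u_fun G theta o o' - u_fun G theta0 o o'| <= L (o, o') * `|theta - theta0| /\
     `|B_fun G theta o o' - B_fun G theta0 o o'| <= L (o, o') * `|theta - theta0|).

Variables (eta : E -> 'cV[R]_(dim_theta T p)).
Hypotheses
  (u_centered : forall k, rexp P (fun o => ku k (O 0%N o, O 1%N o)) = 0)
  (etaP : forall k, cond_exp P (O 0%N) (fun o => ku k (O 0%N o, O 1%N o))
     (fun o => eta o k 0)).

Variables (n s m : nat -> nat) (D : forall r, Omega -> design (n r) (s r))
  (w : forall r, design (n r) (s r) -> R).
Arguments w : clear implicits.
Hypothesis scheme : sampling_scheme P O m D w.
Hypotheses (n_infty : n @ \oo --> \oo) (s_gt0 : forall r, (0 < s r)%N)
  (m_range : forall r, (0 < m r < n r)%N).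
Variable theta_hat : forall r : nat, Omega -> 'rV[R]_(dim_theta T p).
Hypothesis cons : sbd P (fun r o => `|theta_hat r o - theta0|) (fun r => rsqrt (n r)).

Let x r o (i : 'I_(n r)) := O i o.

Let m_gt0 r : (0 < m r)%N. Proof. by case/andP: (m_range r). Qed.
Let m_lt r : (m r < n r)%N. Proof. by case/andP: (m_range r). Qed.

(** On this event the partner sets have the right size and avoid their anchors, and the Lipschitz
    bound holds for every pair that the design uses. *)
Definition good r : set Omega := [set o | [/\ w r (D r o) != 0,
  (forall i j : 'I_(n r), i != j -> N (O i o, O j o)) & `|theta_hat r o - theta0| <= rho]].

(** The ball is reached by consistency. Every pair of distinct units has the law of the first pair,
    so it lies in [N] almost surely, and there are finitely many pairs. Each of the finitely many
    designs of weight 0 has probability 0. *)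
Lemma wp_good : wp_to_one P good.
Proof.
have Hrho : wp_to_one P (fun r => [set o | `|theta_hat r o - theta0| <= rho]).
  apply: sbd_wp rho_gt0 (rsqrt_cvg0 n_infty) _ cons => r.
  by rewrite invr_ge0 sqrtr_ge0.
have HN : wp_to_one P (fun r => [set o | forall i j : 'I_(n r), i != j -> N (O i o, O j o)]).
  move=> e e0; near=> r.
  pose A (ij : 'I_(n r) * 'I_(n r)) := if ij.1 != ij.2 then
    [set o | N (O ij.1 o, O ij.2 o)] else setT.
  have mA ij : measurable (A ij).
    rewrite /A; case: ifP => // _.
    apply: (measurable_preimage (Y := fun o => (O ij.1 o, O ij.2 o))) => //.
    by apply: measurable_fun_pair; exact: (iid_measurable O_iid).
  have PA ij : P (A ij) = 1%E.
    rewrite /A; case: ifP => [ne|_]; last exact: probability_setT.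
    have mI : measurable_fun setT (\1_N : E * E -> R) by exact: measurable_indic.
    have := rexp_pair O_iid (K := \1_N) (i := ij.1) (j := ij.2) mI ne.
    have indE i j : rexp P (fun o => \1_N (O i o, O j o) : R) =
        fine (P [set o | N (O i o, O j o)]).
      have mS : measurable [set o | N (O i o, O j o)].
        apply: (measurable_preimage (Y := fun o => (O i o, O j o))) => //.
        by apply: measurable_fun_pair; exact: (iid_measurable O_iid).
      by have := integral_indic P measurableT mS; rewrite setIT => <-.
    rewrite !indE PN /= => H; rewrite -H fineK// fin_num_measure//.
    apply: (measurable_preimage (Y := fun o => (O ij.1 o, O ij.2 o))) => //.
    by apply: measurable_fun_pair; exact: (iid_measurable O_iid).
  have [PI mI] := prob1_big (index_enum _) mA PA.
  exists (\big[setI/setT]_(ij <- index_enum ('I_(n r) * 'I_(n r))%type) A ij); split => //.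
    by rewrite PI lee_fin; lra.
  move=> o; rewrite -bigcap_seq => H i j ij.
  by have := H (i, j); rewrite /A /= ij; apply; rewrite /= mem_index_enum.
have HD : wp_to_one P (fun r => [set o | w r (D r o) != 0]).
  case: scheme => rD _ _ e e0; near=> r; case: (rD r) => mD indD w0 _.
  pose A D0 : set Omega := if w r D0 == 0 then ~` (D r @^-1` [set D0]) else setT.
  have mA D0 : measurable (A D0) by rewrite /A; case: ifP => // _; exact: measurableC.
  have PA D0 : P (A D0) = 1%E.
    rewrite /A; case: ifP => [/eqP wD|_]; last exact: probability_setT.
    rewrite probability_setC//.
    have := indD D0 setT measurableT; rewrite preimage_setT setTI wD mule0 => ->.
    by rewrite sube0.
  have [PI mI] := prob1_big (index_enum _) mA PA.
  exists (\big[setI/setT]_(D0 <- index_enum (design (n r) (s r))) A D0); split => //.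
    by rewrite PI lee_fin; lra.
  move=> o; rewrite -bigcap_seq => H /=; apply/negP => wD.
  by have := H (D r o); rewrite /A wD; apply; rewrite /= ?mem_index_enum.
apply: wp_to_oneS (wp_to_oneI (wp_to_oneI HD HN) Hrho).
by near=> r => o [[? ?] ?].
Unshelve. all: by end_near. Qed.

Let y r o := sample O (n r) o.

Let mO i : measurable_fun setT (O i). Proof. exact: (iid_measurable O_iid). Qed.

Let mpair i j : measurable_fun setT (fun o => (O i o, O j o)).
Proof. exact: measurable_fun_pair. Qed.

Let arrE (K : E * E -> R) r o : arr K (y r o) = fun i j : 'I_(n r) => K (O i o, O j o).
Proof. by apply/funext => i; apply/funext => j; rewrite arr_sample. Qed.

Let n_gt2 : \forall r \near \oo, (2 < n r)%N.
Proof. by move/cvgnyPgt : n_infty; apply. Qed.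

Let err r o := `|theta_hat r o - theta0|.

Lemma good_partners r o a : good r o -> (D r o).2 a \in partners (m r) ((D r o).1 a).
Proof. by case: scheme => _ supp _ [wD _ _]; exact: supp. Qed.

Lemma good_card r o a : good r o -> #|(D r o).2 a| = m r.
Proof. by move=> /(good_partners a); rewrite inE => /andP[/eqP]. Qed.

Lemma good_lip r o a j : good r o -> j \in (D r o).2 a ->
  let i := (D r o).1 a in
  (forall k, `|u_fun G (theta_hat r o) (O i o) (O j o) k 0 - ku k (O i o, O j o)|
     <= `|L (O i o, O j o)| * err r o) /\
  (forall k l, `|B_fun G (theta_hat r o) (O i o) (O j o) k l - kB k l (O i o, O j o)|
     <= `|L (O i o, O j o)| * err r o).
Proof.
move=> go jD i.
have ij : i != j.
  by apply: contraNneq (partners_neq (good_partners a go) jD) => <-.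
have [_ HN Hr] := go; have [Hu HB] := lip (HN _ _ ij) Hr.
(* [L] carries no sign condition, so later bounds use its absolute value. *)
have le_abs : L (O i o, O j o) * err r o <= `|L (O i o, O j o)| * err r o.
  by rewrite ler_wpM2r ?ler_norm// /err.
split=> [k|k l]; rewrite /ku /kB /= -subr_entry; apply: le_trans (mx_entry_le _ _ _) _.
- exact: le_trans Hu le_abs.
- exact: le_trans HB le_abs.
Qed.

Definition B_fluct k l r o : R :=
  anchor_avg (D r o) (fun i J => pmean (m r) J (arr (kB k l) (y r o) i)) -
  pop_avg (m r) (fun i J => pmean (m r) J (arr (kB k l) (y r o) i)).

Lemma sbd_B_fluct k l : sbd P (fun r o => `|B_fluct k l r o|) (fun r => rsqrt (s r)).
Proof.
apply: (sbd_anchor_fluct O_iid scheme s_gt0 m_range (K := fun oo => kB k l oo ^+ 2) _ _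
  (f := fun r y i J => pmean (m r) J (arr (kB k l) y i))).
- exact: measurable_funX.
- exact: B2.
- by move=> r i J; exact: measurable_pmean.
- move=> r z i J; rewrite inE => /andP[/eqP cJ _].
  exact: pmean_sqr.
Qed.

Lemma sbd_err (K : E * E -> R) : measurable_fun setT K -> (forall oo, 0 <= K oo) ->
  rintegrable P (fun o => K (O 0%N o, O 1%N o)) ->
  sbd P (fun r o => err r o * anchor_avg (D r o) (fun i J => pmean (m r) J (arr K (y r o) i)))
    (fun r => rsqrt (n r)).
Proof.
move=> mK K0 Ki.
apply: (@sbd_rate _ _ _ P 1 _ (fun r => rsqrt (n r) * 1)).
  by near=> r; rewrite mulr1 mul1r lexx invr_ge0 sqrtr_ge0.
apply: sbdM => //.
- by move=> r o; exact: normr_ge0.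
- move=> r o; apply: mulr_ge0; first by rewrite invr_ge0 ler0n.
  by apply: sumr_ge0 => a _; exact: pmean_ge0.
- exact: (sbd_anchor_avg O_iid scheme s_gt0 m_range mK K0 Ki).
Unshelve. all: by end_near. Qed.

Let B_i k l : rexp P (fun o => kB k l (O 0%N o, O 1%N o)) = B_pop P G O theta0 k l.
Proof. by rewrite mxE /kB expectation.unlock. Qed.

Lemma sbd_B_rest k l : sbd P (fun r o =>
    `|B_hat G (@x r o) (theta_hat r o) (m r) (D r o) k l - B_pop P G O theta0 k l -
      B_fluct k l r o|) (fun r => rsqrt (n r)).
Proof.
have L1 : rintegrable P (fun o => `|L (O 0%N o, O 1%N o)|).
  apply: (@rintegrable_le _ _ _ _ _ (fun o => 1 + L (O 0%N o, O 1%N o) ^+ 2)).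
  - by apply: measurableT_comp => //; exact: measurableT_comp.
  - by move=> o; rewrite normr_id ler_norml; apply/andP; split; nra.
  - by apply: rintegrableD => //; exact: rintegrable_cst.
have mLabs : measurable_fun setT (fun oo => `|L oo|) by exact: measurableT_comp.
have S1 := sbd_err mLabs (fun=> normr_ge0 _) L1.
have S2 := sbd_ustat O_iid n_infty
  (g := fun t => kB k l (t.1, t.2.1)) (measurableT_comp (meas_B k l) _) (B2 k l).
apply: sbd_le_wp wp_good _ (sbdD S1 (S2 _)); last first.
  by apply: measurable_fun_pair => //; exact: measurableT_comp.
near=> r => o go.
have n2 : (2 < n r)%N by near: r.
rewrite B_hat_entry /B_fluct arrE (pop_avg_pmean n2 (m_gt0 r) (m_lt r)).
apply: le_trans (norm_four _ _ _ _) _; rewrite -B_i; apply: lerD; last by [].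
rewrite arrE; apply: anchor_avg_lip => a.
rewrite /pmean -mulrBr -sumrB normrM ger0_norm ?invr_ge0 ?ler0n// mulrCA.
rewrite ler_wpM2l ?invr_ge0 ?ler0n// mulr_sumr.
apply: le_trans (ler_norm_sum _ _ _) _; apply: ler_sum => j jD.
by rewrite mulrC; exact: (good_lip go jD).2.
Unshelve. all: by end_near. Qed.

Let Bh r o := B_hat G (@x r o) (theta_hat r o) (m r) (D r o).

Lemma B_hat_decomp : exists2 X : nat -> Omega -> 'M[R]_(dim_theta T p),
  sbd P (fun r o => `|X r o|) (fun r => rsqrt (s r)) &
  sbd P (fun r o => `|Bh r o - B_pop P G O theta0 - X r o|) (fun r => rsqrt (n r)).
Proof.
exists (fun r o => \matrix_(k, l) B_fluct k l r o); apply: sbd_mx => k l.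
  by apply: sbd_le (sbd_B_fluct k l); apply: nearW => r o; rewrite mxE.
apply: sbd_le (sbd_B_rest k l); apply: nearW => r o.
by rewrite !subr_entry [X in _ - X]mxE.
Qed.

Let le1sqr (a : R) : `|a| <= 1 + a ^+ 2.
Proof. by rewrite ler_norml; apply/andP; split; nra. Qed.

Let prod_sqr_le (a b : R) : `|(a * b) ^+ 2| <= 2^-1 * (a ^+ 4 + b ^+ 4).
Proof.
have -> : a ^+ 4 = (a ^+ 2) ^+ 2 by rewrite -exprM.
have -> : b ^+ 4 = (b ^+ 2) ^+ 2 by rewrite -exprM.
rewrite ger0_norm ?sqr_ge0// exprMn.
by have := sqr_ge0 (a ^+ 2 - b ^+ 2); nra.
Qed.

Let mku k i j : measurable_fun setT (fun o => ku k (O i o, O j o)).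
Proof. exact: measurableT_comp. Qed.

Let u4' k i j : i != j -> rintegrable P (fun o => ku k (O i o, O j o) ^+ 4).
Proof.
move=> ij; apply: (rintegrable_pair O_iid (K := fun oo => ku k oo ^+ 4)) => //.
exact: measurable_funX.
Qed.

Let prod4 k l i j j' : i != j -> i != j' ->
  rintegrable P (fun o => (ku k (O i o, O j o) * ku l (O i o, O j' o)) ^+ 2).
Proof.
move=> ij ij'; apply: (@rintegrable_le _ _ _ _ _
  (fun o => 2^-1 * (ku k (O i o, O j o) ^+ 4 + ku l (O i o, O j' o) ^+ 4))).
- by apply: measurable_funX; exact: measurable_funM.
- by move=> o; exact: prod_sqr_le.
- by apply: rintegrableZ; apply: rintegrableD; exact: u4'.
Qed.

Let prod_i k l i j j' : i != j -> i != j' ->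
  rintegrable P (fun o => ku k (O i o, O j o) * ku l (O i o, O j' o)).
Proof.
move=> ij ij'; apply: (@rintegrable_le _ _ _ _ _
  (fun o => 1 + (ku k (O i o, O j o) * ku l (O i o, O j' o)) ^+ 2)).
- exact: measurable_funM.
- by move=> o; exact: le1sqr.
- by apply: rintegrableD; [exact: rintegrable_cst|exact: prod4].
Qed.

Let u2 k : rintegrable P (fun o => ku k (O 0%N o, O 1%N o) ^+ 2).
Proof. exact: (@prod_i k k 0%N 1%N 1%N). Qed.

Let u1 k : rintegrable P (fun o => ku k (O 0%N o, O 1%N o)).
Proof.
apply: (@rintegrable_le _ _ _ _ _ (fun o => 1 + ku k (O 0%N o, O 1%N o) ^+ 2)) => //.
by apply: rintegrableD => //; exact: rintegrable_cst.
Qed.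

Lemma Sigma_popE k l : Sigma_pop P O eta k l =
  rexp P (fun o => ku k (O 0%N o, O 1%N o) * ku l (O 0%N o, O 2%N o)).
Proof.
rewrite mxE; apply: (covariance_cmean O_iid (a := fun o => eta o k 0)
  (b := fun o => eta o l 0) (meas_u k) (meas_u l) (u1 k) (u1 l)) => //.
exact: (@prod_i k l 0%N 1%N 2%N).
Qed.

(** The limit of the average of u_ij u_ij^T; its difference from Sigma is the direction of the
    bias. *)
Definition uu_pop : 'M[R]_(dim_theta T p) :=
  \matrix_(k, l) rexp P (fun o => ku k (O 0%N o, O 1%N o) * ku l (O 0%N o, O 1%N o)).

Section Debiasing.
Variable alpha : R.
Let lam r : R := debias_coef (n r) (m r) alpha.
Hypothesis lam01 : forall r, 0 <= lam r <= 1.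

Definition Sigma_fluct k l r o : R :=
  anchor_avg (D r o) (fun i J =>
    qform (m r) J (lam r) (arr (ku k) (y r o) i) (arr (ku l) (y r o) i)) -
  pop_avg (m r) (fun i J =>
    qform (m r) J (lam r) (arr (ku k) (y r o) i) (arr (ku l) (y r o) i)).

Lemma sbd_Sigma_fluct k l : sbd P (fun r o => `|Sigma_fluct k l r o|) (fun r => rsqrt (s r)).
Proof.
apply: (sbd_anchor_fluct O_iid scheme s_gt0 m_range
  (K := fun oo => 5 * (ku k oo ^+ 4 + ku l oo ^+ 4)) _ _
  (f := fun r z i J => qform (m r) J (lam r) (arr (ku k) z i) (arr (ku l) z i))).
- by apply: measurable_funM => //; apply: measurable_funD; exact: measurable_funX.
- by apply: rintegrableZ; exact: rintegrableD.
- move=> r i J; apply: measurable_funB; apply: measurable_funM => //.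
    by apply: measurable_funM; exact: measurable_pmean.
  apply: (measurable_pmean m J i (K := fun oo => ku k oo * ku l oo)).
  exact: measurable_funM.
- move=> r z i J; rewrite inE => /andP[/eqP cJ _].
  exact: qform_sqr.
Qed.

Let bias_bound r : `|bias_coef (n r) (m r) alpha| <= 1 /\
  `|1 - bias_coef (n r) (m r) alpha| <= 2.
Proof.
have := lam01 r; rewrite /lam /bias_coef.
move: (debias_coef _ _ _) => c /andP[c0 c1].
have mi0 : 0 <= (m r)%:R^-1 :> R by rewrite invr_ge0.
have mi1 : (m r)%:R^-1 <= 1 :> R by rewrite invf_le1 ?ltr0n ?ler1n.
move: ((m r)%:R^-1) mi0 mi1 => b b0 b1.
by split; rewrite ler_norml; apply/andP; split; nra.
Qed.

Lemma sbd_Sigma_rest k l : sbd P (fun r o =>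
    `|Sigma_hat G (@x r o) (theta_hat r o) (m r) (D r o) alpha k l -
      (Sigma_pop P O eta k l +
       bias_coef (n r) (m r) alpha * (uu_pop k l - Sigma_pop P O eta k l)) -
      Sigma_fluct k l r o|) (fun r => rsqrt (n r)).
Proof.
(* The majorant that [qform_lipschitz] yields for the two entries of u. *)
pose Lam oo := 3 * ((1 + rho) * `|L oo| ^+ 2 + 2^-1 * (ku k oo ^+ 2 + ku l oo ^+ 2)).
have mLam : measurable_fun setT Lam.
  apply: measurable_funM => //; apply: measurable_funD; apply: measurable_funM => //.
    by apply: measurable_funX; exact: measurableT_comp.
  by apply: measurable_funD; exact: measurable_funX.
have Lam0 oo : 0 <= Lam oo.
  by rewrite mulr_ge0// addr_ge0// mulr_ge0 ?addr_ge0 ?sqr_ge0// ?invr_ge0// ltW.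
have Lami : rintegrable P (fun o => Lam (O 0%N o, O 1%N o)).
  apply: rintegrableZ; apply: rintegrableD; apply: rintegrableZ; last exact: rintegrableD.
  by under [fun o => _]eq_fun do rewrite real_normK ?num_real//.
have S1 := sbd_err mLam Lam0 Lami.
have S2 : sbd P (fun r o => `|ustat3 (fun i j _ : 'I_(n r) =>
    ku k (O i o, O j o) * ku l (O i o, O j o)) - uu_pop k l|) (fun r => rsqrt (n r)).
  have := sbd_ustat O_iid n_infty (g := fun t => ku k (t.1, t.2.1) * ku l (t.1, t.2.1)).
  rewrite mxE; apply; last exact: prod4.
  by apply: measurable_funM; apply: measurableT_comp => //;
    apply: measurable_fun_pair => //; exact: measurableT_comp.
have S3 : sbd P (fun r o => `|ustat3 (fun i j h : 'I_(n r) =>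
    ku k (O i o, O j o) * ku l (O i o, O h o)) - Sigma_pop P O eta k l|) (fun r => rsqrt (n r)).
  have := sbd_ustat O_iid n_infty (g := fun t => ku k (t.1, t.2.1) * ku l (t.1, t.2.2)).
  rewrite Sigma_popE; apply; last exact: prod4.
  by apply: measurable_funM; apply: measurableT_comp => //;
    apply: measurable_fun_pair => //; exact: measurableT_comp.
have two0 : 0 <= 2 :> R by [].
apply: sbd_le_wp wp_good _ (sbdD S1 (sbdD (sbdZ two0 S3) S2)).
near=> r => o go.
have n2 : (2 < n r)%N by near: r.
rewrite (Sigma_hat_entry G (@x r o) (theta_hat r o) (m_gt0 r) (fun a => good_card a go)).
rewrite /Sigma_fluct !arrE (pop_avg_qform n2 (m_gt0 r) (m_lt r)).
apply: le_trans (norm_four _ _ _ _) _; apply: lerD.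
  apply: anchor_avg_lip => a.
  apply: (qform_lipschitz (m_gt0 r) (good_card a go) (lam01 r)) => [|j jD].
    by apply/andP; split; [exact: normr_ge0|case: go].
  have [Hu _] := good_lip go jD.
  by split; [exact: normr_ge0|split; exact: Hu].
have [c1 c2] := bias_bound r.
move: c1 c2 (uu_pop k l) (Sigma_pop P O eta k l) (ustat3 _) (ustat3 _).
move: (bias_coef _ _ _) => c c1 c2 q sg q' w'.
(* The population error combines the errors of the two U-statistics with weights that [bias_bound]
   bounds uniformly in r. *)
have -> : w' + c * (q' - w') - (sg + c * (q - sg)) = (1 - c) * (w' - sg) + c * (q' - q) by ring.
apply: le_trans (ler_normD _ _) _; rewrite !normrM; apply: lerD.
  by rewrite ler_wpM2r.
by rewrite -[leRHS]mul1r ler_wpM2r.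
Unshelve. all: by end_near. Qed.

Let Sh r o := Sigma_hat G (@x r o) (theta_hat r o) (m r) (D r o) alpha.

Lemma Sigma_hat_decomp : exists2 X : nat -> Omega -> 'M[R]_(dim_theta T p),
  sbd P (fun r o => `|X r o|) (fun r => rsqrt (s r)) &
  sbd P (fun r o => `|Sh r o - (Sigma_pop P O eta +
      bias_coef (n r) (m r) alpha *: (uu_pop - Sigma_pop P O eta)) - X r o|)
    (fun r => rsqrt (n r)).
Proof.
exists (fun r o => \matrix_(k, l) Sigma_fluct k l r o); apply: sbd_mx => k l.
  apply: sbd_le (sbd_Sigma_fluct k l).
  by apply: nearW => r o; rewrite mxE.
apply: sbd_le (sbd_Sigma_rest k l); apply: nearW => r o.
rewrite !subr_entry [X in _ - X - _]mxE [X in _ - (_ + X) - _]mxE subr_entry.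
by rewrite [X in _ - X]mxE.
Qed.

(** The rate [a] is free, so that the random designs and the design of all pairs share one
    statement. With n and s tending to infinity, [B_hat] enters the ball where [sandwich_lipschitz]
    applies. *)
Lemma V_hat_rate a K : B_pop P G O theta0 \in unitmx -> s @ \oo --> \oo ->
  (\forall r \near \oo, rsqrt (s r) <= K * a r) ->
  (\forall r \near \oo, rsqrt (n r) <= K * a r) ->
  (\forall r \near \oo, `|bias_coef (n r) (m r) alpha| <= K * a r) ->
  sbd P (fun r o => `|V_hat G (@x r o) (theta_hat r o) (m r) (D r o) alpha -
    sandwich (B_pop P G O theta0) (Sigma_pop P O eta)|) a.
Proof.
move=> uB s_infty sa na ca.
have [c [C [c0 C0 HC]]] := sandwich_lipschitz (Sigma_pop P O eta) uB.
have rs0 (k : nat -> nat) r : 0 <= rsqrt (k r) :> R by rewrite invr_ge0 sqrtr_ge0.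
have [XB XB1 XB2] := B_hat_decomp.
have HB b : (\forall r \near \oo, rsqrt (s r) <= b r) ->
    (\forall r \near \oo, rsqrt (n r) <= b r) ->
    sbd P (fun r o => `|Bh r o - B_pop P G O theta0|) b.
  move=> sb nb.
  apply: (sbd_le (N := fun r o => `|XB r o| + `|Bh r o - B_pop P G O theta0 - XB r o|)).
    by apply: nearW => r o; apply: le_trans (ler_normD _ _); rewrite (addrC (XB r o)) subrK.
  apply: sbdD.
    apply: (@sbd_rate _ _ _ P 1) XB1.
    by apply: filterS sb => r sb; rewrite rs0 mul1r.
  apply: (@sbd_rate _ _ _ P 1) XB2.
  by apply: filterS nb => r nb; rewrite rs0 mul1r.
have wpB : wp_to_one P (fun r => [set o | `|Bh r o - B_pop P G O theta0| <= c]).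
  apply: (sbd_wp (a := fun r => rsqrt (s r) + rsqrt (n r)) c0).
  - rewrite -[X in _ --> X](addr0 (0 : R)); apply: cvgD; exact: rsqrt_cvg0.
  - by move=> r; rewrite addr_ge0 ?rs0.
  - by apply: HB; apply: nearW => r; rewrite ?lerDl ?lerDr rs0.
have [X X1 X2] := Sigma_hat_decomp.
have HKB : sbd P (fun r o => `|Bh r o - B_pop P G O theta0|) (fun r => K * a r) by exact: HB.
have rate b : (\forall r \near \oo, 0 <= b r <= K * a r) -> forall N,
    sbd P N b -> sbd P N (fun r => K * a r).
  by move=> bK N'; apply: (@sbd_rate _ _ _ P 1); apply: filterS bK => r; rewrite mul1r.
have HS : sbd P (fun r o => `|Sh r o - Sigma_pop P O eta|) (fun r => K * a r).
  apply: (sbd_le (N := fun r o => `|X r o| + (`|Sh r o - (Sigma_pop P O eta +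
      bias_coef (n r) (m r) alpha *: (uu_pop - Sigma_pop P O eta)) - X r o| +
      `|uu_pop - Sigma_pop P O eta| * `|bias_coef (n r) (m r) alpha|))).
    apply: nearW => r o; rewrite [X in _ + (_ + X)]mulrC -normrZ.
    apply: le_trans (lerD (lexx _) (ler_normD _ _)); apply: le_trans (ler_normD _ _).
    have dec (V : zmodType) (g b e u : V) : g + (b - (e + u) - g + u) = b - e.
      by rewrite addrA (addrC g) subrK opprD addrA subrK.
    by rewrite dec.
  apply: sbdD; first by apply: rate X1; apply: filterS sa => r ->; rewrite rs0.
  apply: sbdD; first by apply: rate X2; apply: filterS na => r ->; rewrite rs0.
  apply: (@sbd_cst _ _ _ P (`|uu_pop - Sigma_pop P O eta|)).
  by apply: filterS ca => r ca o; rewrite ler_wpM2l.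
have : sbd P (fun r o => `|V_hat G (@x r o) (theta_hat r o) (m r) (D r o) alpha -
    sandwich (B_pop P G O theta0) (Sigma_pop P O eta)|) (fun r => K * a r).
  apply: sbd_le_wp wpB _ (sbdZ C0 (sbdD HKB HS)).
  by apply: nearW => r o; exact: HC.
(* The factor [K] passes from the rate into the constant. *)
move=> H eps /H[C' HC']; exists (C' * K); apply: filterS HC' => r [F [mF PF HF]].
by exists F; split => // o /HF; rewrite mulrA.
Qed.

End Debiasing.

End Asymptotics.

(** * Moments from the tails, and deterministic rates *)

(** The square of [sigma] is measurable as a version of a conditional expectation, and [sigma],
    being nonnegative, is its root. *)
Lemma cond_sd_measurable d d' (Omega : measurableType d) (E : measurableType d') (R : realType)
    (P : probability Omega R) (W : Omega -> E) (X : Omega -> R) (sigma : E -> R) :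
  cond_sd P W X sigma -> measurable_fun setT sigma.
Proof.
move=> [s0 [mu _ /cond_exp_measurable ms]].
rewrite (_ : sigma = Num.sqrt \o (fun x => sigma x ^+ 2)); last first.
  by apply/funext => x /=; rewrite sqrtr_sqr ger0_norm.
by apply: measurableT_comp ms; apply: continuous_measurable_fun; exact: sqrt_continuous.
Qed.

Section SubGaussian.
Context {d : measure_display} {Omega : measurableType d} {R : realType}.
Variables (P : probability Omega R) (X : Omega -> R).
Hypotheses (mX : measurable_fun setT X) (X_tail : sub_gaussian P X).

Lemma sub_gaussian_moments :
  rintegrable P (fun o => X o ^+ 2) /\ rintegrable P (fun o => X o ^+ 4).
Proof.
case: X_tail => K K0 HK.
have mY : measurable_fun setT (fun o => expR ((X o / K) ^+ 2)).
  apply: measurableT_comp => //; apply: measurable_funX; exact: measurable_funM.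
have ei : rintegrable P (fun o => expR ((X o / K) ^+ 2)).
  apply/integrableP; split; first exact/measurable_EFinP.
  rewrite expectation.unlock in HK; apply: le_lt_trans (ltry 2).
  rewrite (eq_integral (fun o => (expR ((X o / K) ^+ 2))%:E))// => o _ /=.
  by rewrite ger0_norm// expR_ge0.
(* Applied to y = (X/K)^2, this bounds X^2 and X^4 by the integrable exponential. The 4 comes from
   e^y >= (1 + y/2)^2. *)
have exp2 (y : R) : 0 <= y -> y <= expR y /\ y ^+ 2 <= 4 * expR y.
  move=> y0; have e1 := expR_ge1Dx y; have e2 := expR_ge1Dx (y / 2).
  have eE : expR y = expR (y / 2) ^+ 2 by rewrite -expRM_natl -mulr_natl mulrC divfK.
  split; first lra.
  rewrite eE; apply: (@le_trans _ _ (4 * (1 + y / 2) ^+ 2)); first by nra.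
  by rewrite ler_wpM2l// ler_pXn2r ?nnegrE ?expR_ge0//; lra.
have XE o : X o = K * (X o / K) by rewrite mulrC divfK ?gt_eqF.
split.
- apply: (@rintegrable_le _ _ _ _ _ (fun o => K ^+ 2 * expR ((X o / K) ^+ 2))).
  + exact: measurable_funX.
  + move=> o; rewrite ger0_norm ?sqr_ge0// {1}XE exprMn ler_wpM2l ?sqr_ge0//.
    by have [] := exp2 _ (sqr_ge0 (X o / K)).
  + exact: rintegrableZ.
- apply: (@rintegrable_le _ _ _ _ _ (fun o => K ^+ 4 * 4 * expR ((X o / K) ^+ 2))).
  + exact: measurable_funX.
  + move=> o; rewrite ger0_norm ?exprn_even_ge0// {1}XE exprMn -mulrA.
    rewrite ler_wpM2l ?exprn_even_ge0//.
    by have [_] := exp2 _ (sqr_ge0 (X o / K)); rewrite -exprM.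
  + exact: rintegrableZ.
Qed.

End SubGaussian.

Section Rates.
Context {R : realType}.
Implicit Types (n s : nat).

Lemma rsqrt_ge0 n : 0 <= rsqrt n :> R.
Proof. by rewrite invr_ge0 sqrtr_ge0. Qed.

Lemma rsqrt_sqr n : rsqrt n ^+ 2 = n%:R^-1 :> R.
Proof. by rewrite /rsqrt exprVn sqr_sqrtr. Qed.

Lemma inv_le_rsqrt n : n%:R^-1 <= rsqrt n :> R.
Proof.
rewrite -rsqrt_sqr; case: n => [|n]; first by rewrite /rsqrt sqrtr0 invr0 expr0n.
have r1 : rsqrt n.+1 <= 1 :> R.
  by rewrite invf_le1 ?sqrtr_gt0 ?ltr0n// -[leLHS]sqrtr1 ler_wsqrtr// ler1n.
by rewrite expr2 ler_piMl ?rsqrt_ge0.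
Qed.

Lemma inv_pred_le n : (1 < n)%N -> (n%:R - 1)^-1 <= 2 * n%:R^-1 :> R.
Proof.
move=> n1; have n2 : 2 <= n%:R :> R by rewrite (ler_nat _ 2).
have n0 : 0 < n%:R :> R by lra.
rewrite -[2]invrK -invfM lef_pV2 ?posrE ?mulr_gt0 ?invr_gt0//; lra.
Qed.

Lemma natr_pred n : (0 < n)%N -> n.-1%:R = n%:R - 1 :> R.
Proof. by move=> n0; rewrite -subn1 natrB. Qed.

Lemma rsqrt_le_prop n s (c : R) : 0 < c -> (0 < n)%N -> c * n%:R <= s%:R ->
  rsqrt s <= (Num.sqrt c)^-1 * rsqrt n :> R.
Proof.
move=> c0 n0 H; have n0R : 0 < n%:R :> R by rewrite ltr0n.
rewrite /rsqrt -invfM -(sqrtrM _ (ltW c0)) lef_pV2 ?posrE ?sqrtr_gt0 ?mulr_gt0//.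
  by apply: ler_wsqrtr.
by apply: lt_le_trans H; rewrite mulr_gt0.
Qed.

Lemma proportional_cvg (n s : nat -> nat) (c : R) : 0 < c -> n @ \oo --> \oo ->
  (\forall r \near \oo, c * (n r)%:R <= (s r)%:R) -> s @ \oo --> \oo.
Proof.
move=> c0 n_infty H; apply/cvgnyPge => A; near=> r.
have nA : (Num.truncn (A%:R / c) < n r)%N by near: r; move/cvgnyPgt : n_infty; apply.
have nR : A%:R / c < (n r)%:R by apply: lt_le_trans (truncnS_gt _) _; rewrite ler_nat.
rewrite -(ler_nat R); apply: (@le_trans _ _ (c * (n r)%:R)); last by near: r.
by rewrite mulrC -ler_pdivrMr// ltW.
Unshelve. all: by end_near. Qed.

End Rates.

(** In the full design each unit is an anchor once with n - 1 partners, so the partner means divide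
    by n - 1; [alpha] is 0 since [Sigma_full] has no correction. *)
Lemma V_full_design (R : realType) T p (G : gee_model R T p) n
    (x : 'I_n -> unit_data R T p) theta :
  (0 < n)%N -> V_full G x theta = V_hat G x theta n.-1 (full_design n) 0.
Proof.
move=> n0.
have meanE (V : lmodType R) (F : 'I_n -> 'I_n -> V) i :
    n.-1%:R^-1 *: \sum_(j in (full_design n).2 i) F ((full_design n).1 i) j =
    (n%:R - 1)^-1 *: \sum_(j < n | j != i) F i j.
  rewrite natr_pred// [(full_design n).1 i]ffunE; congr (_ *: _).
  by apply: eq_bigl => j; rewrite ffunE !inE.
have BE : B_hat G x theta n.-1 (full_design n) = B_full G x theta.
  apply: (congr1 ( *:%R _)); apply: eq_bigr => i _.
  exact: (meanE _ (fun i j => B_fun G theta (x i) (x j)) i).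
have uE i : u_bar G x theta n.-1 (full_design n) i = u_full G x theta i.
  exact: (meanE _ (fun i j => u_fun G theta (x i) (x j)) i).
have SE : Sigma_hat G x theta n.-1 (full_design n) 0 = Sigma_full G x theta.
  rewrite /Sigma_hat /Sigma_full (mul0r (_ - _)) scale0r subr0.
  by apply: (congr1 ( *:%R _)); apply: eq_bigr => i _; rewrite uE.
by rewrite /V_full /V_hat BE SE.
Qed.

Theorem theorem6
  (R : realType) (d : measure_display) (Omega : measurableType d)
  (P : probability Omega R)
  (T p : nat) (T_gt0 : (0 < T)%N)
  (* the i.i.d. units *)
  (O : nat -> Omega -> unit_data R T p) (O_iid : iid P O)
  (unconfounded :
     cond_indep P (fun omega => cov (O 0%N omega))
       (fun omega => pot (O 0%N omega)) (fun omega => trt (O 0%N omega)))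
  (positivity :
     exists2 e : covariates R T p -> R,
       cond_exp P (fun omega => cov (O 0%N omega))
         (fun omega => trtR (O 0%N omega)) e &
       {ae P, forall omega, 0 < e (cov (O 0%N omega)) < 1})
  (* target and working models *)
  (G : gee_model R T p)
  (varphi_monotone :
     {homo varphi G : x y / x <= y} \/ {homo varphi G : x y /~ x <= y})
  (varphi_L2 : forall t,
     ('E_P[fun omega => (contrast G (O 0%N omega) (O 1%N omega) t ^+ 2)%R] < +oo)%E)
  (link_pi_derivable : forall x : R, derivable (link_pi G) x 1)
  (link_pi_range : forall x : R, 0 < link_pi G x < 1)
  (link_g_derivable : forall x : R, derivable (link_g G) x 1)
  (sd_hP : forall theta (k : 'I_(dim_h T)),
     cond_sd P (fun omega => (cov (O 0%N omega), cov (O 1%N omega)))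
       (fun omega => h_fun G theta (O 0%N omega) (O 1%N omega) k 0)
       (fun ww => sd_h G theta ww k))
  (work_corrP : correlation_mx (work_corr G))
  (work_corr1 : T = 1%N -> work_corr G = 1%:M)
  (* the true parameter *)
  (theta0 : 'rV[R]_(dim_theta T p))
  (delta_true : forall t,
     ('E_P[fun omega => contrast G (O 0%N omega) (O 1%N omega) t] =
      (delta_of theta0 0%R t)%:E)%E)
  (u_centered : forall k,
     ('E_P[fun omega => u_fun G theta0 (O 0%N omega) (O 1%N omega) k 0%R] = 0)%E)
  (B_inv : B_pop P G O theta0 \in unitmx)
  (* tails and local regularity *)
  (u_tail : forall k, sub_gaussian P
     (fun omega => u_fun G theta0 (O 0%N omega) (O 1%N omega) k 0))
  (B_tail : forall k l, sub_gaussian P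
     (fun omega => B_fun G theta0 (O 0%N omega) (O 1%N omega) k l))
  (regular : local_L2_lipschitz P G O theta0)
  (* eta(O_i) = E(u_ij | O_i) *)
  (eta : unit_data R T p -> 'cV[R]_(dim_theta T p))
  (etaP : forall k, cond_exp P (O 0%N)
     (fun omega => u_fun G theta0 (O 0%N omega) (O 1%N omega) k 0)
     (fun o => eta o k 0))
  (* sample sizes, numbers of anchors and of partners *)
  (repl : bool) (n s m : nat -> nat)
  (n_gt1 : forall r, (1 < n r)%N) (n_infty : n @ \oo --> \oo)
  (s_gt0 : forall r, (0 < s r)%N) (s_le : forall r, repl || (s r <= n r)%N)
  (m_range : forall r, (0 < m r < n r)%N)
  (* the estimate of theta *)
  (est : forall r, (n r).-tuple (unit_obs R T p) -> 'rV[R]_(dim_theta T p))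
  (est_meas : forall r k, measurable_fun setT (fun y => est r y 0 k)) :
  let x r omega (i : 'I_(n r)) := O i omega in
  let theta_hat r omega := est r [tuple observe (O i omega) | i < n r] in
  forall
  (theta_hat_sol :
     wp_to_one P (fun r => [set omega |
       est_eq G (x r omega) (theta_hat r omega) = 0]))
  (theta_hat_cons :
     bigOp P (fun r omega => theta_hat r omega - theta0) (fun r => rsqrt (n r)))
  (* the random design: uniform and independent of the data *)
  (D : forall r, Omega -> design (n r) (s r))
  (D_meas : forall r (D0 : design (n r) (s r)), measurable (D r @^-1` [set D0]))
  (D_law : forall r (D0 : design (n r) (s r))
       (E : set ((n r).-tuple (unit_data R T p))), measurable E ->
     (P ([set omega | E [tuple O i omega | i < n r]] `&` D r @^-1` [set D0]) =
      P [set omega | E [tuple O i omega | i < n r]] *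
      ((D0 \in designs repl (n r) (s r) (m r))%:R /
       #|designs repl (n r) (s r) (m r)|%:R)%:E)%E),
  let B := B_pop P G O theta0 in
  let Sigma := Sigma_pop P O eta in
  let V := sandwich B Sigma in
  let Bh r omega :=
    B_hat G (x r omega) (theta_hat r omega) (m r) (D r omega) in
  let Sigmah alpha r omega :=
    Sigma_hat G (x r omega) (theta_hat r omega) (m r) (D r omega) alpha in
  let Vh alpha r omega :=
    V_hat G (x r omega) (theta_hat r omega) (m r) (D r omega) alpha in
  let debiasable := \forall r \near \oo, (1 < m r)%N in
  let s_infty := s @ \oo --> \oo in
  [/\ (exists X1 X2 X3 : nat -> Omega -> 'M[R]_(dim_theta T p),
         [/\ (forall r omega,
                Bh r omega - B = X1 r omega + X2 r omega + X3 r omega),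
             bigOp P X1 (fun r => rsqrt (s r)),
             bigOp P X2 (fun r => rsqrt (s r * m r)) &
             bigOp P X3 (fun r => rsqrt (n r))]),
      (exists (X1 X2 : nat -> Omega -> 'M[R]_(dim_theta T p))
              (Y1 Y2 : nat -> 'M[R]_(dim_theta T p)),
         [/\ (forall r omega,
                Sigmah 0 r omega - Sigma =
                X1 r omega + X2 r omega + Y1 r + Y2 r),
             bigOp P X1 (fun r => rsqrt (s r)),
             bigOp P X2 (fun r => rsqrt (n r)),
             Y1 =O_\oo (fun r => (m r)%:R^-1 : R) &
             Y2 =O_\oo (fun r => (n r)%:R^-1 : R)]),
      (debiasable ->
       exists (X1 X2 : nat -> Omega -> 'M[R]_(dim_theta T p))
              (Y2 : nat -> 'M[R]_(dim_theta T p)),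
         [/\ (forall r omega,
                Sigmah 1 r omega - Sigma = X1 r omega + X2 r omega + Y2 r),
             bigOp P X1 (fun r => rsqrt (s r)),
             bigOp P X2 (fun r => rsqrt (n r)) &
             Y2 =O_\oo (fun r => (n r)%:R^-1 : R)]),
      (s_infty ->
         bigOp P (fun r omega => Vh 0 r omega - V)
           (fun r => rsqrt (s r) + rsqrt (s r * m r) + rsqrt (n r)
                     + (m r)%:R^-1 + (n r)%:R^-1) /\
         (debiasable ->
          bigOp P (fun r omega => Vh 1 r omega - V)
            (fun r => rsqrt (s r) + rsqrt (s r * m r) + rsqrt (n r)
                      + (n r)%:R^-1))) &
      (debiasable ->
       (exists c1 c2 : R, 0 < c1 /\
          \forall r \near \oo, c1 * (n r)%:R <= (s r)%:R <= c2 * (n r)%:R) ->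
         bigOp P (fun r omega => Vh 1 r omega - V) (fun r => rsqrt (n r))) /\
      bigOp P (fun r omega =>
          V_full G (x r omega) (theta_hat r omega) - V)
        (fun r => rsqrt (n r))].
Proof.
move=> x theta_hat _ cons D D_meas D_law B Sigma V Bh Sigmah Vh debiasable s_infty.
have mO i : measurable_fun setT (O i) := iid_measurable O_iid i.
have m01 : measurable_fun setT (fun o => (O 0%N o, O 1%N o)) by exact: measurable_fun_pair.
have msd theta k : measurable_fun setT (fun ww => sd_h G theta ww k).
  exact: cond_sd_measurable (sd_hP theta k).
have meas_u k : measurable_fun setT (ku G theta0 k).
  exact: (measurable_u_fun varphi_monotone link_pi_derivable link_g_derivable msd
    measurable_fst measurable_snd).
have meas_B k l : measurable_fun setT (kB G theta0 k l).
  exact: (measurable_B_fun varphi_monotone link_pi_derivable link_pi_range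
    link_g_derivable msd measurable_fst measurable_snd).
have u4 k : rintegrable P (fun o => ku G theta0 k (O 0%N o, O 1%N o) ^+ 4).
  exact: (sub_gaussian_moments (measurableT_comp (meas_u k) m01) (u_tail k)).2.
have B2 k l : rintegrable P (fun o => kB G theta0 k l (O 0%N o, O 1%N o) ^+ 2).
  exact: (sub_gaussian_moments (measurableT_comp (meas_B k l) m01) (B_tail k l)).1.
have u0 k : rexp P (fun o => ku G theta0 k (O 0%N o, O 1%N o)) = 0.
  by have := u_centered k; rewrite expectation.unlock /rexp /ku => ->.
have [rho [N [L [rho0 [mN PN] mL L2lty lip]]]] := regular.
have L2 : rintegrable P (fun o => L (O 0%N o, O 1%N o) ^+ 2).
  apply: rintegrable_sqr_lty; first exact: measurableT_comp mL m01.
  by rewrite expectation.unlock in L2lty.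
have scheme : sampling_scheme P O m D (@uniform_weight R n repl s m).
  exact: uniform_scheme.
have n_gt0 r : (0 < n r)%N by exact: ltn_trans (n_gt1 r).
have HB := B_hat_decomp O_iid meas_B B2 rho0 mN PN mL L2 lip
  scheme n_infty s_gt0 m_range cons.
have HS alpha lam01 := Sigma_hat_decomp O_iid meas_u u4 rho0 mN PN mL L2 lip u0 etaP
  scheme n_infty s_gt0 m_range cons (alpha := alpha) lam01.
have HV alpha lam01 a K := V_hat_rate O_iid meas_u meas_B u4 B2 rho0 mN PN mL L2 lip u0 etaP
  scheme n_infty s_gt0 m_range cons (alpha := alpha) lam01 (a := a) (K := K) B_inv.
have lam0 (m' : nat -> nat) r : 0 <= debias_coef (n r) (m' r) (0 : R) <= 1.
  by rewrite debias_coef0 lexx ler01.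
have lam1 r : 0 <= debias_coef (n r) (m r) (1 : R) <= 1.
  by have /andP[m0 mn] := m_range r; exact: debias_coef1_itv.
have bias1 : debiasable -> \forall r \near \oo,
    bias_coef (n r) (m r) (1 : R) = ((n r)%:R - 1)^-1.
  apply: filterS => r m1; have /andP[m0 mn] := m_range r; exact: bias_coef1.
have bias1_le : debiasable -> \forall r \near \oo,
    `|bias_coef (n r) (m r) (1 : R)| <= 2 * (n r)%:R^-1.
  move=> /bias1; apply: filterS => r ->; rewrite ger0_norm ?inv_pred_le//.
  by rewrite invr_ge0 subr_ge0 ler1n.
have O0 (a : nat -> R) : (fun=> 0 : 'M[R]_(dim_theta T p)) =O_\oo a.
  apply/eqO_exP; exists 1 => //; apply: nearW => r.
  by rewrite normr0 mul1r.
have op0 a : (forall r, 0 <= a r) -> bigOp P (fun _ _ => 0 : 'M[R]_(dim_theta T p)) a.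
  move=> a0; apply: (@sbd_cst _ _ _ P 0).
  by apply: nearW => r o; rewrite normr0 mul0r.
split.
- have [X X1 X2] := HB.
  (* [X] already contains the sampling of the partners: as m >= 1, the order (sm)^(-1/2) is
     dominated by s^(-1/2), and the middle term is taken to be 0. *)
  exists X, (fun _ _ => 0), (fun r o => Bh r o - B - X r o); split => //.
    by move=> r o; rewrite addr0 [RHS]addrC subrK.
  by apply: op0 => r; exact: rsqrt_ge0.
- have [X X1 X2] := HS 0 (lam0 m).
  (* The centring value differs from Sigma by exactly 1/m times a fixed matrix, so the term of order
     1/n can be 0. *)
  exists X, (fun r o => Sigmah 0 r o - (Sigma +
      bias_coef (n r) (m r) 0 *: (uu_pop P O G theta0 - Sigma)) - X r o),
    (fun r => bias_coef (n r) (m r) 0 *: (uu_pop P O G theta0 - Sigma)), (fun=> 0); split => //.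
    by move=> r o; rewrite addr0 (addrC (X r o)) subrK opprD addrA subrK.
  apply/eqO_exP; exists (`|uu_pop P O G theta0 - Sigma| + 1); first by rewrite ltr_wpDl.
  apply: nearW => r; rewrite bias_coef0 normrZ mulrC.
  by rewrite ler_wpM2r// lerDl.
- move=> dm; have [X X1 X2] := HS 1 lam1.
  pose U := uu_pop P O G theta0 - Sigma.
  pose c r := bias_coef (n r) (m r) (1 : R).
  (* The remaining bias, eventually U/(n-1), is absorbed into the term of order n^(-1/2). *)
  exists X, (fun r o => (Sigmah 1 r o - (Sigma + c r *: U) - X r o) + c r *: U), (fun=> 0).
  split => //.
    by move=> r o; rewrite addr0 [RHS]addrA (addrC (X r o)) subrK opprD [in RHS]addrA subrK.
  apply: (sbd_le (N := fun r o => `|Sigmah 1 r o - (Sigma + c r *: U) - X r o| + `|c r *: U|)).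
    by apply: nearW => r o; exact: ler_normD.
  apply: sbdD => //; apply: (@sbd_cst _ _ _ P (2 * `|U|)).
  move: (bias1_le dm); apply: filterS => r cr o; rewrite normrZ.
  rewrite mulrAC; apply: ler_wpM2r => //; apply: le_trans cr _.
  by rewrite ler_wpM2l// inv_le_rsqrt.
- have a0 r : [/\ 0 <= rsqrt (s r) :> R, 0 <= rsqrt (s r * m r) :> R,
      0 <= rsqrt (n r) :> R, 0 <= (m r)%:R^-1 :> R & 0 <= (n r)%:R^-1 :> R].
    by rewrite !rsqrt_ge0 !invr_ge0 !ler0n.
  move=> s_inf; split=> [|dm].
    (* Constant 1: without de-biasing the bias coefficient is 1/m, itself a summand of the rate. *)
    apply: (HV 0 (lam0 m) _ 1 s_inf); apply: nearW => r; have [? ? ? ? ?] := a0 r; [lra|lra|].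
    by rewrite bias_coef0 ger0_norm//; lra.
  (* Constant 2, from 1/(n-1) <= 2/n. *)
  apply: (HV 1 lam1 _ 2 s_inf); last first.
    move: (bias1_le dm); apply: filterS => r cr; have [? ? ? ? ?] := a0 r; lra.
  + by apply: nearW => r; have [? ? ? ? ?] := a0 r; lra.
  + by apply: nearW => r; have [? ? ? ? ?] := a0 r; lra.
- split=> [dm [c1 [c2 [c10 Hs]]]|].
    have Hs1 : \forall r \near \oo, c1 * (n r)%:R <= (s r)%:R.
      by apply: filterS Hs => r /andP[].
    (* The first value converts s^(-1/2) into n^(-1/2) when s >= c1 n; the second bounds the bias
       1/(n-1). *)
    pose K := Num.max (Num.sqrt c1)^-1 2.
    apply: (HV 1 lam1 _ K (proportional_cvg c10 n_infty Hs1)).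
    + apply: filterS Hs1 => r /(rsqrt_le_prop c10 (n_gt0 r)) H; apply: le_trans H _.
      by rewrite ler_wpM2r ?rsqrt_ge0// le_max lexx.
    + apply: nearW => r; rewrite ler_peMl ?rsqrt_ge0// le_max; apply/orP; right; lra.
    + move: (bias1_le dm); apply: filterS => r cr; apply: le_trans cr _.
      apply: (@le_trans _ _ (2 * rsqrt (n r))); first by rewrite ler_wpM2l// inv_le_rsqrt.
      by rewrite ler_wpM2r ?rsqrt_ge0// le_max lexx orbT.
  have m_range' r : (0 < (n r).-1 < n r)%N.
    by have := n_gt1 r; case: (n r) => [|[|k]]//= _; rewrite ltnSn.
  (* Here s = n and m = n - 1, so even with [alpha := 0] the bias 1/m is of order 1/n. *)
  have HF := V_hat_rate O_iid meas_u meas_B u4 B2 rho0 mN PN mL L2 lip u0 etaP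
    (full_scheme P O n_gt1) n_infty n_gt0 m_range' cons (alpha := 0)
    (lam0 (fun r => (n r).-1)) (a := fun r => rsqrt (n r)) (K := 2) B_inv n_infty.
  apply: (sbd_le _ (HF _ _ _)).
  + by apply: nearW => r o; rewrite V_full_design.
  + by apply: nearW => r; rewrite ler_peMl ?rsqrt_ge0//; lra.
  + by apply: nearW => r; rewrite ler_peMl ?rsqrt_ge0//; lra.
  + apply: nearW => r; rewrite bias_coef0 ger0_norm ?invr_ge0// natr_pred//.
    apply: le_trans (inv_pred_le (n_gt1 r)) _.
    by rewrite ler_wpM2l// inv_le_rsqrt.
Qed.
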